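(* Let $S(\lambda,t_2)$ be an $n\times n$ matrix function, rational in $\lambda$, which for each fixed $\lambda$ maps solutions of $\lambda\sigma_2u-\sigma_1u'+\gamma u=0$ to solutions of $\lambda\sigma_2y-\sigma_1y'+\gamma_*y=0$, and suppose additionally that 1. $S(\infty,t_2)=I$; 2. $S(\lambda,t_2)\sigma_1^{-1}S^*(\lambda,t_2)\ge\sigma_1^{-1}$ for $\Re\lambda>0$; 3. $S(\lambda,t_2)\sigma_1^{-1}S^*(-\bar\lambda,t_2)=\sigma_1^{-1}$ for all $t_2$. Then there exists a conservative vessel with $S(\lambda,t_2)$ as the transfer function. In this case $$S(\lambda,t_2)=I+C(t_2)(\lambda I+A_1)^{-1}C^*(t_2)\sigma_1,$$ where $C(t_2)$ satisfies the output differential equation with the matrix parameter $A_1$, i.e. $\sigma_1C'(t_2)=\sigma_2C(t_2)A_1+\gamma_*C(t_2)$.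
   Context: $I\subseteq\mathbb R$ is an interval with variable $t_2$, prime is $\frac{d}{dt_2}$, $\mathcal E=\mathbb C^n$; $\sigma_1,\sigma_2,\gamma,\gamma_*$ are $n\times n$ matrix functions on $I$, $\sigma_1$ absolutely continuous with invertible values, $\sigma_2,\gamma,\gamma_*$ locally integrable, $\sigma_j^*=\sigma_j$, $\gamma^*=-\gamma-\sigma_1'$, $\gamma_*^*=-\gamma_*-\sigma_1'$. $S^*(\mu,t_2)$ means $(S(\mu,t_2))^*$; relations in $\lambda$ are at points of analyticity. In the displayed formula $A_1$ is a matrix, and $C^*(t_2)$ is the adjoint of $C(t_2)$ with respect to an inner product on the finite-dimensional inner space; with $A_1$ kept constant this inner product varies with $t_2$. An evolution semi-group on Hilbert spaces $\mathcal H_t$ is a family of bounded invertible operators $F(t,s):\mathcal H_s\to\mathcal H_t$ with $F(t,s)F(s,r)=F(t,r)$, $F(t,t)=I$. A conservative vessel is a collection $(A_1,F,B;\sigma_1,\sigma_2,\gamma,\gamma_*;\mathcal H_{t_2},\mathcal E)$ where $A_1(t_2)$ is bounded on the Hilbert space $\mathcal H_{t_2}$, $B(t_2):\mathcal E\to\mathcal H_{t_2}$ is bounded, $F$ is an evolution semi-group, $s\mapsto F(t_2,s)B(s)\sigma_2(s)$ and $s\mapsto B^*(s)F(s,t_2)$ are absolutely continuous in operator norm (for almost all $t_2$), and (i) $A_1(t_2)+A_1^*(t_2)+B(t_2)\sigma_1(t_2)B^*(t_2)=0$; (ii) $F^*(t_2,t_2^0)F(t_2,t_2^0)=I-\int_{t_2^0}^{t_2}F^*(s,t_2^0)B(s)\sigma_2(s)B^*(s)F(s,t_2^0)\,ds$;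 (iii) $F(t_2,t_2^0)A_1(t_2^0)=A_1(t_2)F(t_2,t_2^0)$; (iv) $\frac{d}{dt_2}\big(F(t_2^0,t_2)B\sigma_1\big)+F(t_2^0,t_2)A_1B\sigma_2+F(t_2^0,t_2)B\gamma=0$; (v) $\sigma_1\frac{d}{dt_2}\big[B^*F(t_2,t_2^0)\big]-\sigma_2B^*A_1F(t_2,t_2^0)-\gamma_*B^*F(t_2,t_2^0)=0$; (vi) $\gamma_*=\gamma+\sigma_2B^*B\sigma_1-\sigma_1B^*B\sigma_2$. Its transfer function is $I-B^*(t_2)(\lambda I-A_1(t_2))^{-1}B(t_2)\sigma_1(t_2)$.
   Formalization: Condition 2 is assumed for Re λ<0, not Re λ>0; the display has (A₁−λI)⁻¹ in place of (λI+A₁)⁻¹; in the vessel definition F(t₂,s)B(s)σ₁(s), not F(t₂,s)B(s)σ₂(s), is absolutely continuous; (vi) and the differential equations hold almost everywhere. *)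

(* Defs.v *)
From HB Require Import structures.
From mathcomp Require Import all_boot all_order all_algebra.
From mathcomp Require Import sesquilinear spectral complex.
From mathcomp Require Import all_classical all_reals all_analysis.
Import Order.TTheory GRing.Theory Num.Theory.
Import numFieldNormedType.Exports.

Set Implicit Arguments.
Unset Strict Implicit.
Unset Printing Implicit Defensive.

Local Open Scope classical_set_scope.
Local Open Scope ring_scope.
Local Open Scope sesquilinear_scope.
Local Open Scope complex_scope.

(** * Functions of a real variable on an interval [I]

    Functions are total on [R]; only their values on [I] matter. *)

Definition ae_on {R : realType} (I : interval R) (P : R -> Prop) : Prop :=
  {ae (@lebesgue_measure R), forall t, t \in I -> P t}.

(* Absolute continuity on every compact subinterval of [I], for a function
   with values in a space with distance [d]. *)
Definition loc_abs_cont {R : realType} {T : Type} (d : T -> T -> R)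
    (I : interval R) (f : R -> T) : Prop :=
  forall a b, a \in I -> b \in I ->
  forall e, 0 < e -> exists2 delta, 0 < delta &
    forall (k : nat) (x y : 'I_k -> R),
      (forall i, a <= x i /\ x i <= y i /\ y i <= b) ->
      (forall i j : 'I_k, (i < j)%N -> y i <= x j) ->
      \sum_i (y i - x i) < delta ->
      \sum_i d (f (x i)) (f (y i)) < e.

Definition mx_dist {R : realType} {m n : nat} (A B : 'M[R[i]]_(m, n)) : R :=
  \sum_i \sum_j Normc.normc (A i j - B i j).

Definition mx_loc_abs_cont {R : realType} {m n : nat} (I : interval R)
    (f : R -> 'M[R[i]]_(m, n)) : Prop :=
  loc_abs_cont mx_dist I f.

Definition mx_loc_integrable {R : realType} {m n : nat} (I : interval R)
    (f : R -> 'M[R[i]]_(m, n)) : Prop :=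
  forall a b, a \in I -> b \in I -> forall i j,
    (@lebesgue_measure R).-integrable `[a, b]
      (fun t => (complex.Re (f t i j))%:E) /\
    (@lebesgue_measure R).-integrable `[a, b]
      (fun t => (complex.Im (f t i j))%:E).

Definition mx_deriv {R : realType} {m n : nat}
    (f : R -> 'M[R[i]]_(m, n)) (t : R) (D : 'M[R[i]]_(m, n)) : Prop :=
  forall i j,
    is_derive t (1 : R) (fun s => complex.Re (f s i j)) (complex.Re (D i j)) /\
    is_derive t (1 : R) (fun s => complex.Im (f s i j)) (complex.Im (D i j)).

(* The oriented integral of a complex function from [a] to [b]. *)
Definition oint {R : realType} (a b : R) (f : R -> R[i]) : R[i] :=
  let int_ c d g := Rintegral (@lebesgue_measure R) `[c, d] g in
  if a <= b
  then int_ a b (fun s => complex.Re (f s)) +i*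
       int_ a b (fun s => complex.Im (f s))
  else - (int_ b a (fun s => complex.Re (f s)) +i*
          int_ b a (fun s => complex.Im (f s))).

(** * Matrices and rational matrix functions *)

(* In the order of [R[i]], [0 <= z] means that [z] is a nonnegative real, so
   this includes that [A] is Hermitian. *)
Definition psdmx {R : realType} {n : nat} (A : 'M[R[i]]_n) : Prop :=
  forall v : 'cV[R[i]]_n, 0 <= (v^t* *m A *m v) 0 0.

Definition is_quotient {R : realType} {n : nat} (f : R[i] -> 'M[R[i]]_n)
    (P : 'M[{poly R[i]}]_n) (q : {poly R[i]}) : Prop :=
  forall z, q.[z] != 0 -> f z = q.[z]^-1 *: map_mx (horner_eval z) P.

Definition rationalmx {R : realType} {n : nat} (f : R[i] -> 'M[R[i]]_n) : Prop :=
  exists P q, q != 0 /\ is_quotient f P q.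

(* The points of analyticity of a rational [f]; the values of [f] elsewhere
   are irrelevant. *)
Definition analytic_at {R : realType} {n : nat} (f : R[i] -> 'M[R[i]]_n)
    (z : R[i]) : Prop :=
  exists P q, q.[z] != 0 /\ is_quotient f P q.

Definition lim_at_infinity {R : realType} {n : nat} (f : R[i] -> 'M[R[i]]_n)
    (L : 'M[R[i]]_n) : Prop :=
  forall e : R, 0 < e -> exists r : R, forall z,
    r < Normc.normc z -> mx_dist (f z) L < e.

(** * The differential equations [z s2 u - s1 u' + g u = 0] *)

Definition solution {R : realType} {n : nat} (I : interval R)
    (s1 s2 g : R -> 'M[R[i]]_n) (z : R[i]) (u : R -> 'cV[R[i]]_n) : Prop :=
  mx_loc_abs_cont I u /\
  ae_on I (fun t => exists2 u', mx_deriv u t u' &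
    z *: (s2 t *m u t) - s1 t *m u' + g t *m u t = 0).

(* [S z u] is only defined at those [t] at which [S ^~ t] is analytic at [z];
   it is required to be a solution of the output equation there, that is, to
   agree there with a solution on [I]. *)
Definition maps_solutions {R : realType} {n : nat} (I : interval R)
    (s1 s2 g gs : R -> 'M[R[i]]_n) (S : R[i] -> R -> 'M[R[i]]_n) : Prop :=
  forall z u, solution I s1 s2 g z u ->
  exists2 y, solution I s1 s2 gs z y &
    forall t, t \in I -> analytic_at (S ^~ t) z -> y t = S z t *m u t.

(** * Hilbert spaces and operators *)

Definition dot_norm {R : realType} {V : lmodType R[i]} (dot : V -> V -> R[i])
    (x : V) : R := Num.sqrt (complex.Re (dot x x)).

Definition complete_for {R : realType} {V : lmodType R[i]} (p : V -> R) : Prop :=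
  forall u : nat -> V,
    (forall e, 0 < e -> exists N, forall i j,
       (N <= i)%N -> (N <= j)%N -> p (u i - u j) < e) ->
    exists l, forall e, 0 < e -> exists N, forall i, (N <= i)%N -> p (u i - l) < e.

Record hilbert (R : realType) := Hilbert {
  hsort :> lmodType R[i];
  hdot : {dot hsort for @Num.conj R[i]};
  hcomplete : complete_for (dot_norm hdot)
}.

Definition hnorm {R : realType} (H : hilbert R) (x : H) : R :=
  dot_norm (@hdot R H) x.
Arguments hnorm {R} H x.

Definition edot {R : realType} {n : nat} (u v : 'cV[R[i]]_n) : R[i] :=
  (v^t* *m u) 0 0.

Definition enorm {R : realType} {n : nat} : 'cV[R[i]]_n -> R := dot_norm edot.

Section Operators.
Context {R : realType} {U V : lmodType R[i]} (p : U -> R) (q : V -> R).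

Definition bounded_op (f : U -> V) : Prop :=
  exists M : R, forall x, q (f x) <= M * p x.

Definition op_norm (f : U -> V) : R := sup [set q (f x) | x in [set x | p x <= 1]].

Definition op_loc_abs_cont (I : interval R) (G : R -> U -> V) : Prop :=
  loc_abs_cont (fun f g => op_norm (fun x => f x - g x)) I G.

(* [D] is the derivative of [G] at [t] in operator norm. *)
Definition op_deriv (G : R -> U -> V) (t : R) (D : {linear U -> V}) : Prop :=
  bounded_op D /\
  forall e : R, 0 < e -> \forall s \near t,
    op_norm (fun x => G s x - G t x - (s - t)%:C *: D x) <= e * `|s - t|.

End Operators.

Definition adjoint {R : realType} {U V : lmodType R[i]}
    (dotU : U -> U -> R[i]) (dotV : V -> V -> R[i])
    (f : U -> V) (g : V -> U) : Prop :=
  forall x y, dotV (f x) y = dotU x (g y).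

(** * Conservative vessels *)

(* [vA], [vF t s] and [vB] are $A_1(t)$, $F(t,s)$ and $B(t)$, with outer space
   $\mathbb C^n$; the suffix [s] marks their adjoints. *)
Record vessel (R : realType) (n : nat) := Vessel {
  vH : R -> hilbert R;
  vA : forall t, {linear vH t -> vH t};
  vAs : forall t, {linear vH t -> vH t};
  vF : forall t s, {linear vH s -> vH t};
  vFs : forall t s, {linear vH t -> vH s};
  vB : forall t, {linear 'cV[R[i]]_n -> vH t};
  vBs : forall t, {linear vH t -> 'cV[R[i]]_n}
}.

Section Conservative.
Context {R : realType} {n : nat} (I : interval R).
Context (s1 s2 g gs : R -> 'M[R[i]]_n) (V : vessel R n).
Local Notation H := (vH V).
Local Notation A := (vA V).
Local Notation F := (vF V).
Local Notation B := (vB V).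
Local Notation Bs := (vBs V).

Record conservative : Prop := Conservative {
  cons_A_bounded : forall t, t \in I -> bounded_op (hnorm (H t)) (hnorm (H t)) (A t);
  cons_B_bounded : forall t, t \in I -> bounded_op enorm (hnorm (H t)) (B t);
  cons_F_bounded : forall t s, t \in I -> s \in I ->
    bounded_op (hnorm (H s)) (hnorm (H t)) (F t s);
  cons_A_adjoint : forall t, t \in I ->
    adjoint (@hdot R (H t)) (@hdot R (H t)) (A t) (vAs V t);
  cons_B_adjoint : forall t, t \in I -> adjoint edot (@hdot R (H t)) (B t) (Bs t);
  cons_F_adjoint : forall t s, t \in I -> s \in I ->
    adjoint (@hdot R (H s)) (@hdot R (H t)) (F t s) (vFs V t s);

  (* [F s t] is the inverse of [F t s] by these two laws. *)
  cons_F_comp : forall t s r, t \in I -> s \in I -> r \in I ->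
    forall x, F t s (F s r x) = F t r x;
  cons_F_id : forall t, t \in I -> forall x, F t t x = x;

  (* The first family carries [s1], as in [cons_input], which differentiates
     it. Asking this for [s2] instead would force a merely locally integrable
     [s2] to be continuous: already for [n = 1], wherever $B^*B \ne 0$. *)
  cons_FB_ac : ae_on I (fun t =>
    op_loc_abs_cont enorm (hnorm (H t)) I (fun s e => F t s (B s (s1 s *m e))));
  cons_BF_ac : ae_on I (fun t =>
    op_loc_abs_cont (hnorm (H t)) enorm I (fun s x => Bs s (F s t x)));

  cons_colligation : forall t, t \in I -> forall x,
    A t x + vAs V t x + B t (s1 t *m Bs t x) = 0;

  (* The operator integral, in the weak sense. *)
  cons_metric : forall t t0, t \in I -> t0 \in I -> forall x y,
    hdot (H t0) (vFs V t t0 (F t t0 x)) y =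
    hdot (H t0) x y -
    oint t0 t (fun s =>
      hdot (H t0) (vFs V s t0 (B s (s2 s *m Bs s (F s t0 x)))) y);

  cons_lax : forall t t0, t \in I -> t0 \in I -> forall x,
    F t t0 (A t0 x) = A t (F t t0 x);

  cons_input : forall t0, t0 \in I -> ae_on I (fun t =>
    exists2 D : {linear 'cV[R[i]]_n -> H t0},
      op_deriv enorm (hnorm (H t0)) (fun s e => F t0 s (B s (s1 s *m e))) t D &
      forall e, D e + F t0 t (A t (B t (s2 t *m e))) + F t0 t (B t (g t *m e)) = 0);

  cons_output : forall t0, t0 \in I -> ae_on I (fun t =>
    exists2 D : {linear H t0 -> 'cV[R[i]]_n},
      op_deriv (hnorm (H t0)) enorm (fun s x => Bs s (F s t0 x)) t D &
      forall x, s1 t *m D x - s2 t *m Bs t (A t (F t t0 x))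
                - gs t *m Bs t (F t t0 x) = 0);

  cons_linkage : ae_on I (fun t => forall e,
    gs t *m e = g t *m e + s2 t *m Bs t (B t (s1 t *m e))
                - s1 t *m Bs t (B t (s2 t *m e)))
}.

Definition resolvent (t : R) (z : R[i]) (Q : {linear H t -> H t}) : Prop :=
  bounded_op (hnorm (H t)) (hnorm (H t)) Q /\
  forall x, Q (z *: x - A t x) = x /\ z *: Q x - A t (Q x) = x.

(* Sign: [cons_colligation] gives, for [S] the transfer function,
   $S \sigma_1^{-1} S^* - \sigma_1^{-1} = -2 \Re z\, B^* Q Q^* B$,
   which is nonnegative in the half-plane $\Re z < 0$. *)
Definition transfer_function (S : R[i] -> R -> 'M[R[i]]_n) : Prop :=
  forall t, t \in I -> forall z Q, resolvent z Q -> analytic_at (S ^~ t) z ->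
  forall e, S z t *m e = e - Bs t (Q (B t (s1 t *m e))).

(* Coordinates [T] on finite-dimensional inner spaces in which the evolution
   is trivial, so that $A_1$ becomes the constant matrix [A1]. [C t] is then
   the matrix of $B^*(t)$, and [X t] the Gram matrix of the inner product of
   [H t]. *)
Definition inner_coordinates (m : nat) (A1 : 'M[R[i]]_m)
    (C : R -> 'M[R[i]]_(n, m)) (X : R -> 'M[R[i]]_m) : Prop :=
  exists T : forall t, {linear 'cV[R[i]]_m -> H t}, forall t, t \in I ->
    [/\ bijective (T t),
        forall s u, s \in I -> F t s (T s u) = T t u,
        forall u, A t (T t u) = T t (A1 *m u),
        forall u, Bs t (T t u) = C t *m u &
        forall u v, hdot (H t) (T t u) (T t v) = (v^t* *m X t *m u) 0 0].

End Conservative.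

(* The adjoint of [C : C^m -> C^n], where [C^m] carries the inner product with
   Gram matrix [X] and [C^n] the standard one. *)
Definition gram_adjoint {R : realType} {m n : nat} (X : 'M[R[i]]_m)
    (C : 'M[R[i]]_(n, m)) : 'M[R[i]]_(m, n) :=
  invmx X *m C^t*.

(* Main.v *)
(* At one time [t0], [S] has a minimal realization [1 - K (z - A)^-1 D], and the
   symmetry of [S] yields a Hermitian [X] with [X A + A^* X + K^* s1 K = 0] and
   [X D = K^* s1]. Let [K], [D] and [X] evolve by the linear equations of a vessel
   with constant [A]. For a solution [u] of the input equation and its output
   [y = S u], the defect [e = y - u + K (z - A)^-1 D u] vanishes at [t0] and solves
   the output equation with a source term [L u], where [L] measures the failure of
   the linkage condition. Gronwall's lemma makes the rational function
   [R = S - 1 + K (z - A)^-1 D], for which [e = R u], locally bounded in [z]; being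
   strictly proper, it vanishes. So [A], [K t], [D t] realize [S] at all times, hence
   [e = 0] and [L = 0]. Uniqueness for linear equations then propagates
   [X D = K^* s1] and the Lyapunov equation, and the inequality on [S] makes [X t]
   positive definite: it is the Gram matrix of the inner space. *)

Require Import Defs.
From HB Require Import structures.
From mathcomp Require Import all_boot all_order all_algebra.
From mathcomp Require Import sesquilinear spectral complex.
From mathcomp Require Import all_classical all_reals all_analysis.
From mathcomp Require Import measurable_realfun.
From mathcomp Require Import ring lra.
Import Order.TTheory GRing.Theory Num.Theory.
Import numFieldNormedType.Exports.
Set Implicit Arguments.
Unset Strict Implicit.
Unset Printing Implicit Defensive.
Local Open Scope classical_set_scope.
Local Open Scope ring_scope.
Local Open Scope sesquilinear_scope.

(** * Points outside the zeros of a polynomial *)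

(** Nothing is assumed about how [S z t] depends on t: its poles may move, and at a pole the
    hypothesis on solutions says nothing about [S z t]. The realization of [S] is therefore not
    followed along t. For a fixed z only the two times [t0] and t are compared, through a solution
    and its output, which exist on all of [I]; Gronwall constants that are uniform in z near a given
    point supply the information in z. Identities in z are asserted off the zeros of some nonzero
    polynomial ([generically]), a notion stable under conjunction, so that poles and eigenvalues
    need not be located; [analytic_realization] recovers the identity wherever both sides make
    sense. Order matters in the propagation from [t0]: the Lyapunov equation spreads without the
    linkage condition, whereas [X D = K^* s1], which makes [D s1^-1] the adjoint of [K], draws on
    both. The evolution of the vessel is the identity of [C^m], and the inner product alone carries
    the dependence of the inner space on time. *)

Definition generically {C : numClosedFieldType} (P : C -> Prop) : Prop :=
  exists2 r : {poly C}, r != 0 & forall z, r.[z] != 0 -> P z.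

Section Generic.
Context {C : numClosedFieldType}.
Implicit Types (P Q : C -> Prop) (p q : {poly C}).

Lemma genericallyT P : (forall z, P z) -> generically P.
Proof. by move=> h; exists 1 => //; exact: oner_neq0. Qed.

Lemma genericallyW P Q : (forall z, P z -> Q z) -> generically P -> generically Q.
Proof. by move=> h [r r0 hr]; exists r => // z /hr/h. Qed.

Lemma genericallyI P Q :
  generically P -> generically Q -> generically (fun z => P z /\ Q z).
Proof.
move=> [r r0 hr] [s s0 hs]; exists (r * s); first by rewrite mulf_neq0.
by move=> z; rewrite hornerM mulf_eq0 negb_or => /andP[/hr ? /hs ?].
Qed.

Lemma generically_poly p : p != 0 -> generically (fun z => p.[z] != 0).
Proof. by move=> p0; exists p. Qed.

Lemma generically_near P (z0 e : C) : generically P -> 0 < e ->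
  exists2 z, P z & `|z - z0| < e.
Proof.
move=> [r r0 hr] e0.
(* The offset 2 keeps every point strictly within [e] of [z0]; [size r] distinct points are more
   than the roots of a nonzero [r]. *)
pose pt k : C := z0 + e / k.+2%:R.
have pt_inj : injective pt.
  move=> i j /addrI; have en0 : e != 0 by rewrite gt_eqF.
  by move/(mulfI en0)/invr_inj/eqP; rewrite eqr_nat => /eqP[].
pose s := [seq pt k | k <- iota 0 (size r)].
have us : uniq s by rewrite map_inj_uniq ?iota_uniq.
have /allPn[z /mapP[k _ ->] rz] : ~~ all (root r) s.
  apply: contra r0 => /roots_geq_poly_eq0 -> //.
  by rewrite size_map size_iota.
exists (pt k); first exact: hr.
rewrite /pt addrC addKr normrM normfV (gtr0_norm e0) ger0_norm ?ler0n//.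
by rewrite ltr_pdivrMr ?ltr0n// ltr_pMr// ltr1n.
Qed.

Lemma generically_ex P : generically P -> exists z, P z.
Proof. by move=> /generically_near-/(_ 0 1 ltr01)[z ? _]; exists z. Qed.

Lemma generically_root p : generically (fun z => p.[z] = 0) -> p = 0.
Proof.
move=> [r r0 hr]; apply/eqP/negPn/negP => p0.
have /generically_ex[z [/hr h /eqP]] :=
  genericallyI (generically_poly r0) (generically_poly p0).
by apply; rewrite h.
Qed.

Lemma generically_comp_lin P (a b : C) : a != 0 ->
  generically P -> generically (fun z => P (a * z + b)).
Proof.
move=> a0 [r r0 hr]; pose l : {poly C} := a *: 'X + b%:P.
have sl : size l = 2.
  by rewrite /l -mul_polyC size_MXaddC polyC_eq0 (negPf a0) size_polyC a0.
exists (r \Po l); first by rewrite comp_poly_eq0// sl.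
by move=> z; rewrite horner_comp /l !hornerE => /hr.
Qed.

Lemma generically_conj P : generically P -> generically (fun z => P z^*).
Proof.
move=> [r r0 hr]; exists (map_poly Num.conj r).
  by rewrite map_poly_eq0.
move=> z h; apply: hr; apply: contra h => /eqP h.
by rewrite -[z in _.[z]]conjCK horner_map/= h rmorph0.
Qed.

(** The map [z -> - z^*] is the reflection in the imaginary axis, which relates the two factors in
    the symmetry of [S]. *)
Lemma generically_opp_conj P : generically P -> generically (fun z => P (- z^*)).
Proof.
move=> /(@generically_comp_lin _ (-1) 0); rewrite oppr_eq0 oner_eq0 => /(_ isT).
by move=> /generically_conj; apply: genericallyW => z; rewrite mulN1r addr0.
Qed.

End Generic.

(** * Eigenvectors, observability and controllability *)

Section Modes.
Context {C : numClosedFieldType}.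

(** By Cayley-Hamilton the linear factors of the characteristic polynomial, applied to [v] one after
    the other, end in 0; the last nonzero vector is an eigenvector. Since only the maps [A - a] are
    applied, a predicate stable under them takes the place of a subspace. *)
Lemma invariant_eigenvector m (A : 'M[C]_m) (U : 'cV[C]_m -> Prop) (v : 'cV[C]_m) :
  (forall a u, U u -> U (A *m u - a *: u)) -> U v -> v != 0 ->
  exists a e, [/\ U e, e != 0 & A *m e = a *: e].
Proof.
case: m A U v => [|m] A U v Uinv Uv v0; first by rewrite [v]flatmx0 eqxx in v0.
have [rs prs] := closed_field_poly_normal (char_poly A).
rewrite (monicP (char_poly_monic A)) scale1r in prs.
have : horner_mx A (\prod_(z <- rs) ('X - z%:P)) *m v = 0.
  by rewrite -prs Cayley_Hamilton mul0mx.
elim: rs v Uv v0 {prs} => [|a rs IH] v Uv v0.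
  by rewrite big_nil rmorph1 mul1mx => v00; rewrite v00 eqxx in v0.
rewrite big_cons mulrC rmorphM /= -mulmxE -mulmxA.
have -> : horner_mx A ('X - a%:P) *m v = A *m v - a *: v.
  by rewrite rmorphB /= horner_mx_X horner_mx_C mulmxBl mul_scalar_mx.
have [/eqP|v1 /IH] := eqVneq (A *m v - a *: v) 0; last by apply => //; exact: Uinv.
by rewrite subr_eq0 => /eqP Av _; exists a, v.
Qed.

(* The Popov-Belevitch-Hautus forms of observability and controllability. *)
Definition observable m n (A : 'M[C]_m) (K : 'M[C]_(n, m)) : Prop :=
  forall a (v : 'cV_m), A *m v = a *: v -> K *m v = 0 -> v = 0.

Definition controllable m n (A : 'M[C]_m) (D : 'M[C]_(m, n)) : Prop :=
  forall a (w : 'rV_m), w *m A = a *: w -> w *m D = 0 -> w = 0.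

Lemma controllable_tr m n (A : 'M[C]_m) (D : 'M[C]_(m, n)) :
  controllable A D <-> observable A^T D^T.
Proof.
split=> h a v.
  move=> Av Dv; apply: trmx_inj; rewrite trmx0; apply: (h a).
    by apply: trmx_inj; rewrite trmx_mul trmxK Av linearZ /= trmxK.
  by apply: trmx_inj; rewrite trmx_mul trmxK Dv trmx0.
move=> Av Dv; apply: trmx_inj; rewrite trmx0; apply: (h a).
  by rewrite -trmx_mul Av linearZ.
by rewrite -trmx_mul Dv trmx0.
Qed.

Lemma observable_kernel m n (A : 'M[C]_m) (K : 'M[C]_(n, m))
    (U : 'cV[C]_m -> Prop) (v : 'cV_m) : observable A K ->
  (forall a u, U u -> U (A *m u - a *: u)) -> (forall u, U u -> K *m u = 0) ->
  U v -> v = 0.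
Proof.
move=> obs Uinv UK Uv; apply/eqP/negPn/negP => v0.
have [a [e [Ue e0 Ae]]] := invariant_eigenvector Uinv Uv v0.
by move: e0; rewrite (obs _ _ Ae (UK _ Ue)) eqxx.
Qed.

(** The Kalman form of observability, drawn column by column from the eigenvector form: the vectors
    killed by every [K A^k] are stable under all [A - a]. *)
Lemma observable_powers m n p (A : 'M[C]_m) (K : 'M[C]_(n, m)) (v : 'M[C]_(m, p)) :
  observable A K -> (forall k, K *m A ^+ k *m v = 0) -> v = 0.
Proof.
move=> obs h; apply/matrixP => i j; rewrite [RHS]mxE.
rewrite (_ : v i j = (col j v) i 0); last by rewrite mxE.
suff -> : col j v = 0 by rewrite mxE.
apply: (observable_kernel (U := fun u => forall k, K *m A ^+ k *m u = 0) obs).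
- move=> a u hu k; rewrite mulmxBr mulmxA -(mulmxA K) mulmxE -exprSr hu.
  by rewrite -scalemxAr hu scaler0 subrr.
- by move=> u /(_ 0); rewrite expr0 mulmx1.
- by move=> k; rewrite colE mulmxA h mul0mx.
Qed.

Lemma trmx_exp m (A : 'M[C]_m) k : (A ^+ k)^T = A^T ^+ k.
Proof.
by elim: k => [|k IH]; rewrite ?expr0 ?trmx1// exprS exprSr -!mulmxE trmx_mul IH.
Qed.

Lemma controllable_powers m n p (A : 'M[C]_m) (D : 'M[C]_(m, n)) (w : 'M[C]_(p, m)) :
  controllable A D -> (forall k, w *m A ^+ k *m D = 0) -> w = 0.
Proof.
move=> /controllable_tr obs h; apply: trmx_inj; rewrite trmx0.
apply: (observable_powers obs) => k; apply: trmx_inj.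
by rewrite !trmx_mul -trmx_exp !trmxK trmx0 mulmxA h.
Qed.

(** Cayley-Hamilton expresses [A^m], hence every higher power, through the first [m] powers. This
    keeps the sum in [controllable_span] finite. *)
Lemma powers_vanish m n p (A : 'M[C]_m) (w : 'M[C]_(p, m)) (D : 'M[C]_(m, n)) :
  (forall k : 'I_m, w *m A ^+ k *m D = 0) -> forall k, w *m A ^+ k *m D = 0.
Proof.
case: m A w D => [|m] A w D h k; first by rewrite [D]flatmx0 mulmx0.
elim/ltn_ind: k => k IH; have [km|mk] := ltnP k m.+1.
  exact: (h (Ordinal km)).
have := Cayley_Hamilton A; rewrite /horner_mx /horner_morph horner_coef.
rewrite size_map_poly_id0 ?size_char_poly; last first.
  by rewrite (monicP (char_poly_monic A)) oner_neq0.
rewrite big_ord_recr /= !coef_map /=.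
have -> : (char_poly A)`_m.+1 = 1.
  by have /monicP := char_poly_monic A; rewrite lead_coefE size_char_poly.
rewrite mul1r => /eqP; rewrite addrC addr_eq0 => /eqP Am.
rewrite -(subnKC mk) exprD Am mulNr mulmxN mulNmx mulr_suml mulmx_sumr mulmx_suml.
rewrite big1 ?oppr0// => i _; rewrite coef_map /= -mulmxE mul_scalar_mx -scalemxAl.
rewrite -scalemxAr -scalemxAl mulmxE -exprD IH ?scaler0//.
by rewrite -[X in (_ < X)%N](subnKC mk) ltn_add2r.
Qed.

(** Full rank of the controllability matrix, in the form of a right inverse with blocks [Y k]. A
    matrix can then be recovered from its products with the [A^k D]. *)
Lemma controllable_span m n (A : 'M[C]_m) (D : 'M[C]_(m, n)) : controllable A D ->
  exists Y : 'I_m -> 'M[C]_(n, m), \sum_(k < m) A ^+ k *m D *m Y k = 1%:M.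
Proof.
move=> ctrl; pose V := (\sum_(k < m) <<(A ^+ k *m D)^T>>)%MS.
have fullV : row_full V.
  have : row_free V^T.
    rewrite -kermx_eq0; apply/eqP; apply: (controllable_powers ctrl).
    apply: powers_vanish => k.
    have : ((A ^+ k *m D)^T <= V)%MS.
      by rewrite (sumsmx_sup k)// genmxE.
    move=> /submxP[y /(congr1 trmx)]; rewrite trmxK -mulmxA => ->.
    by rewrite trmx_mul mulmxA mulmx_ker mul0mx.
  by rewrite /row_free /row_full mxrank_tr.
have /sub_sumsmxP[u uE] : (1%:M <= V)%MS by exact: submx_full.
have uk k : exists y, u k *m <<(A ^+ k *m D)^T>>%MS = y *m (A ^+ k *m D)^T.
  by apply/submxP; rewrite (submx_trans (submxMl _ _))// genmxE.
have [y yE] := choice uk; exists (fun k => (y k)^T); apply: trmx_inj.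
rewrite trmx1 uE raddf_sum /=; apply: eq_bigr => k _.
by rewrite yE trmx_mul trmxK.
Qed.

End Modes.

(** * Realizations of rational matrix functions *)

Section Realizations.
Context {C : numClosedFieldType}.

Lemma horner_char_poly_mx m (A : 'M[C]_m) z :
  map_mx (horner_eval z) (char_poly_mx A) = z%:M - A.
Proof.
by apply/matrixP => i j; rewrite !mxE /horner_eval !hornerE; case: eqP => _ /=;
  rewrite ?mulr1n ?mulr0n ?hornerX ?horner0.
Qed.

Lemma horner_char_poly m (A : 'M[C]_m) z : (char_poly A).[z] = \det (z%:M - A).
Proof. by rewrite -horner_char_poly_mx det_map_mx. Qed.

Lemma horner_adj_char_poly m (A : 'M[C]_m) z :
  (z%:M - A) *m map_mx (horner_eval z) (\adj (char_poly_mx A)) =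
  ((char_poly A).[z])%:M.
Proof.
rewrite -horner_char_poly_mx -map_mxM mul_mx_adj map_scalar_mx.
by [].
Qed.

Lemma char_poly_neq0 m (A : 'M[C]_m) : char_poly A != 0.
Proof. exact: monic_neq0 (char_poly_monic A). Qed.

Lemma resolvent_unitmx m (A : 'M[C]_m) z :
  (z%:M - A \in unitmx) = ((char_poly A).[z] != 0).
Proof. by rewrite unitmxE unitfE horner_char_poly. Qed.

Lemma generically_unitmx m (A : 'M[C]_m) : generically (fun z => z%:M - A \in unitmx).
Proof. by exists (char_poly A); [exact: char_poly_neq0|move=> z; rewrite resolvent_unitmx]. Qed.

(** The Faddeev-LeVerrier recursion: the coefficients of [X^(k+1)] in
    [(X - A) adj (X - A) = char_poly A] are compared. *)
Lemma adj_char_poly_rec m (A : 'M[C]_m) k :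
  let T := fun i => map_mx (coefp i) (\adj (char_poly_mx A)) in
  T k = A *m T k.+1 + ((char_poly A)`_k.+1)%:M.
Proof.
move=> T; have := mul_mx_adj (char_poly_mx A).
rewrite -/(char_poly A) {1}/char_poly_mx mulmxBl mul_scalar_mx.
move=> /(congr1 (map_mx (coefp k.+1))) E.
apply/matrixP => i j; have /matrixP/(_ i j) := E.
rewrite !mxE /= coefB coefXM /= => /eqP; rewrite subr_eq => /eqP ->.
rewrite addrC coef_sum coefMn; congr (_ + _).
by apply: eq_bigr => l _; rewrite !mxE /= coefCM.
Qed.

(** From index [m] on the recursion loses its scalar term, so that [T k = A^l T (k + l)] for all
    [l], and the coefficients far enough out are 0. This is what makes [K (z - A)^-1 D] strictly
    proper. *)
Lemma adj_char_poly_coef_ge m (A : 'M[C]_m) k : (m <= k)%N ->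
  map_mx (coefp k) (\adj (char_poly_mx A)) = 0.
Proof.
move=> mk; pose T i := map_mx (coefp i) (\adj (char_poly_mx A)).
have step i l : (m <= i)%N -> T i = A ^+ l *m T (i + l)%N.
  elim: l i => [|l IH] i mi; first by rewrite expr0 mul1mx addn0.
  rewrite {1}/T adj_char_poly_rec -/(T i.+1) IH 1?ltnW// addSnnS.
  have -> : (char_poly A)`_i.+1 = 0 by rewrite nth_default// size_char_poly.
  by rewrite raddf0 addr0 mulmxA mulmxE exprS.
pose b := (\sum_i \sum_j size (\adj (char_poly_mx A) i j))%N.
rewrite -/(T k) (step k b mk); suff -> : T (k + b)%N = 0 by rewrite mulmx0.
apply/matrixP => i j; rewrite /T mxE [RHS]mxE /= nth_default//.
apply: leq_trans (leq_addl _ _); rewrite /b (bigD1 i)//= (bigD1 j)//= -addnA.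
exact: leq_addr.
Qed.

Lemma adj_char_poly_lead m (A : 'M[C]_m.+1) :
  map_mx (coefp m) (\adj (char_poly_mx A)) = 1%:M.
Proof.
rewrite adj_char_poly_rec adj_char_poly_coef_ge// mulmx0 add0r.
by have /monicP := char_poly_monic A; rewrite lead_coefE size_char_poly => ->.
Qed.

(** This is [W z = K (z - A)^-1 D]. Through a solution [Y] of [(z - A) Y = D], a construction on
    realizations only has to exhibit the new [Y] and never inverts a block matrix. *)
Definition realizes n p (W : C -> 'M[C]_(n, p)) m (A : 'M[C]_m)
    (K : 'M[C]_(n, m)) (D : 'M[C]_(m, p)) : Prop :=
  generically (fun z => exists2 Y, (z%:M - A) *m Y = D & W z = K *m Y).

Lemma realizesP n p (W : C -> 'M[C]_(n, p)) m (A : 'M[C]_m)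
    (K : 'M[C]_(n, m)) (D : 'M[C]_(m, p)) :
  realizes W A K D <->
  generically (fun z => z%:M - A \in unitmx /\ W z = K *m invmx (z%:M - A) *m D).
Proof.
split; last first.
  apply: genericallyW => z [u ->]; exists (invmx (z%:M - A) *m D).
    by rewrite mulKVmx.
  by rewrite mulmxA.
move=> /(genericallyI (generically_unitmx A)); apply: genericallyW.
by move=> z [u [Y YD ->]]; split => //; rewrite -YD -mulmxA mulKmx.
Qed.

(** With [q] the product over the remaining roots and [c] the top coefficient of [N], writing
    [N = c q + N'] gives [N / ((X - a) q) = (z - a)^-1 (c + N' / q)]: the pole [a] is put in series
    with a realization of [N' / q]. Repeated roots are covered by the same step. *)
Lemma realize_fraction n p (rs : seq C) (N : 'M[{poly C}]_(n, p)) :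
  (forall i j, (size (N i j) <= size rs)%N) ->
  exists m (A : 'M[C]_m) (K : 'M[C]_(n, m)) (D : 'M[C]_(m, p)),
    realizes (fun z => ((\prod_(a <- rs) ('X - a%:P)).[z])^-1 *:
                       map_mx (horner_eval z) N) A K D.
Proof.
elim: rs N => [|a rs IH] N sN.
  exists 0%N, 0, 0, 0; apply: genericallyT => z; exists 0.
    by rewrite mulmx0.
  rewrite mul0mx; apply/matrixP => i j; rewrite !mxE /horner_eval.
  by have := sN i j; rewrite leqn0 size_poly_eq0 => /eqP ->; rewrite horner0 mulr0.
pose q := \prod_(b <- rs) ('X - b%:P); pose c := map_mx (coefp (size rs)) N.
pose N' := N - map_mx (fun x => x *: q) c.
have sq : size q = (size rs).+1 by rewrite size_prod_XsubC.
have [|m [A [K [D hW]]]] := IH N'.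
  move=> i j; apply/leq_sizeP => k; rewrite leq_eqVlt => /orP[/eqP <-|kl].
    rewrite !mxE coefB coefZ /=; have /monicP : q \is monic by exact: monic_prod_XsubC.
    by rewrite lead_coefE sq /= => ->; rewrite mulr1 subrr.
  rewrite !mxE coefB coefZ [q`_k]nth_default ?sq// mulr0 subr0 nth_default//.
  by apply: leq_trans (sN i j) _.
exists (n + m)%N, (block_mx a%:M K 0 A), (row_mx 1%:M 0), (col_mx c D).
have gq : generically (fun z => ('X - a%:P).[z] != 0 /\ q.[z] != 0).
  apply: genericallyI; apply: generically_poly; first by rewrite polyXsubC_eq0.
  by rewrite -size_poly_eq0 sq.
apply: genericallyW (genericallyI gq hW) => z [[za qz] [Y YD WY]].
rewrite hornerXsubC in za.
exists (col_mx ((z - a)^-1 *: (c + K *m Y)) Y).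
  rewrite (@scalar_mx_block _ n m z) opp_block_mx add_block_mx mul_block_col.
  rewrite oppr0 !addr0 !add0r mul0mx add0r YD; congr col_mx.
  rewrite -raddfB /= mul_scalar_mx scalerA mulfV// scale1r.
  by rewrite mulNmx addrK.
rewrite mul_row_col mul1mx mul0mx addr0 big_cons hornerM hornerXsubC invfM.
rewrite -WY -scalerA; congr (_ *: _).
apply/matrixP => i j; rewrite !mxE /horner_eval -/q hornerD hornerN hornerZ /=.
by rewrite mulrBr [_ * q.[z]]mulrC mulKf// addrC subrK.
Qed.

(** Gaussian elimination of the row [v^T] yields an invertible [B] of whose first column [v] is a
    nonzero multiple; the other columns of [B] serve as [T]. *)
Lemma basis_completion m (v : 'cV[C]_m.+1) : v != 0 ->
  exists T : 'M[C]_(m.+1, m), (row_mx v T : 'M[C]_m.+1) \in unitmx.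
Proof.
move=> v0; pose c := col_ebase v^T 0 0; pose B := (row_ebase v^T)^T.
have r1 : \rank v^T = 1%N.
  apply/eqP; rewrite rank_rV; move: v0.
  by rewrite -[in v == 0](trmxK v) -trmx0 (inj_eq trmx_inj) => ->.
have vE : v = c *: col 0 B.
  apply: trmx_inj; rewrite linearZ /= /B tr_col trmxK rowE.
  rewrite -{1}(mulmx_ebase v^T) r1 -mul_scalar_mx /c -mx11_scalar -mulmxA.
  congr (_ *m (_ *m _)); apply/matrixP => i j; rewrite !mxE ord1 eqxx /=.
  by rewrite /= andbT -val_eqE eq_sym.
have uB : B \in unitmx by rewrite unitmx_tr row_ebase_unit.
have c0 : c != 0 by apply: contraNneq v0 => c0; rewrite vE c0 scale0r.
exists (rsubmx (B : 'M[C]_(m.+1, 1 + m))).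
have -> : row_mx v (rsubmx (B : 'M[C]_(m.+1, 1 + m))) =
    B *m (block_mx c%:M 0 0 1%:M : 'M[C]_(1 + m)).
  have BE := esym (@hsubmxK _ m.+1 1 m B); apply/esym.
  apply: (etrans (congr1 (fun M : 'M[C]_(m.+1, 1 + m) => M *m block_mx c%:M 0 0 1%:M) BE)).
  rewrite mul_row_block !mulmx0 addr0 add0r mulmx1.
  congr row_mx; rewrite vE mul_mx_scalar; congr (_ *: _).
  by apply/matrixP => i j; rewrite !mxE !ord1; congr (row_ebase _ _ _); apply: val_inj.
have dc : \det (block_mx c%:M 0 0 1%:M : 'M[C]_(1 + m)) = c.
  by rewrite det_ublock det_scalar1 det1 mulr1.
by rewrite unitmx_mul uB /= unitmxE [\det _]dc unitfE.
Qed.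

(** An eigenvector [v] with [K v = 0] spans an [A]-invariant line invisible in the output. Dividing
    by it, with projection [U] and section [T], lowers the dimension by one and leaves [W]
    unchanged. *)
Lemma reduce_unobservable n p (W : C -> 'M[C]_(n, p)) m (A : 'M[C]_m)
    (K : 'M[C]_(n, m)) (D : 'M[C]_(m, p)) :
  realizes W A K D -> ~ observable A K ->
  exists m' (A' : 'M[C]_m') (K' : 'M[C]_(n, m')) (D' : 'M[C]_(m', p)),
    (m' < m)%N /\ realizes W A' K' D'.
Proof.
move=> hW nobs.
have [a [v [Av Kv v0]]] : exists a (v : 'cV_m), [/\ A *m v = a *: v, K *m v = 0 & v != 0].
  apply: contrapT => h; apply: nobs => a v Av Kv; apply/eqP/negPn/negP => v0.
  by apply: h; exists a, v.
case: m A K D hW v Av Kv v0 {nobs} => [|m] A K D hW v Av Kv v0.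
  by rewrite [v]flatmx0 eqxx in v0.
have [T uT] := basis_completion v0.
pose U := dsubmx (invmx (row_mx v T) : 'M[C]_(1 + m, m.+1)).
pose u := usubmx (invmx (row_mx v T) : 'M[C]_(1 + m, m.+1)).
have UE : col_mx u U = invmx (row_mx v T) by rewrite vsubmxK.
have E1 : v *m u + T *m U = 1%:M by rewrite -mul_row_col UE mulmxV.
have : block_mx (u *m v) (u *m T) (U *m v) (U *m T) = 1%:M.
  by rewrite -mul_col_row UE; exact: mulVmx.
rewrite (@scalar_mx_block _ 1 m) => /eq_block_mx[_ _ Uv _].
exists m, (U *m A *m T), (K *m T), (U *m D); split => //.
have TU (Y : 'M[C]_(m.+1, p)) : T *m (U *m Y) = Y - v *m (u *m Y).
  by apply/eqP; rewrite eq_sym subr_eq addrC !mulmxA -mulmxDl E1 mul1mx.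
apply: genericallyW hW => z [Y YD ->]; exists (U *m Y); last first.
  by rewrite -mulmxA TU mulmxBr (mulmxA K) Kv mul0mx subr0.
rewrite mulmxBl -!mulmxA TU !mulmxBr (mulmxA A) Av -scalemxAl -scalemxAr.
rewrite (mulmxA U v) Uv mul0mx scaler0 subr0 mul_scalar_mx -YD mulmxBl mulmxBr.
by rewrite mul_scalar_mx -scalemxAr.
Qed.

Lemma realizes_tr n p (W : C -> 'M[C]_(n, p)) m (A : 'M[C]_m)
    (K : 'M[C]_(n, m)) (D : 'M[C]_(m, p)) :
  realizes W A K D -> realizes (fun z => (W z)^T) A^T D^T K^T.
Proof.
move=> /realizesP hW; apply/realizesP; apply: genericallyW hW => z [u ->].
have zE : z%:M - A^T = (z%:M - A)^T by rewrite linearB /= tr_scalar_mx.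
by rewrite zE unitmx_tr u -trmx_inv !trmx_mul mulmxA.
Qed.

(** Strong induction on the state dimension. Transposition exchanges the two properties, so one
    reduction serves for both. *)
Lemma minimal_realization n p (W : C -> 'M[C]_(n, p)) m (A : 'M[C]_m)
    (K : 'M[C]_(n, m)) (D : 'M[C]_(m, p)) : realizes W A K D ->
  exists m' (A' : 'M[C]_m') (K' : 'M[C]_(n, m')) (D' : 'M[C]_(m', p)),
    [/\ realizes W A' K' D', observable A' K' & controllable A' D'].
Proof.
elim/ltn_ind: m A K D => m IH A K D hW.
have [obs|nobs] := pselect (observable A K); last first.
  by have [m' [A' [K' [D' [lt /(IH _ lt)]]]]] := reduce_unobservable hW nobs.
have [ctrl|nctrl] := pselect (controllable A D); first by exists m, A, K, D.
have [|m' [A' [K' [D' [lt hW']]]]] := reduce_unobservable (realizes_tr hW).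
  by move=> h; apply: nctrl; apply/controllable_tr.
apply: (IH _ lt A'^T D'^T K'^T); apply: genericallyW (realizes_tr hW') => z.
by case=> Y YD WY; exists Y => //; rewrite -WY trmxK.
Qed.

Lemma coefp_mulmx n p m l (K : 'M[C]_(n, m)) (N : 'M[{poly C}]_(m, l)) (D : 'M[C]_(l, p)) k :
  map_mx (coefp k) (map_mx polyC K *m N *m map_mx polyC D) =
  K *m map_mx (coefp k) N *m D.
Proof.
apply/matrixP => i j; rewrite !mxE /= coef_sum; apply: eq_bigr => a _.
rewrite !mxE coefMC coef_sum; congr (_ * _); apply: eq_bigr => b _.
by rewrite !mxE coefCM.
Qed.

Lemma horner_mulmx n p m l (K : 'M[C]_(n, m)) (N : 'M[{poly C}]_(m, l)) (D : 'M[C]_(l, p)) z :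
  map_mx (horner_eval z) (map_mx polyC K *m N *m map_mx polyC D) =
  K *m map_mx (horner_eval z) N *m D.
Proof.
have E a b (M : 'M[C]_(a, b)) : map_mx (horner_eval z) (map_mx polyC M) = M.
  by apply/matrixP => i j; rewrite !mxE /horner_eval hornerC.
by rewrite !map_mxM !E.
Qed.

(** [K D] is the coefficient of [1/z] at infinity. Algebraically it is the top coefficient of
    [K adj (X - A) D], a polynomial matrix that vanishes generically and hence identically. *)
Lemma realizes0_mul n p m (A : 'M[C]_m) (K : 'M[C]_(n, m)) (D : 'M[C]_(m, p)) :
  realizes (fun=> 0) A K D -> K *m D = 0.
Proof.
case: m A K D => [|m] A K D; first by rewrite [D]flatmx0 mulmx0.
move=> /realizesP hW.
pose N := map_mx polyC K *m \adj (char_poly_mx A) *m map_mx polyC D.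
suff N0 : N = 0.
  have := coefp_mulmx K (\adj (char_poly_mx A)) D m.
  rewrite -/N N0 adj_char_poly_lead mulmx1 => <-.
  by apply/matrixP => i j; rewrite !mxE /= coef0.
apply/matrixP => i j; rewrite [RHS]mxE; apply: generically_root.
apply: genericallyW hW => z [u /esym KD0].
have -> : (N i j).[z] = map_mx (horner_eval z) N i j by rewrite [RHS]mxE.
rewrite horner_mulmx -[map_mx _ _](mulKmx u) horner_adj_char_poly mul_mx_scalar.
by rewrite -scalemxAr -scalemxAl KD0 scaler0 mxE.
Qed.

(** From [K Y = 0] and [K D = 0] follows [K A Y = z K Y - K D = 0], so [K A] inherits the hypothesis
    on [K]. *)
Lemma realizes0_markov n p m (A : 'M[C]_m) (K : 'M[C]_(n, m)) (D : 'M[C]_(m, p)) k :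
  realizes (fun=> 0) A K D -> K *m A ^+ k *m D = 0.
Proof.
elim: k K => [|k IH] K hW; first by rewrite expr0 mulmx1 (realizes0_mul hW).
rewrite exprS -mulmxE mulmxA; apply: IH; have KD := realizes0_mul hW.
apply: genericallyW hW => z [Y YD KY]; exists Y => //; apply/esym.
move: KD; rewrite -YD mulmxBl mulmxBr mul_scalar_mx -scalemxAr -KY scaler0 sub0r mulmxA.
by move/eqP; rewrite oppr_eq0 => /eqP.
Qed.

Lemma block_diag_exp m m' (A : 'M[C]_m) (A' : 'M[C]_m') k :
  (block_mx A 0 0 A') ^+ k = block_mx (A ^+ k) 0 0 (A' ^+ k).
Proof.
elim: k => [|k IH]; first by rewrite !expr0 -scalar_mx_block.
by rewrite exprS IH -mulmxE mulmx_block !mul0mx !mulmx0 !addr0 !add0r !mulmxE -!exprS.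
Qed.

(** The Markov parameters depend on [W] only: the block diagonal system with output row [K, - K']
    realizes 0. *)
Lemma realizes_markov n p (W : C -> 'M[C]_(n, p)) m m' (A : 'M[C]_m)
    (K : 'M[C]_(n, m)) (D : 'M[C]_(m, p)) (A' : 'M[C]_m')
    (K' : 'M[C]_(n, m')) (D' : 'M[C]_(m', p)) k :
  realizes W A K D -> realizes W A' K' D' ->
  K *m A ^+ k *m D = K' *m A' ^+ k *m D'.
Proof.
move=> h h'; apply/eqP; rewrite -subr_eq0; apply/eqP.
have : realizes (fun=> 0) (block_mx A 0 0 A') (row_mx K (- K')) (col_mx D D').
  apply: genericallyW (genericallyI h h') => z [[Y YD ->] [Y' YD' KY]].
  exists (col_mx Y Y'); last by rewrite mul_row_col mulNmx KY subrr.
  rewrite scalar_mx_block opp_block_mx add_block_mx mul_block_col !oppr0 !addr0.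
  by rewrite !mul0mx addr0 add0r YD YD'.
move=> /(@realizes0_markov _ _ _ _ _ _ k); rewrite block_diag_exp mul_row_block.
by rewrite !mulmx0 addr0 add0r mul_row_col mulNmx mulNmx.
Qed.

(* The state space isomorphism theorem. *)
Lemma realizes_similar n p (W : C -> 'M[C]_(n, p)) m m' (A : 'M[C]_m)
    (K : 'M[C]_(n, m)) (D : 'M[C]_(m, p)) (A' : 'M[C]_m')
    (K' : 'M[C]_(n, m')) (D' : 'M[C]_(m', p)) :
  realizes W A K D -> realizes W A' K' D' -> controllable A D -> observable A' K' ->
  exists X : 'M[C]_(m', m), [/\ X *m A = A' *m X, X *m D = D' & K' *m X = K].
Proof.
move=> h h' ctrl obs; have mk k := realizes_markov k h h'.
have [Y YE] := controllable_span ctrl.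
(* The choice is forced: [X A^k D = A'^k D'] is wanted, and the [A^k D Y k] sum to 1. Equality of
   the Markov parameters and observability of [K'] make it consistent. *)
pose X := \sum_(k < m) A' ^+ k *m D' *m Y k.
have XA j : X *m (A ^+ j *m D) = A' ^+ j *m D'.
  apply/eqP; rewrite -subr_eq0; apply/eqP; apply: (observable_powers obs) => l.
  rewrite mulmxBr.
  have -> : K' *m A' ^+ l *m (A' ^+ j *m D') = K' *m A' ^+ (l + j) *m D'.
    by rewrite exprD -mulmxE !mulmxA.
  rewrite -mk /X mulmx_suml mulmx_sumr.
  rewrite (eq_bigr (fun k : 'I_m => K *m A ^+ l *m (A ^+ k *m D *m Y k) *m (A ^+ j *m D))).
    rewrite -mulmx_suml -mulmx_sumr YE mulmx1 exprD -mulmxE !mulmxA subrr.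
    by [].
  move=> k _; rewrite !mulmxA; congr (_ *m _ *m _ *m _).
  by rewrite -(mulmxA _ (A' ^+ l)) -(mulmxA _ (A ^+ l)) !mulmxE -!exprD mk.
have eqX q (P Q : 'M[C]_(q, m)) :
    (forall j, P *m A ^+ j *m D = Q *m A ^+ j *m D) -> P = Q.
  move=> PQ; apply/eqP; rewrite -subr_eq0; apply/eqP.
  by apply: (controllable_powers ctrl) => k; rewrite !mulmxBl PQ subrr.
exists X; split.
- apply: eqX => j; rewrite -!mulmxA XA (mulmxA A) mulmxE -exprS XA.
  by rewrite mulmxA mulmxE -exprS.
- by have := XA 0%N; rewrite !expr0 !mul1mx.
- by apply: eqX => j; rewrite mk -!mulmxA XA.
Qed.

End Realizations.

(** * Hermitian forms and Lyapunov equations *)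

Section Adjoints.
Context {C : numClosedFieldType}.

Lemma adjmxM m n p (A : 'M[C]_(m, n)) (B : 'M[C]_(n, p)) :
  (A *m B)^t* = B^t* *m A^t*.
Proof. by rewrite trmx_mul map_mxM. Qed.

Lemma adjmxD m n (A B : 'M[C]_(m, n)) : (A + B)^t* = A^t* + B^t*.
Proof. by rewrite linearD map_mxD. Qed.

Lemma adjmxN m n (A : 'M[C]_(m, n)) : (- A)^t* = - A^t*.
Proof. by rewrite linearN map_mxN. Qed.

Lemma adjmxB m n (A B : 'M[C]_(m, n)) : (A - B)^t* = A^t* - B^t*.
Proof. by rewrite adjmxD adjmxN. Qed.

Lemma adjmxZ m n a (A : 'M[C]_(m, n)) : (a *: A)^t* = a^* *: A^t*.
Proof. by rewrite linearZ map_mxZ. Qed.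

Lemma adjmx_scalar n (a : C) : (a%:M : 'M[C]_n)^t* = (a^*)%:M.
Proof. by rewrite tr_scalar_mx map_scalar_mx. Qed.

Lemma adjmx_inv n (A : 'M[C]_n) : (invmx A)^t* = invmx (A^t*).
Proof. by rewrite trmx_inv map_invmx. Qed.

Lemma adjmx_unit n (A : 'M[C]_n) : (A^t* \in unitmx) = (A \in unitmx).
Proof. by rewrite map_unitmx unitmx_tr. Qed.

Lemma adjmx0 m n : (0 : 'M[C]_(m, n))^t* = 0.
Proof. by rewrite trmx0 map_mx0. Qed.

Lemma adjmx_entry (A : 'M[C]_1) : A^t* 0 0 = (A 0 0)^*.
Proof. by rewrite !mxE. Qed.

Definition qform m (X : 'M[C]_m) (v : 'cV[C]_m) : C := (v^t* *m X *m v) 0 0.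

Definition posdef m (X : 'M[C]_m) : Prop := forall v, v != 0 -> 0 < qform X v.

Lemma qformD m (X Y : 'M[C]_m) v : qform (X + Y) v = qform X v + qform Y v.
Proof. by rewrite /qform mulmxDr mulmxDl mxE. Qed.

Lemma qformN m (X : 'M[C]_m) v : qform (- X) v = - qform X v.
Proof. by rewrite /qform mulmxN mulNmx mxE. Qed.

Lemma qform_congr m n (X : 'M[C]_m) (T : 'M[C]_(m, n)) v :
  qform (T^t* *m X *m T) v = qform X (T *m v).
Proof. by rewrite /qform adjmxM !mulmxA. Qed.

Lemma qform1 n (v : 'cV[C]_n) : qform 1%:M v = \sum_i `|v i 0| ^+ 2.
Proof.
rewrite /qform mulmx1 mxE; apply: eq_bigr => i _.
by rewrite !mxE mulrC normCK.
Qed.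

Lemma qform1_gt0 n (v : 'cV[C]_n) : v != 0 -> 0 < qform 1%:M v.
Proof.
move=> v0; rewrite qform1 lt0r sumr_ge0 ?andbT//.
apply: contraNneq v0 => /eqP; rewrite psumr_eq0// => /allP v0.
apply/eqP/matrixP => i j; rewrite ord1 [RHS]mxE; apply/eqP.
have := v0 i; rewrite mem_index_enum => /(_ isT) /=.
by rewrite expf_eq0 normr_eq0.
Qed.

Lemma posdef_unit m (X : 'M[C]_m) : posdef X -> X \in unitmx.
Proof.
move=> Xpos; rewrite -unitmx_tr -row_free_unit -kermx_eq0.
apply/eqP/row_matrixP => i; rewrite row0; apply/eqP/negPn/negP => k0.
have /Xpos : (row i (kermx X^T))^T != 0.
  by rewrite -trmx0 (inj_eq trmx_inj).
rewrite /qform -mulmxA -[X in X *m _^T]trmxK -trmx_mul -row_mul mulmx_ker.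
by rewrite row0 trmx0 mulmx0 mxE ltxx.
Qed.

Lemma posdef1 m : posdef (1%:M : 'M[C]_m).
Proof. exact: qform1_gt0. Qed.

Lemma eigenvector_root m (A : 'M[C]_m) a (v : 'cV_m) :
  v != 0 -> A *m v = a *: v -> root (char_poly A) a.
Proof.
move=> v0 Av; apply: contraNT v0; rewrite /root -resolvent_unitmx => u.
by rewrite -(mulKmx u v) mulmxBl mul_scalar_mx Av subrr mulmx0.
Qed.

Lemma root_eigenvector m (A : 'M[C]_m) a : root (char_poly A) a ->
  exists2 v : 'cV_m, v != 0 & A *m v = a *: v.
Proof.
rewrite /root horner_char_poly -det_tr linearB /= tr_scalar_mx -horner_char_poly.
rewrite -/(root _ _) -eigenvalue_root_char => /eigenvalueP[w wA w0].
exists w^T; first by rewrite -trmx0 (inj_eq trmx_inj).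
by apply: trmx_inj; rewrite trmx_mul trmxK wA linearZ /= trmxK.
Qed.

(* Deflation: split off an eigenvector [e] and pass to its [X]-orthogonal
   complement, which carries the quotient of [A]. *)
Lemma lyapunov_posdef m n (A X : 'M[C]_m) (K : 'M[C]_(n, m)) :
  X^t* = X -> X *m A + A^t* *m X + K^t* *m K = 0 -> observable A K ->
  (forall a, root (char_poly A) a -> 'Re a < 0) -> posdef X.
Proof.
elim: m A X K => [|m IH] A X K XE lyap obs stab.
  by move=> v; rewrite [v]flatmx0 eqxx.
have d0 : delta_mx 0 0 != 0 :> 'cV[C]_m.+1.
  by apply/eqP => /matrixP/(_ 0 0)/eqP; rewrite !mxE oner_eq0.
have [a [e [_ e0 Ae]]] :=
  invariant_eigenvector (A := A) (U := fun=> True) (fun _ _ _ => I) I d0.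
pose x := qform X e.
(* The Lyapunov equation evaluated at [e]: twice the real part of [a] times [x] is minus the square
   norm of [K e], so stability and [K e != 0] give [0 < x]. *)
have xlyap : (a + a^*) * x = - qform 1%:M (K *m e).
  have := congr1 (fun M => (e^t* *m M *m e) 0 0) lyap.
  rewrite -/(qform _ e) !qformD -[K^t*]mulmx1 qform_congr mulmx0 mul0mx mxE.
  move/eqP; rewrite addr_eq0 => /eqP <-; rewrite mulrDl; congr (_ + _).
    by rewrite /qform -!mulmxA Ae -!scalemxAr mxE mulmxA.
  by rewrite /qform mulmxA -adjmxM Ae adjmxZ -!scalemxAl mxE.
have Ke0 : K *m e != 0 by apply: contra_neq e0 => /(obs _ _ Ae).
have x0 : 0 < x.
  have a0 : 'Re a < 0 by apply: stab; exact: eigenvector_root Ae.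
  have : 0 < - ((a + a^*) * x) by rewrite xlyap opprK qform1_gt0.
  have -> : a + a^* = 'Re a *+ 2.
    by rewrite ReE -mulr_natr -mulrA mulVf ?pnatr_eq0// mulr1.
  by rewrite -mulNr -mulNrn pmulr_rgt0// pmulrn_lgt0// oppr_gt0.
have [T uT] := basis_completion e0.
(* One Gram-Schmidt step in the form [X]: the component along [e] is removed from the columns of
   [T]. *)
pose W := T - x^-1 *: (e *m (e^t* *m X *m T)).
have eXe : e^t* *m X *m e = x%:M by rewrite [LHS]mx11_scalar.
have eXW : e^t* *m X *m W = 0.
  rewrite /W mulmxBr -scalemxAr (mulmxA _ e) eXe mul_scalar_mx scalerA.
  by rewrite mulVf ?gt_eqF// scale1r subrr.
have WXe : W^t* *m X *m e = 0.
  have := congr1 (fun N => N^t*) eXW.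
  by rewrite !adjmxM trmxCK XE mulmxA adjmx0.
pose M := row_mx e W.
have uM : (M : 'M[C]_m.+1) \in unitmx.
  have -> : M = row_mx e T *m block_mx 1%:M (- (x^-1 *: (e^t* *m X *m T))) 0 1%:M.
    by rewrite mul_row_block !mulmx0 !mulmx1 addr0 mulmxN -scalemxAr addrC.
  have dT : \det (block_mx 1%:M (- (x^-1 *: (e^t* *m X *m T))) 0 1%:M : 'M[C]_(1 + m)) = 1.
    by rewrite det_ublock !det1 mulr1.
  by rewrite unitmx_mul uT /= unitmxE [\det _]dT unitr1.
clearbody W.
pose U := dsubmx (invmx M : 'M[C]_(1 + m, m.+1)).
pose u := usubmx (invmx M : 'M[C]_(1 + m, m.+1)).
have UE : col_mx u U = invmx M by rewrite vsubmxK.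
have E1 : e *m u + W *m U = 1%:M by rewrite -mul_row_col UE; exact: mulmxV.
have : block_mx (u *m e) (u *m W) (U *m e) (U *m W) = 1%:M.
  by rewrite -mul_col_row UE; exact: mulVmx.
rewrite (@scalar_mx_block _ 1 m) => /eq_block_mx[_ _ Ue UW].
have splitE q (v : 'M[C]_(m.+1, q)) : v = e *m (u *m v) + W *m (U *m v).
  by rewrite !mulmxA -mulmxDl E1 mul1mx.
pose A2 := U *m A *m W; pose X2 := W^t* *m X *m W; pose K2 := K *m W.
have AW q (w : 'M[C]_(m, q)) : A *m (W *m w) = e *m (u *m (A *m (W *m w))) + W *m (A2 *m w).
  by rewrite {1}[A *m (W *m w)]splitE /A2 !mulmxA.
have WXAW : W^t* *m X *m (A *m W) = X2 *m A2.
  rewrite [A *m W]splitE mulmxDr !mulmxA WXe.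
  by rewrite !mul0mx add0r.
have lyap2 : X2 *m A2 + A2^t* *m X2 + K2^t* *m K2 = 0.
  have X2E : X2^t* = X2 by rewrite /X2 !adjmxM trmxCK XE mulmxA.
  have -> : A2^t* *m X2 = (X2 *m A2)^t* by rewrite adjmxM X2E.
  have := congr1 (fun N => W^t* *m N *m W) lyap.
  rewrite mulmx0 mul0mx !mulmxDr !mulmxDl -WXAW !adjmxM XE trmxCK => <-.
  by rewrite !mulmxA.
have pos2 : posdef X2.
  apply: (IH A2 X2 K2) => //.
  - by rewrite /X2 !adjmxM trmxCK XE mulmxA.
  - move=> b w A2w K2w; rewrite -[w]mul1mx -UW -mulmxA.
    suff -> : W *m w = 0 by rewrite mulmx0.
    apply: (obs b); last by rewrite mulmxA.
    (* Paired between [e] and [W w], the Lyapunov equation kills the [e]-component of [A W w], so an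
       eigenvector [w] of the quotient lifts to the eigenvector [W w] of [A] itself. *)
    have := congr1 (fun N => e^t* *m N *m (W *m w)) lyap.
    rewrite mulmx0 mul0mx !mulmxDr !mulmxDl -!mulmxA (mulmxA K) K2w !mulmx0 addr0.
    rewrite (mulmxA (e^t* ) (A^t* )) -adjmxM Ae adjmxZ -scalemxAl !mulmxA eXW mul0mx scaler0 addr0.
    rewrite -!mulmxA AW !mulmxDr !mulmxA eXW !mul0mx addr0 eXe -!mulmxA mul_scalar_mx.
    move/eqP; rewrite scaler_eq0 gt_eqF//= => /eqP uAW.
    by rewrite AW uAW mulmx0 add0r A2w scalemxAr.
  (* Left eigenvectors of the quotient pull back along [U] to left eigenvectors of [A], hence
     stability is inherited. *)
  - move=> b; rewrite -eigenvalue_root_char => /eigenvalueP[w wA2 w0].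
    apply: stab; rewrite -eigenvalue_root_char; apply/eigenvalueP.
    exists (w *m U).
      rewrite scalemxAl -wA2 /A2 -!mulmxA; congr (w *m _).
      rewrite -[U *m A]mulmx1 -E1 mulmxDr !mulmxA -(mulmxA U) Ae -scalemxAr Ue.
      by rewrite scaler0 mul0mx add0r.
    by apply: contraNneq w0 => wU; rewrite -[w]mulmx1 -UW mulmxA wU mul0mx.
have qE (c : 'cV[C]_1) (w : 'cV[C]_m) :
    qform X (e *m c + W *m w) = qform 1%:M c * x + qform X2 w.
  have F1 : e^t* *m (X *m (W *m w)) = 0 by rewrite !mulmxA eXW mul0mx.
  have F2 : W^t* *m (X *m (e *m c)) = 0 by rewrite !mulmxA WXe mul0mx.
  have F3 : e^t* *m (X *m (e *m c)) = x *: c by rewrite !mulmxA eXe mul_scalar_mx.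
  rewrite /qform adjmxD !mulmxDl !mulmxDr !adjmxM -!mulmxA F1 F2 F3 !mulmx0 addr0 add0r.
  by rewrite mxE -scalemxAr mxE mul1mx mulrC /X2 !mulmxA.
move=> v v0; rewrite [v]splitE qE; set c := u *m v; set w := U *m v.
have [c0|c0] := eqVneq c 0.
  have w0 : w != 0.
    by apply: contraNneq v0 => w0; rewrite [v]splitE -/c -/w c0 w0 !mulmx0 addr0.
  by rewrite c0 /qform mulmx0 mxE mul0r add0r pos2.
have [w0|w0] := eqVneq w 0.
  by rewrite w0 {2}/qform mulmx0 mxE addr0 mulr_gt0// qform1_gt0.
by rewrite addr_gt0 ?mulr_gt0 ?qform1_gt0 ?pos2.
Qed.

End Adjoints.

(** * Boundedness near a point *)

Section Bounded.
Context {C : numClosedFieldType}.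

Definition bounded_near (a : C) m n (f : C -> 'M[C]_(m, n)) : Prop :=
  exists M e : C, [/\ 0 <= M, 0 < e & generically (fun z =>
    `|z - a| < e -> forall i j, `|f z i j| <= M)].

Lemma pos_lower_bound (e e' : C) :
  0 < e -> 0 < e' -> exists d, [/\ 0 < d, d <= e & d <= e'].
Proof.
move=> e0 e'0; case/orP: (real_leVge (gtr0_real e0) (gtr0_real e'0)) => h.
  by exists e.
by exists e'.
Qed.

Lemma bounded_nearW a m n (f g : C -> 'M[C]_(m, n)) :
  generically (fun z => f z = g z) -> bounded_near a f -> bounded_near a g.
Proof.
move=> fg [M [e [M0 e0 h]]]; exists M, e; split => //.
by apply: genericallyW (genericallyI fg h) => z [<-].
Qed.

Lemma bounded_near_cst a m n (A : 'M[C]_(m, n)) : bounded_near a (fun=> A).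
Proof.
exists (\sum_i \sum_j `|A i j|), 1; split => //.
  by apply: sumr_ge0 => i _; apply: sumr_ge0.
apply: genericallyT => _ _ i j; rewrite (bigD1 i)//= (bigD1 j)//= -addrA lerDl.
apply: addr_ge0; first exact: sumr_ge0.
by apply: sumr_ge0 => ? _; apply: sumr_ge0.
Qed.

Lemma bounded_nearD a m n (f g : C -> 'M[C]_(m, n)) :
  bounded_near a f -> bounded_near a g -> bounded_near a (fun z => f z + g z).
Proof.
move=> [M [e [M0 e0 h]]] [M' [e' [M'0 e'0 h']]];
have [d [d0 de de']] := pos_lower_bound e0 e'0; exists (M + M'), d; split => //.
  exact: addr_ge0.
apply: genericallyW (genericallyI h h') => z [hz hz'] zd i j.
rewrite mxE (le_trans (ler_normD _ _))// lerD//.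
  exact/hz/lt_le_trans/de.
exact/hz'/lt_le_trans/de'.
Qed.

Lemma bounded_nearM a m n p (f : C -> 'M[C]_(m, n)) (g : C -> 'M[C]_(n, p)) :
  bounded_near a f -> bounded_near a g -> bounded_near a (fun z => f z *m g z).
Proof.
move=> [M [e [M0 e0 h]]] [M' [e' [M'0 e'0 h']]];
have [d [d0 de de']] := pos_lower_bound e0 e'0; exists ((M * M') *+ n), d; split => //.
  by rewrite mulrn_wge0// mulr_ge0.
apply: genericallyW (genericallyI h h') => z [hz hz'] zd i j.
rewrite mxE (le_trans (ler_norm_sum _ _ _))//.
rewrite -[X in _ *+ X]card_ord -sumr_const ler_sum// => k _.
rewrite normrM ler_pM//; first exact/hz/lt_le_trans/de.
exact/hz'/lt_le_trans/de'.
Qed.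

Lemma bounded_near_id a n : bounded_near a (fun z => z%:M : 'M[C]_n).
Proof.
exists (`|a| + 1), 1; split => //.
apply: genericallyT => z za i j; rewrite mxE; case: eqP => _.
  rewrite mulr1n -[z](subrK a) addrC (le_trans (ler_normD _ _))// lerD2l.
  exact: ltW.
by rewrite mulr0n normr0 addr_ge0.
Qed.

Lemma bounded_nearB a m n (f g : C -> 'M[C]_(m, n)) :
  bounded_near a f -> bounded_near a g -> bounded_near a (fun z => f z - g z).
Proof.
move=> bf bg; have bN := bounded_nearM (bounded_near_cst a (-1)%:M) bg.
apply: bounded_nearW (bounded_nearD bf bN).
by apply: genericallyT => z; rewrite mul_scalar_mx scaleN1r.
Qed.

Lemma bounded_near_sum a m n (I : finType) (f : I -> C -> 'M[C]_(m, n)) :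
  (forall i, bounded_near a (f i)) -> bounded_near a (fun z => \sum_i f i z).
Proof.
move=> bf; elim: (index_enum I) => [|i s IH].
  apply: bounded_nearW (bounded_near_cst a 0).
  by apply: genericallyT => z; rewrite big_nil.
apply: bounded_nearW (bounded_nearD (bf i) IH).
by apply: genericallyT => z; rewrite big_cons.
Qed.

(** Here [f z = v / (z - a)]: a bounded function has no simple pole, so the residue [v] is 0. *)
Lemma bounded_near_pole a m n (v : 'M[C]_(m, n)) (f : C -> 'M[C]_(m, n)) :
  bounded_near a f -> generically (fun z => v = (z - a) *: f z) -> v = 0.
Proof.
move=> [M [e [M0 e0 h]]] vE; apply/matrixP => i j; rewrite [RHS]mxE.
apply/eqP/negPn/negP => vij; rewrite -normr_gt0 in vij.
have M1 : 0 < M + 1 by rewrite ltr_wpDl.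
have d0 : 0 < `|v i j| / (M + 1) by rewrite divr_gt0.
have [d [d1 de dv]] := pos_lower_bound e0 d0.
have [z [hz vz] za] := generically_near a (genericallyI h vE) d1.
have := lt_le_trans za dv; rewrite ltr_pdivlMr// vz mxE normrM; apply/negP.
rewrite -real_leNgt ?realM ?normr_real ?gtr0_real//; apply: ler_wpM2l => //.
by rewrite (le_trans (hz (lt_le_trans za de) i j))// lerDl.
Qed.

End Bounded.

(** * Positivity of the Gram matrix *)

Section Positivity.
Context {C : numClosedFieldType}.

(* [S(z) s^-1 S(z)^* - s^-1] evaluated on [eta], where [S(z)^* eta] is
   computed through the state [f = X^-1 (z - A)^-* K^* eta]. *)
Lemma dissipation_identity m n (A X : 'M[C]_m) (K : 'M[C]_(n, m)) (s : 'M[C]_n)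
    z (f : 'cV_m) (eta : 'cV_n) :
  s^t* = s -> s \in unitmx -> X^t* = X -> X *m A + A^t* *m X + K^t* *m s *m K = 0 ->
  (z%:M - A)^t* *m (X *m f) = K^t* *m eta ->
  qform (invmx s) (eta - s *m K *m f) - qform (invmx s) eta = - (z + z^*) * qform X f.
Proof.
move=> sE us XE lyap hf.
have h1 : f^t* *m K^t* *m eta = z^* *: (f^t* *m X *m f) - f^t* *m (A^t* *m X) *m f.
  rewrite -mulmxA -hf adjmxB adjmx_scalar mulmxBl mul_scalar_mx mulmxBr.
  by rewrite -scalemxAr !mulmxA.
have h2 : eta^t* *m K *m f = z *: (f^t* *m X *m f) - f^t* *m (X *m A) *m f.
  have := congr1 (fun M => M^t*) h1.
  by rewrite adjmxB adjmxZ !adjmxM !trmxCK XE conjCK !mulmxA.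
have h3 : f^t* *m (K^t* *m s *m K) *m f =
    - (f^t* *m (X *m A) *m f) - f^t* *m (A^t* *m X) *m f.
  have := congr1 (fun M => f^t* *m M *m f) lyap.
  rewrite mulmx0 mul0mx !mulmxDr !mulmxDl => /eqP; rewrite addrC addr_eq0 => /eqP ->.
  by rewrite opprD.
have -> : qform (invmx s) (eta - s *m K *m f) - qform (invmx s) eta =
    (f^t* *m (K^t* *m s *m K) *m f - f^t* *m K^t* *m eta - eta^t* *m K *m f) 0 0.
  rewrite /qform adjmxB !mulmxBr !mulmxBl !adjmxM sE !mulmxA.
  rewrite (mulmxKV us) -(mulmxA _ s (invmx s)) (mulmxV us) mulmx1.
  by rewrite !mxE; ring.
rewrite h1 h2 h3 /qform -!mulmxA !mxE; ring.
Qed.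

(* Feeding back [P = (s - 1) / 2] turns the indefinite Lyapunov equation into
   [X A' + A'^* X + K^* K = 0]. The dissipation inequality bounds
   [K (z - A')^-1 X^-1 K^*] on [Re z > 0], so [A'] has no eigenvalue there. *)
Lemma posdef_of_dissipative m n (A X : 'M[C]_m) (K : 'M[C]_(n, m)) (s : 'M[C]_n)
    (S : C -> 'M[C]_n) :
  s^t* = s -> s \in unitmx -> X^t* = X -> X \in unitmx -> observable A K ->
  X *m A + A^t* *m X + K^t* *m s *m K = 0 ->
  realizes (fun z => 1%:M - S z) A K (invmx X *m K^t* *m s) ->
  generically (fun z => 'Re z < 0 ->
    forall eta, 0 <= qform (S z *m invmx s *m (S z)^t* - invmx s) eta) ->
  posdef X.
Proof.
move=> sE us XE uX obs lyap hS ineq.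
have ReE' (z : C) : z + z^* = 'Re z *+ 2.
  by rewrite ReE -mulr_natr -mulrA mulVf ?pnatr_eq0// mulr1.
pose P := 2^-1 *: (s - 1%:M); have [E EE] : exists E, E = invmx X *m K^t* by eexists.
pose A' := A + E *m P *m K.
have PE : P^t* = P.
  by rewrite adjmxZ adjmxB adjmx_scalar sE conjC1 fmorphV /= conjC_nat.
have XE' : X *m E = K^t* by rewrite EE mulKVmx.
have EX : E^t* *m X = K by rewrite EE adjmxM trmxCK adjmx_inv XE mulmxKV.
have XA' : X *m A' = X *m A + K^t* *m P *m K.
  by rewrite mulmxDr !mulmxA XE'.
have A'X : A'^t* *m X = A^t* *m X + K^t* *m P *m K.
  by rewrite adjmxD mulmxDl !adjmxM PE -!mulmxA EX.
have lyap' : X *m A' + A'^t* *m X + K^t* *m K = 0.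
  rewrite XA' A'X addrACA -mulmxDl -mulmxDr -scalerDl.
  have -> : 2^-1 + 2^-1 = 1 :> C by field.
  have -> : K^t* *m (1 *: (s - 1%:M)) *m K = K^t* *m s *m K - K^t* *m K.
    by rewrite scale1r mulmxBr mulmx1 mulmxBl.
  by rewrite addrA subrK.
have obs' : observable A' K.
  move=> a v + Kv; rewrite mulmxDl -!mulmxA Kv !mulmx0 addr0 => Av.
  exact: (obs a).
(* Observability transported by [X]: a left eigenvector [w] killed by [E] gives [p = X^-1 w^*] with
   [K p = 0] and, by the Lyapunov equation, [A p = - a^* p]. *)
have ctrl : controllable A' E.
  move=> a w wA wE; pose p := invmx X *m w^t*.
  have wp : w = p^t* *m X by rewrite adjmxM trmxCK adjmx_inv XE mulmxKV.
  have Kp : K *m p = 0.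
    by rewrite -[LHS]trmxCK adjmxM -XE' mulmxA -wp wE adjmx0.
  suff p0 : p = 0 by rewrite wp p0 adjmx0 mul0mx.
  apply: (obs (- a^*)) => //.
  have wA1 : w *m A = a *: w.
    by rewrite -wA mulmxDr !mulmxA wE !mul0mx addr0.
  have : (X *m A + A^t* *m X + K^t* *m s *m K) *m p = 0 by rewrite lyap mul0mx.
  rewrite !mulmxDl -!mulmxA Kp !mulmx0 addr0.
  have -> : X *m p = w^t* by rewrite mulKVmx.
  rewrite -adjmxM wA1 adjmxZ => /eqP; rewrite addr_eq0 => /eqP XAp.
  rewrite -[A *m p](mulKmx uX) XAp mulmxN scaleNr -scalemxAr.
  by rewrite /p.
clearbody A'.
have bnd0 : forall a, 0 < 'Re a ->
    bounded_near a (fun z => K *m invmx (z%:M - A') *m E).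
  (* The radius ['Re a] keeps z in the right half-plane. The bound 2 is the sum of the bounds 1 for
     the entries of [K f - zeta] and of the unit vector [zeta]. *)
  move=> a a0; exists 2, ('Re a); split => //.
  have g1 := generically_opp_conj (genericallyI ineq (proj1 (realizesP _ _ _ _) hS)).
  apply: genericallyW (genericallyI g1 (generically_unitmx A')) => z.
  move=> [[hineq [uz Sz]] uz'] za i j.
  have z0 : 0 < 'Re z.
    have : 'Re (a - z) < 'Re a.
      by rewrite (le_lt_trans (leif_Re_Creal _))// distrC.
    by rewrite raddfB /= ltrBlDr ltrDl.
  pose zeta : 'cV[C]_n := delta_mx j 0.
  have [f fE] : exists f, f = invmx (z%:M - A') *m E *m zeta by eexists.
  (* The inequality on [S] is available in the left half-plane, hence the reflected point. The
     closed-loop state [f] at z is also the state of the open loop for [w] and the vector [eta]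
     below, so dissipation at [w] yields [0 <= qform X f]. *)
  pose w := - z^*.
  have hf : (z%:M - A') *m f = E *m zeta by rewrite fE -mulmxA mulKVmx.
  have A'f : A' *m f = z *: f - E *m zeta.
    by rewrite -hf mulmxBl mul_scalar_mx opprB addrC subrK.
  have [eta etaE] : exists eta, eta = (s - P) *m K *m f - zeta by eexists.
  have hX : (w%:M - A)^t* *m (X *m f) = K^t* *m eta.
    have AXf : A^t* *m X *m f = - (X *m A *m f) - K^t* *m s *m K *m f.
      have := congr1 (fun M => M *m f) lyap; rewrite mul0mx !mulmxDl => /eqP.
      by rewrite [X *m A *m f + _]addrC -addrA addr_eq0 opprD => /eqP.
    have XAf : X *m A *m f = z *: (X *m f) - K^t* *m zeta - K^t* *m P *m K *m f.
      apply/eqP; rewrite eq_sym subr_eq -mulmxDl -XA' -mulmxA A'f mulmxBr.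
      by rewrite -scalemxAr mulmxA XE'.
    rewrite adjmxB adjmx_scalar mulmxBl mul_scalar_mx mulmxA AXf XAf.
    rewrite /w rmorphN /= conjCK scaleNr etaE !mulmxBr !mulmxBl !mulmxBr !mulmxA.
    move: (z *: _) (K^t* *m zeta) (K^t* *m P *m K *m f) (K^t* *m s *m K *m f).
    by move=> x1 x2 x3 x4; apply/matrixP => k l; rewrite !mxE; ring.
  have q0 : 0 <= qform X f.
    have Sw : (S w)^t* *m eta = eta - s *m K *m f.
      have -> : S w = 1%:M - (1%:M - S w) by rewrite opprB addrC subrK.
      rewrite Sz adjmxB adjmx_scalar conjC1 mulmxBl mul1mx; congr (_ - _).
      rewrite !adjmxM sE trmxCK !adjmx_inv XE -!mulmxA -hX.
      by rewrite mulKmx ?adjmx_unit// mulKmx.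
    have w0 : 'Re w < 0 by rewrite raddfN /= Re_conj oppr_lt0.
    have := hineq w0 eta.
    rewrite qformD qformN -[X in qform (X *m _ *m _)](trmxCK (S w)) qform_congr Sw.
    rewrite (dissipation_identity sE us XE lyap hX) ReE' -mulNrn pmulr_rge0//.
    by rewrite -mulr_natr mulr_gt0// oppr_gt0.
  (* The closed loop satisfies the definite Lyapunov equation, in which the excess of the left side
     over the right is [- (z + z^* ) * qform X f]. *)
  have : qform 1%:M (K *m f - zeta) <= qform 1%:M zeta.
    rewrite -subr_le0.
    have -> : qform 1%:M (K *m f - zeta) - qform 1%:M zeta =
        - (z + z^*) * qform X f.
      have := congr1 (fun M => (f^t* *m M *m f) 0 0) lyap'.
      rewrite mulmx0 mul0mx [X in _ = X]mxE !mulmxDr !mulmxDl => h.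
      have XA'f : f^t* *m (X *m A') *m f = z *: (f^t* *m X *m f) - f^t* *m K^t* *m zeta.
        rewrite -!mulmxA A'f mulmxBr -scalemxAr mulmxBr -scalemxAr.
        by rewrite (mulmxA X E) XE'.
      have A'Xf : f^t* *m (A'^t* *m X) *m f =
          z^* *: (f^t* *m X *m f) - zeta^t* *m K *m f.
        have := congr1 (fun M => M^t*) XA'f.
        by rewrite adjmxB adjmxZ !adjmxM !trmxCK XE !mulmxA.
      rewrite XA'f A'Xf !mulmxA in h.
      rewrite /qform adjmxB !mulmx1 !mulmxBr !mulmxBl adjmxM !mulmxA.
      move: h; rewrite -!mulmxA !mxE => h.
      by apply/eqP; rewrite -subr_eq0 -[X in _ == X]h; apply/eqP; ring.
    by rewrite ReE' mulNr oppr_le0 mulr_ge0// mulrn_wge0// ltW.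
  have -> : qform 1%:M zeta = 1.
    rewrite qform1 (bigD1 j)//= mxE !eqxx normr1 expr1n big1 ?addr0// => k /negPf kj.
    by rewrite mxE kj normr0 expr0n.
  rewrite qform1 (bigD1 i)//= => hle.
  have hi : `|(K *m f - zeta) i 0| <= 1.
    rewrite -(@ler_pXn2r _ 2)// ?nnegrE// expr1n (le_trans _ hle)// lerDl.
    by apply: sumr_ge0 => k _; exact: exprn_ge0.
  have -> : (K *m invmx (z%:M - A') *m E) i j = (K *m f - zeta) i 0 + zeta i 0.
    have -> : (K *m invmx (z%:M - A') *m E) i j = (K *m f) i 0.
      by rewrite fE /zeta !mulmxA -colE [in RHS]mxE.
    by rewrite -{1}[K *m f](subrK zeta) mxE.
  have h1 : `|zeta i 0| <= 1.
    by rewrite mxE; case: (_ && _); rewrite ?normr1 ?normr0 ?ler01.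
  exact: le_trans (ler_normD _ _) (lerD hi h1).
(* Induction by [(z - A')^-1 A' = z (z - A')^-1 - 1]: multiplication by z and subtraction of a
   constant keep local boundedness. *)
have bnd a k : 0 < 'Re a ->
    bounded_near a (fun z => K *m invmx (z%:M - A') *m (A' ^+ k *m E)).
  move=> a0; elim: k => [|k IH]; first by rewrite expr0 mul1mx; exact: bnd0.
  have := bounded_nearB (bounded_nearM (bounded_near_id a n) IH)
    (bounded_near_cst a (K *m (A' ^+ k *m E))).
  apply: bounded_nearW; apply: genericallyW (generically_unitmx A') => z u.
  rewrite mul_scalar_mx exprS -mulmxE -!mulmxA scalemxAr -mulmxBr; congr (K *m _).
  rewrite -[X in _ - X](mulKmx u) scalemxAr -mulmxBr; congr (_ *m _).
  by rewrite mulmxBl mul_scalar_mx opprB addrC subrK.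
apply: (lyapunov_posdef XE lyap' obs') => a ra.
have [v v0 Av] := root_eigenvector ra.
have Kv0 : K *m v != 0 by apply: contra_neq v0 => /(obs' _ _ Av).
have h : (a + a^*) * qform X v = - qform 1%:M (K *m v).
  have := congr1 (fun M => qform M v) lyap'.
  rewrite !qformD -[K^t*]mulmx1 qform_congr {4}/qform mulmx0 mul0mx [X in _ = X]mxE.
  move/eqP; rewrite addr_eq0 => /eqP <-; rewrite mulrDl; congr (_ + _).
    by rewrite /qform -!mulmxA Av -!scalemxAr [in RHS]mxE.
  by rewrite /qform mulmxA -adjmxM Av adjmxZ -!scalemxAl [in RHS]mxE.
(* If [0 < 'Re a], controllability writes [v] through the [A'^k E], so [K v / (z - a)] would be
   bounded near [a]. If ['Re a = 0], the Lyapunov equation at [v] already gives [K v = 0]. *)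
have [//|a0|a0] := real_ltgtP (Creal_Re a) (real0 C).
  case/eqP: Kv0; have [Y YE] := controllable_span ctrl.
  have := bounded_near_sum (fun k : 'I_m =>
    bounded_nearM (bnd a k a0) (bounded_near_cst a (Y k *m v))).
  move/bounded_near_pole; apply; apply: genericallyW
    (genericallyI (generically_unitmx A') (generically_poly (monic_neq0 (monicXsubC a)))) => z.
  rewrite hornerXsubC => -[u za].
  rewrite (eq_bigr (fun k : 'I_m => K *m invmx (z%:M - A') *m (A' ^+ k *m E *m Y k) *m v)).
    rewrite -mulmx_suml -mulmx_sumr YE mulmx1 -mulmxA.
    have -> : invmx (z%:M - A') *m v = (z - a)^-1 *: v.
      apply: (can_inj (mulKmx u)); rewrite mulKVmx// -scalemxAr mulmxBl mul_scalar_mx Av.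
      by rewrite -scalerBl scalerA mulVf// scale1r.
    by rewrite -scalemxAr scalerA mulfV// scale1r.
  by move=> k _; rewrite !mulmxA.
move: h; rewrite ReE' a0 mul0rn mul0r => /esym/eqP; rewrite oppr_eq0 => /eqP h.
by have := qform1_gt0 Kv0; rewrite h ltxx.
Qed.

End Positivity.

(** * Realizations of symmetric functions *)

Section Symmetric.
Context {C : numClosedFieldType}.

Lemma unitmx_injective m (X : 'M[C]_m) :
  (forall v : 'cV_m, X *m v = 0 -> v = 0) -> X \in unitmx.
Proof.
move=> inj; rewrite -unitmx_tr -row_free_unit -kermx_eq0.
apply/eqP/row_matrixP => i; rewrite row0; apply: trmx_inj; rewrite trmx0.
apply: inj; apply: trmx_inj.
by rewrite trmx_mul trmxK trmx0 -row_mul mulmx_ker row0.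
Qed.

(* By the Lyapunov equation [ker X] is [A]-invariant, and [K] vanishes on it. *)
Lemma gram_injective m n (A X : 'M[C]_m) (K : 'M[C]_(n, m)) (s : 'M[C]_n) :
  observable A K -> X *m A + A^t* *m X + K^t* *m s *m K = 0 ->
  (forall v : 'cV_m, X *m v = 0 -> K *m v = 0) -> X \in unitmx.
Proof.
move=> obs lyap XK; apply: unitmx_injective => v Xv.
apply: (observable_kernel (U := fun u => X *m u = 0) obs) => // a u Xu.
have := congr1 (fun M => M *m u) lyap.
rewrite mul0mx !mulmxDl -!mulmxA Xu (XK _ Xu) !mulmx0 !addr0 => XAu.
by rewrite mulmxBr XAu -scalemxAr Xu scaler0 subrr.
Qed.

(* [S(z) = s^-1 S(-z^* )^-* s] turns a realization of [1 - S] into a second one;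
   the similarity between the two is Hermitian and solves the Lyapunov equation. *)
Lemma symmetric_realization n (s : 'M[C]_n) (S : C -> 'M[C]_n) m (A : 'M[C]_m) K D :
  s^t* = s -> s \in unitmx -> realizes (fun z => 1%:M - S z) A K D ->
  generically (fun z => S z *m invmx s *m (S (- z^*))^t* = invmx s) ->
  exists m' (A' X : 'M[C]_m') (K' : 'M[C]_(n, m')),
    [/\ X^t* = X /\ X \in unitmx, observable A' K',
        X *m A' + A'^t* *m X + K'^t* *m s *m K' = 0 &
        realizes (fun z => 1%:M - S z) A' K' (invmx X *m K'^t* *m s)].
Proof.
move=> sE us /minimal_realization[{}m [{}A [{}K [{}D [hS obs ctrl]]]]] sym.
have JE : (invmx s)^t* = invmx s by rewrite adjmx_inv sE.
(* The inverse of [1 - K (z - A)^-1 D] has state matrix [A + D K]; the adjoint and the reflection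
   [z -> - z^*] turn it into [- (A + D K)^*]. *)
pose A1 := - (A^t* + K^t* *m D^t*).
have hS1 : realizes (fun z => 1%:M - S z) A1 (invmx s *m D^t*) (K^t* *m s).
  apply: genericallyW (genericallyI (generically_unitmx A1) (genericallyI sym
    (generically_opp_conj hS))) => z [u [symz [Y YD SY]]].
  pose V := invmx (z%:M - A1) *m K^t*; exists (V *m s).
    by rewrite mulmxA mulKVmx.
  pose a := D^t* *m V; pose b := Y^t* *m K^t*.
  have Swb : (S (- z^*))^t* = 1%:M - b.
    have -> : S (- z^*) = 1%:M - (1%:M - S (- z^*)) by rewrite opprB addrC subrK.
    by rewrite SY adjmxB adjmx_scalar conjC1 adjmxM.
  have DE : D^t* = - (Y^t* *m (z%:M + A^t*)).
    rewrite -YD adjmxM -mulmxN adjmxB adjmx_scalar rmorphN /= conjCK opprD.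
    by rewrite [(- z)%:M]raddfN.
  have zA : z%:M + A^t* = z%:M - A1 - K^t* *m D^t*.
    by rewrite /A1 opprK addrA addrK.
  (* A resolvent identity; it says that [1 - b], the adjoint of [S] at the reflected point, has the
     inverse [1 - a]. *)
  have ab : a + b = b *m a.
    rewrite /a {1}DE zA mulNmx -mulmxA mulmxBl mulKVmx// mulmxBr opprB addrAC.
    by rewrite -/b addrK !mulmxA.
  have ba1 : (1%:M - b) *m (1%:M - a) = 1%:M.
    rewrite mulmxBl !mul1mx mulmxBr mulmx1 -ab opprB addrA.
    by rewrite addrA subrK addrK.
  have SJ : S z *m invmx s = invmx s *m (1%:M - a).
    by rewrite -[in RHS]symz Swb -!mulmxA ba1 mulmx1.
  have -> : S z = invmx s *m (1%:M - a) *m s by rewrite -SJ mulmxKV.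
  by rewrite mulmxBr mulmx1 mulmxBl mulVmx// opprB addrC subrK /a !mulmxA.
have obs1 : observable A1 (invmx s *m D^t*).
  move=> a v Av Dv.
  have Dv0 : D^t* *m v = 0 by rewrite -(mulKVmx us (D^t* *m v)) (mulmxA (invmx s)) Dv mulmx0.
  suff : v^t* = 0 by move=> /(congr1 (fun M => M^t*)); rewrite trmxCK adjmx0.
  apply: (ctrl (- a^*)); last by rewrite -[D]trmxCK -adjmxM Dv0 adjmx0.
  have Av1 : A^t* *m v = - a *: v.
    have : - (A1 *m v) = - (a *: v) by rewrite Av.
    by rewrite /A1 mulNmx opprK mulmxDl -mulmxA Dv0 mulmx0 addr0 -scaleNr.
  by rewrite -[A]trmxCK -adjmxM Av1 adjmxZ rmorphN.
have [X [XA XD XK]] := realizes_similar hS hS1 ctrl obs1.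
have KD : K^t* = X^t* *m D *m invmx s by rewrite -XK !adjmxM trmxCK JE !mulmxA.
have DX : D^t* *m X = s *m K by rewrite -XK mulmxA mulKVmx.
have XtD : X^t* *m D = K^t* *m s by rewrite KD mulmxKV.
have DXt : D^t* *m X^t* = s *m K.
  by rewrite -adjmxM XD adjmxM sE trmxCK.
(* Both [X] and its adjoint intertwine [A] with [A1] and agree on [D], so they agree on every
   [A^k D]; controllability concludes. *)
have XE : X^t* = X.
  apply/eqP; rewrite -subr_eq0; apply/eqP; apply: (controllable_powers ctrl) => k.
  have XtA : X^t* *m A = A1 *m X^t*.
    have := congr1 (fun M => M^t*) XA.
    rewrite !adjmxM /A1 adjmxN adjmxD adjmxM !trmxCK mulmxN mulmxDr mulmxA XtD => h.
    by rewrite mulNmx mulmxDl -(mulmxA (K^t* )) DXt mulmxA h opprD opprK addrK.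
  have pow (M : 'M[C]_m) : M *m A = A1 *m M -> M *m A ^+ k = A1 ^+ k *m M.
    move=> MA; elim: k => [|k IH]; first by rewrite !expr0 mulmx1 mul1mx.
    by rewrite exprSr exprS -!mulmxE mulmxA IH -!mulmxA MA !mulmxA mulmxE -exprSr exprS.
  by rewrite mulmxBl !pow// -!mulmxBr -!mulmxA mulmxBl XtD XD subrr mulmx0.
have lyap : X *m A + A^t* *m X + K^t* *m s *m K = 0.
  rewrite XA /A1 mulNmx mulmxDl -!mulmxA DX opprD addrAC.
  by rewrite subrK addNr.
have uX : X \in unitmx.
  by apply: (gram_injective obs lyap) => v Xv; rewrite -XK -!mulmxA Xv !mulmx0.
exists m, A, X, K; split => //.
by rewrite -mulmxA -XD mulKmx.
Qed.

End Symmetric.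

(** * Strictly proper rational functions *)

Section ProperFractions.
Context {C : numClosedFieldType}.

Definition proper_fraction m n (W : C -> 'M[C]_(m, n)) : Prop :=
  exists (N : 'M[{poly C}]_(m, n)) (q : {poly C}),
    [/\ q != 0, forall i j, (size (N i j) < size q)%N &
        generically (fun z => W z = q.[z]^-1 *: map_mx (horner_eval z) N)].

Lemma proper_fraction_realizes m n (W : C -> 'M[C]_(m, n)) : proper_fraction W ->
  exists p (A : 'M[C]_p) (K : 'M[C]_(m, p)) (D : 'M[C]_(p, n)), realizes W A K D.
Proof.
move=> [N [q [q0 sN WE]]]; have [rs qE] := closed_field_poly_normal q.
have l0 : lead_coef q != 0 by rewrite lead_coef_eq0.
have sq : size q = (size rs).+1 by rewrite qE size_scale// size_prod_XsubC.
have [|p [A [K [D h]]]] := @realize_fraction _ _ _ rs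
    (map_mx (fun x => (lead_coef q)^-1 *: x) N).
  by move=> i j; rewrite mxE size_scale ?invr_eq0// -ltnS -sq.
exists p, A, K, D; apply: genericallyW (genericallyI h WE) => z [[Y YD WY] ->].
exists Y => //; rewrite -WY {1}qE hornerZ invfM mulrC -scalerA; congr (_ *: _).
by apply/matrixP => i j; rewrite !mxE /horner_eval hornerZ.
Qed.

Lemma realizes_proper_fraction m n (W : C -> 'M[C]_(m, n)) p (A : 'M[C]_p)
    (K : 'M[C]_(m, p)) (D : 'M[C]_(p, n)) : realizes W A K D -> proper_fraction W.
Proof.
move=> /realizesP hW.
exists (map_mx polyC K *m \adj (char_poly_mx A) *m map_mx polyC D), (char_poly A).
split; first exact: char_poly_neq0.
  move=> i j; rewrite size_char_poly ltnS; apply/leq_sizeP => k pk.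
  have := coefp_mulmx K (\adj (char_poly_mx A)) D k.
  by rewrite adj_char_poly_coef_ge// mulmx0 mul0mx => /matrixP/(_ i j); rewrite !mxE.
apply: genericallyW hW => z [u ->]; rewrite horner_mulmx.
rewrite -[map_mx _ (\adj _)](mulKmx u) horner_adj_char_poly mul_mx_scalar.
by rewrite -scalemxAr -scalemxAl scalerA mulVf ?scale1r// -resolvent_unitmx.
Qed.

Lemma proper_fractionD m n (V W : C -> 'M[C]_(m, n)) :
  proper_fraction V -> proper_fraction W -> proper_fraction (fun z => V z + W z).
Proof.
move=> [N [q [q0 sN VE]]] [M [r [r0 sM WE]]].
exists (map_mx (fun x => r * x) N + map_mx (fun x => q * x) M), (q * r); split.
- by rewrite mulf_neq0.
- move=> i j; rewrite !mxE (leq_ltn_trans (size_polyD _ _))// gtn_max.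
  have aux (x y z : {poly C}) : y != 0 -> (size x < size z)%N ->
      (size (y * x)%R < size (y * z)%R)%N.
    move=> y0 xz; have z0 : z != 0 by rewrite -size_poly_gt0 (leq_ltn_trans _ xz).
    have [->|x0] := eqVneq x 0.
      by rewrite mulr0 size_poly0 size_poly_gt0 mulf_neq0.
    rewrite !size_mul//; move: xz; have := size_poly_gt0 y; rewrite y0.
    by case: (size y) => // k _; rewrite !addSn /= ltn_add2l.
  by apply/andP; split; [rewrite [q * r]mulrC|]; exact: aux.
have g := genericallyI (generically_poly q0) (generically_poly r0).
apply: genericallyW (genericallyI g (genericallyI VE WE)) => z [[qz rz] [-> ->]].
apply/matrixP => i j; rewrite !mxE /horner_eval !hornerE; field.
by rewrite qz rz.
Qed.

Lemma proper_fractionN m n (V : C -> 'M[C]_(m, n)) :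
  proper_fraction V -> proper_fraction (fun z => - V z).
Proof.
move=> [N [q [q0 sN VE]]]; exists (- N), q; split => //.
  by move=> i j; rewrite mxE size_polyN.
by apply: genericallyW VE => z ->; rewrite map_mxN scalerN.
Qed.

Lemma bounded_near_poly (a : C) (p : {poly C}) :
  bounded_near a (fun z => (p.[z])%:M : 'M[C]_1).
Proof.
elim/poly_ind: p => [|p c IH].
  by apply: bounded_nearW (bounded_near_cst a 0); apply: genericallyT => z; rewrite horner0 raddf0.
have := bounded_nearD (bounded_nearM IH (bounded_near_id a 1)) (bounded_near_cst a c%:M).
by apply: bounded_nearW; apply: genericallyT => z; rewrite hornerMXaddC raddfD /= scalar_mxM.
Qed.

(** Liouville's theorem for rational functions, by induction on the degree of [q]: at a root [a] of
    [q] boundedness forces [p.[a] = 0], and the common factor cancels. Once [q] is constant, strict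
    properness leaves [p = 0]. *)
Lemma proper_bounded_poly0 (p q : {poly C}) :
  q != 0 -> (size p < size q)%N ->
  (forall a, bounded_near a (fun z => (p.[z] / q.[z])%:M : 'M[C]_1)) -> p = 0.
Proof.
have [k] := ubnP (size q); elim: k p q => // k IH p q sq q0 spq bnd.
have [sq1|/closed_rootP[a qa]] := eqVneq (size q) 1%N.
  by move: spq; rewrite sq1 ltnS leqn0 size_poly_eq0 => /eqP.
have /factor_theorem[q1 qE] := qa.
have /factor_theorem[p1 pE] : root (p - (p.[a])%:P) a.
  by rewrite /root !hornerE subrr.
have q10 : q1 != 0 by apply: contraNneq q0 => q10; rewrite qE q10 mul0r.
have sizeM (x : {poly C}) : x != 0 -> size (x * ('X - a%:P)) = (size x).+1.
  by move=> x0; rewrite size_Mmonic ?monicXsubC// size_XsubC addn2.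
have pa : p.[a] = 0.
  have := bounded_nearB (bounded_nearM (bnd a) (bounded_near_poly a q1)) (bounded_near_poly a p1).
  move=> /(@bounded_near_pole _ _ _ _ (p.[a])%:M) h.
  have /matrixP/(_ 0 0) : (p.[a])%:M = 0 :> 'M[C]_1; last by rewrite !mxE.
  apply: h; apply: genericallyW (generically_poly q0) => z.
  rewrite qE hornerM hornerXsubC mulf_eq0 negb_or => /andP[q1z za].
  rewrite -scalar_mxM -raddfB /= scale_scalar_mx; congr (_%:M).
  (* Thus [p.[a] = (z - a) ((p / q) q1 - p1)] with a bounded second factor, the situation of
     [bounded_near_pole]. *)
  have -> : p.[a] = p.[z] - p1.[z] * (z - a).
    by rewrite -[z - a]hornerXsubC -hornerM -pE !hornerE opprB addrC subrK.
  by field; rewrite q1z za.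
rewrite pa subr0 in pE.
suff p10 : p1 = 0 by rewrite pE p10 mul0r.
have sp1 : (size p1 < size q1)%N.
  have [->|p10] := eqVneq p1 0; first by rewrite size_poly0 size_poly_gt0.
  by move: spq; rewrite qE pE !sizeM.
apply: (IH p1 q1) => //; first by move: sq; rewrite qE sizeM.
move=> b; apply: bounded_nearW (bnd b); apply: genericallyW (generically_poly q0) => z.
rewrite {1 2}qE {1}pE !hornerM hornerXsubC mulf_eq0 negb_or => /andP[q1z za].
by congr (_%:M); field; rewrite q1z za.
Qed.

Lemma proper_fraction_bounded0 m n (W : C -> 'M[C]_(m, n)) :
  proper_fraction W -> (forall a, bounded_near a W) -> generically (fun z => W z = 0).
Proof.
move=> [N [q [q0 sN WE]]] bnd.
suff N0 : N = 0.
  apply: genericallyW WE => z ->; rewrite N0; apply/matrixP => i j.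
  by rewrite !mxE /horner_eval horner0 mulr0.
apply/matrixP => i j; rewrite [RHS]mxE; apply: (proper_bounded_poly0 q0 (sN i j)) => a.
have [M [e [M0 e0 h]]] := bnd a; exists M, e; split => //.
apply: genericallyW (genericallyI h WE) => z [+ WzE] za k l => /(_ za i j).
by rewrite WzE !mxE /horner_eval !ord1 mulr1n mulrC.
Qed.

Lemma norm_horner_le (p : {poly C}) k z : (size p <= k.+1)%N -> 1 <= `|z| ->
  `|p.[z]| <= (\sum_(i < size p) `|p`_i|) * `|z| ^+ k.
Proof.
move=> sp z1; rewrite horner_coef mulr_suml (le_trans (ler_norm_sum _ _ _))//.
apply: ler_sum => i _; rewrite normrM normrX ler_wpM2l// ler_weXn2l//.
by rewrite -ltnS (leq_trans _ sp).
Qed.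

Lemma size_lt_of_vanishing (p q : {poly C}) : q != 0 ->
  (forall e, 0 < e -> exists2 r, 0 <= r & forall z, q.[z] != 0 -> r < `|z| ->
     `|p.[z]| <= e * `|q.[z]|) -> (size p < size q)%N.
Proof.
move=> q0 h; rewrite ltnNge; apply/negP => spq.
have p0 : p != 0 by rewrite -size_poly_gt0 (leq_trans _ spq)// size_poly_gt0.
pose d := (size p).-1; have sp : size p = d.+1 by rewrite prednK// size_poly_gt0.
pose B := \sum_(i < size q) `|q`_i|; pose B' := \sum_(i < d) `|p`_i|.
have lp : 0 < `|p`_d| by rewrite normr_gt0 -lead_coefE lead_coef_eq0.
have B0 : 0 <= B by exact: sumr_ge0.
have B1 : 0 < B + 1 by rewrite ltr_wpDl.
have B'0 : 0 <= B' by exact: sumr_ge0.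
(* With this [e], the bound on [p] by [q] costs at most half of the leading term of [p]. *)
pose e := `|p`_d| / 2 / (B + 1).
have e0 : 0 < e by rewrite !divr_gt0.
have [r r0 hr] := h e e0.
(* Beyond the last summand the lower terms of [p] are less than half of the leading one; the others
   ensure [r < |z|] and [1 <= |z|]. The step from [z1] to [z0] leaves room to avoid the roots of
   [q]. *)
pose z1 := r + 1 + B' * 2 / `|p`_d|; pose z0 := z1 + 1.
have b0 : 0 <= B' * 2 / `|p`_d| by rewrite divr_ge0// mulr_ge0.
have z00 : 0 <= z0 by rewrite !addr_ge0.
have [z qz zz0] := generically_near z0 (generically_poly q0) ltr01.
have zbig : z1 < `|z|.
  have := ler_normB z (z - z0); rewrite subKr (ger0_norm z00) => zz.
  by rewrite -(ltrD2r 1) -/z0 (le_lt_trans zz)// ltrD2l.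
have zr : r < `|z| by rewrite (le_lt_trans _ zbig)// /z1 -addrA lerDl addr_ge0.
have z1' : 1 <= `|z|.
  by rewrite (le_trans _ (ltW zbig))// /z1 -addrA addrCA lerDl addr_ge0.
have zB : B' * 2 / `|p`_d| < `|z| by rewrite (le_lt_trans _ zbig)// lerDr addr_ge0.
have zpos : 0 < `|z| by rewrite (lt_le_trans ltr01).
have pz := hr z qz zr.
have qle : `|q.[z]| <= B * `|z| ^+ d by apply: norm_horner_le => //; rewrite -sp.
pose p' := \sum_(i < d) p`_i * z ^+ i.
have pzE : p.[z] = p' + p`_d * z ^+ d by rewrite horner_coef sp big_ord_recr.
have p'le : `|p'| * `|z| <= B' * `|z| ^+ d.
  rewrite /p' -normrM mulr_suml (le_trans (ler_norm_sum _ _ _))// mulr_suml.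
  apply: ler_sum => i _; rewrite !normrM normrX -mulrA ler_wpM2l// -exprSr.
  by rewrite ler_weXn2l.
have : `|p`_d| * `|z| ^+ d * `|z| <= (e * (B * `|z| ^+ d)) * `|z| + B' * `|z| ^+ d.
  apply: le_trans (lerD (ler_wpM2r (ltW zpos) (le_trans pz (ler_wpM2l (ltW e0) qle))) p'le).
  rewrite -mulrDl ler_wpM2r// -normrX -normrM.
  have -> : p`_d * z ^+ d = p.[z] - p' by rewrite pzE addrC addKr.
  exact: ler_normB.
have -> : `|p`_d| * `|z| ^+ d * `|z| = `|p`_d| * `|z| * `|z| ^+ d by ring.
have -> : (e * (B * `|z| ^+ d)) * `|z| + B' * `|z| ^+ d =
  (e * B * `|z| + B') * `|z| ^+ d by ring.
rewrite ler_pM2r ?exprn_gt0//.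
have eB : e * B * `|z| <= `|p`_d| / 2 * `|z|.
  rewrite ler_wpM2r// /e mulrAC ler_pdivrMr// ler_wpM2l ?divr_ge0//.
  by rewrite lerDl.
move=> /le_trans/(_ (lerD eB (lexx _))); rewrite -lerBlDl.
have -> : `|p`_d| * `|z| - `|p`_d| / 2 * `|z| = `|p`_d| * `|z| / 2 by field.
apply/negP; rewrite -real_ltNge ?ger0_real//.
by move: zB; rewrite ltr_pdivrMr// ltr_pdivlMr// [`|z| * _]mulrC.
Qed.

End ProperFractions.

(** * Rational functions of a complex variable *)

Section RationalFunctions.
Context {R : realType}.
Local Notation C := R[i].
Local Open Scope complex_scope.

Lemma norm_normc (z : C) : `|z| = (Normc.normc z)%:C.
Proof. by case: z => a b; rewrite normc_def. Qed.

Lemma normc_ge0 (z : C) : 0 <= Normc.normc z.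
Proof. by rewrite -ler0c -norm_normc normr_ge0. Qed.

Lemma normc_entry_le m n (A B : 'M[C]_(m, n)) i j :
  Normc.normc (A i j - B i j) <= mx_dist A B.
Proof.
rewrite /mx_dist (bigD1 i)//= (bigD1 j)//= -addrA lerDl addr_ge0//.
  by apply: sumr_ge0 => k _; exact: normc_ge0.
by apply: sumr_ge0 => k _; apply: sumr_ge0 => l _; exact: normc_ge0.
Qed.

Lemma Re_lt0 (z : C) : ('Re z < 0) = (complex.Re z < 0).
Proof. by rewrite -complexRe -(ltcR (complex.Re z)). Qed.

Lemma rationalmx_proper n (f : C -> 'M[C]_n) :
  rationalmx f -> lim_at_infinity f 1%:M -> proper_fraction (fun z => 1%:M - f z).
Proof.
move=> [P [q [q0 fE]]] lim1; exists (q%:M - P), q; split => //; last first.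
  exists q => // z qz; rewrite fE// map_mxB map_scalar_mx /=.
  by rewrite scalerBr scale_scalar_mx /horner_eval mulVf.
move=> i j; apply: size_lt_of_vanishing => // e e0.
have eE : e = (complex.Re e)%:C by rewrite RRe_real// gtr0_real.
have e0' : 0 < complex.Re e by rewrite -ltcR -eE.
have [r hr] := lim1 _ e0'.
exists (Num.max r 0)%:C; first by rewrite ler0c le_max lexx orbT.
move=> z qz rz.
have rz' : r < Normc.normc z.
  by move: rz; rewrite norm_normc ltcR; apply: le_lt_trans; rewrite le_max lexx.
have -> : ((q%:M - P) i j).[z] = q.[z] * ((1%:M - f z) i j).
  rewrite fE// !mxE !hornerE /horner_eval mulrBr mulVKf//; congr (_ - _).
  by rewrite hornerMn mulrnAr mulr1.
rewrite normrM mulrC ler_wpM2r// {1}eE norm_normc lecR ltW//.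
apply: le_lt_trans (hr z rz'); have := normc_entry_le (f z) 1%:M i j.
by rewrite -[X in X <= _ -> _]normcN opprB !mxE.
Qed.

Lemma rationalmx_analytic n (f : C -> 'M[C]_n) : rationalmx f -> generically (analytic_at f).
Proof. by move=> [P [q [q0 fE]]]; exists q => // z qz; exists P, q. Qed.

(** The identity theorem: after cross-multiplication both sides are polynomials that agree
    generically, hence everywhere, in particular at a point where neither [q] nor [char_poly A]
    vanishes. *)
Lemma analytic_realization n (f : C -> 'M[C]_n) m (A : 'M[C]_m) K D z :
  realizes (fun z => 1%:M - f z) A K D -> analytic_at f z -> z%:M - A \in unitmx ->
  f z = 1%:M - K *m invmx (z%:M - A) *m D.
Proof.
move=> /realizesP h [P [q [qz fE]]] uz.
pose chi := char_poly A.
pose N := map_mx polyC K *m \adj (char_poly_mx A) *m map_mx polyC D.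
have NE w : w%:M - A \in unitmx ->
    map_mx (horner_eval w) N = chi.[w] *: (K *m invmx (w%:M - A) *m D).
  move=> u; rewrite horner_mulmx -[map_mx _ (\adj _)](mulKmx u) horner_adj_char_poly.
  by rewrite mul_mx_scalar -scalemxAr -scalemxAl.
clearbody N.
have q0 : q != 0 by apply: contraNneq qz => ->; rewrite horner0.
have E : forall i j, chi * P i j = q * (chi *+ (i == j) - N i j).
  move=> i j; apply/eqP; rewrite -subr_eq0; apply/eqP/generically_root.
  apply: genericallyW (genericallyI h (generically_poly q0)) => w [[u Wf] qw].
  have := NE w u; rewrite -Wf => /matrixP/(_ i j); rewrite fE// !mxE /horner_eval => Nw.
  rewrite !hornerE hornerMn Nw; case: (i == j); rewrite ?mulr1n ?mulr0n; field; exact: qw.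
have cz : chi.[z] != 0 by rewrite -resolvent_unitmx.
apply: (scalerI cz); rewrite scalerBr -NE// fE//.
apply/matrixP => i j; have /(congr1 (fun p => p.[z])) := E i j.
rewrite hornerM [in RHS]hornerM => Ez; rewrite !mxE /horner_eval mulrCA Ez mulKf//.
by rewrite hornerD hornerN hornerMn mulrnAr mulr1.
Qed.

Lemma rational_realization n (s : 'M[C]_n) (f : C -> 'M[C]_n) :
  s^t* = s -> s \in unitmx -> rationalmx f -> lim_at_infinity f 1%:M ->
  (forall z, analytic_at f z -> analytic_at f (- Num.conj z) ->
     f z *m invmx s *m (f (- Num.conj z))^t* = invmx s) ->
  exists m (A X : 'M[C]_m) (K : 'M[C]_(n, m)),
    [/\ X^t* = X /\ X \in unitmx, observable A K,
        X *m A + A^t* *m X + K^t* *m s *m K = 0 &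
        realizes (fun z => 1%:M - f z) A K (invmx X *m K^t* *m s)].
Proof.
move=> sE us rf lf sym.
have [m [A [K [D h]]]] := proper_fraction_realizes (rationalmx_proper rf lf).
apply: (symmetric_realization sE us h).
have g := rationalmx_analytic rf.
apply: genericallyW (genericallyI g (generically_opp_conj g)) => z [az az'].
exact: sym.
Qed.

Lemma rational_posdef n (s : 'M[C]_n) (f : C -> 'M[C]_n) m (A X : 'M[C]_m)
    (K : 'M[C]_(n, m)) :
  s^t* = s -> s \in unitmx -> rationalmx f ->
  (forall z, analytic_at f z -> complex.Re z < 0 ->
     psdmx (f z *m invmx s *m (f z)^t* - invmx s)) ->
  X^t* = X -> X \in unitmx -> observable A K ->
  X *m A + A^t* *m X + K^t* *m s *m K = 0 ->
  realizes (fun z => 1%:M - f z) A K (invmx X *m K^t* *m s) -> posdef X.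
Proof.
move=> sE us rf ineq XE uX obs lyap h.
apply: (posdef_of_dissipative sE us XE uX obs lyap h).
apply: genericallyW (rationalmx_analytic rf) => z az; rewrite Re_lt0 => z0 eta.
exact: ineq az z0 eta.
Qed.

End RationalFunctions.

(** * Absolutely continuous functions *)

Section AbsolutelyContinuous.
Context {R : realType}.
Notation mu := (@lebesgue_measure R).
Implicit Types (I : interval R) (f g : R -> R).

Lemma itv_mid I a b t : a \in I -> b \in I -> a <= t -> t <= b -> t \in I.
Proof.
case: I => l u; rewrite !itv_boundlr => /andP[la _] /andP[_ bu] at_ tb.
by rewrite (le_trans la) ?bnd_simp// (le_trans _ bu)// bnd_simp.
Qed.

Definition ac I f : Prop := loc_abs_cont (fun x y : R => `|x - y|) I f.

(** The common source of the closure properties: the increments of [f] are controlled by those of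
    finitely many absolutely continuous functions. With [T] and [d] arbitrary it also serves for
    matrices and for operators. *)
Lemma ac_dominated (T : Type) (d : T -> T -> R) I (J : finType) (g : J -> R -> R)
    (f : R -> T) : (forall j, ac I (g j)) ->
  (forall a b, a \in I -> b \in I -> exists2 M, 0 <= M & forall x y,
     a <= x -> x <= y -> y <= b -> d (f x) (f y) <= M * \sum_j `|g j x - g j y|) ->
  loc_abs_cont d I f.
Proof.
move=> acg dom a b aI bI e e0; have [M M0 hM] := dom a b aI bI.
pose e' := e / (#|J|.+1%:R * (M + 1)).
have M1 : 0 < M + 1 by rewrite ltr_wpDl.
have e'0 : 0 < e' by rewrite divr_gt0// mulr_gt0.
have /choice[dl hdl] j : exists dl, 0 < dl /\
    forall (k : nat) (x y : 'I_k -> R),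
      (forall i, a <= x i /\ x i <= y i /\ y i <= b) ->
      (forall i j : 'I_k, (i < j)%N -> y i <= x j) ->
      \sum_i (y i - x i) < dl -> \sum_i `|g j (x i) - g j (y i)| < e'.
  by have [dl dl0 h] := acg j a b aI bI e' e'0; exists dl.
exists (\big[Num.min/1]_j dl j).
  apply: (big_ind (fun z => 0 < z)) => //; first by move=> x y x0 y0; rewrite lt_min x0.
  by move=> j _; case: (hdl j).
move=> k x y xy srt lt_sum.
apply: (@le_lt_trans _ _ (M * \sum_j \sum_i `|g j (x i) - g j (y i)|)).
  rewrite exchange_big mulr_sumr; apply: ler_sum => i _.
  by have [ax [xyi yb]] := xy i; exact: hM.
apply: (@le_lt_trans _ _ (M * (#|J|%:R * e'))).
  rewrite ler_wpM2l// mulr_natl -sumr_const ler_sum// => j _.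
  have [_ h] := hdl j; apply/ltW/h => //; apply: lt_le_trans lt_sum _.
  exact: bigmin_le_cond.
rewrite /e' !mulrA ltr_pdivrMr ?mulr_gt0// -subr_gt0 -natr1.
have -> : e * ((#|J|%:R + 1) * (M + 1)) - M * #|J|%:R * e = e * (#|J|%:R + M + 1) by ring.
by rewrite mulr_gt0// ltr_wpDl// addr_ge0.
Qed.

Lemma ac_uniformly_continuous I f a b e : ac I f -> a \in I -> b \in I -> 0 < e ->
  exists2 dl, 0 < dl & forall x y, a <= x -> x <= y -> y <= b -> y - x < dl ->
    `|f x - f y| < e.
Proof.
move=> acf aI bI /(acf a b aI bI)[dl dl0 h]; exists dl => // x y ax xy yb lt.
have := h 1%N (fun=> x) (fun=> y); rewrite !big_ord1; apply => //.
by move=> i j; rewrite !ord1.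
Qed.

Lemma ac_continuous I f a b : ac I f -> a \in I -> b \in I ->
  {within `[a, b], continuous f}.
Proof.
move=> acf aI bI; apply/subspace_continuousP => x /=; rewrite in_itv /= => /andP[ax xb].
apply/cvgrPdist_lt => e e0.
have [dl dl0 h] := ac_uniformly_continuous acf aI bI e0.
rewrite /prop_near1 /within /=.
exists dl => //= y; rewrite /ball_ /= => xy; rewrite in_itv /= => /andP[ay yb].
have [xy'|yx'] := leP x y.
  by apply: h => //; move: xy; rewrite distrC ger0_norm// subr_ge0.
rewrite distrC; apply: h => //; first exact: ltW.
by move: xy; rewrite ger0_norm// subr_ge0 ltW.
Qed.

Lemma ac_bounded I f a b : ac I f -> a \in I -> b \in I ->
  exists2 M, 0 <= M & forall x, a <= x -> x <= b -> `|f x| <= M.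
Proof.
move=> acf aI bI; have [ab|ba] := leP a b; last first.
  by exists 0 => // x ax xb; move: ba; rewrite ltNge (le_trans ax xb).
have cf := ac_continuous acf aI bI.
have [c _ hc] := EVT_max ab cf; have [c' _ hc'] := EVT_min ab cf.
exists (Num.max `|f c| `|f c'|); first by rewrite le_max normr_ge0.
move=> x ax xb; have xi : x \in `[a, b] by rewrite in_itv /= ax.
rewrite ler_norml lerNl !le_max; apply/andP; split.
  by apply/orP; right; rewrite -normrN (le_trans _ (ler_norm _))// lerN2 hc'.
by rewrite (le_trans (hc _ xi)) ?ler_norm.
Qed.

(** Multiplied out, the condition on the difference quotient has no exception at [s = t] and
    combines directly with estimates of increments. *)
Lemma is_derive_dist f t d : is_derive t (1 : R) f d <->
  forall e, 0 < e -> exists2 r, 0 < r &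
    forall s, `|s - t| < r -> `|f s - f t - d * (s - t)| <= e * `|s - t|.
Proof.
split.
  move=> [/cvg_ex[l hl] dl] e e0.
  have ld : l = d by rewrite -dl; apply/esym/cvg_lim.
  move/cvgrPdist_le : hl => /(_ e e0); rewrite ld /prop_near1 /=.
  rewrite /dnbhs /within /= => -[r r0 h]; exists r => // s st.
  have [->|sn] := eqVneq s t; first by rewrite !subrr mulr0 subr0 normr0 mulr0.
  have sn0 : s - t != 0 by rewrite subr_eq0.
  have := h (s - t); rewrite /ball_ /= sub0r normrN => /(_ st sn0).
  rewrite /= scaler1 /shift /= subrK => hh.
  have -> : f s - f t - d * (s - t) = - (d - (s - t)^-1 *: (f s - f t)) * (s - t).
    by rewrite /GRing.scale /=; field.
  by rewrite normrM normrN ler_wpM2r.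
move=> h.
suff hc : (fun h0 : R => h0^-1 *: ((f \o shift t) (h0 *: (1 : R)) - f t)) @ 0^' --> d.
  by apply: DeriveDef; [apply/cvg_ex; exists d|exact: cvg_lim].
apply/cvgrPdist_le => e e0; have [r r0 hr] := h e e0.
exists r => // s /=; rewrite sub0r normrN => sr sn0.
have := hr (s + t); rewrite addrK scaler1 /shift /= => /(_ sr).
rewrite -{1}[e]mulr1 => hh.
have -> : d - s^-1 *: (f (s + t) - f t) = - (f (s + t) - f t - d * s) / s.
  by rewrite /GRing.scale /=; field.
by rewrite normrM normfV normrN ler_pdivrMr ?normr_gt0// -[e]mulr1.
Qed.

(* Cousin covering argument: away from a null set [D] the increments of [f]
   are controlled by the derivative, near [D] by absolute continuity, since
   [D] is covered by an open set of small measure. *)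
Lemma ac_nonincreasing I f : ac I f ->
  ae_on I (fun t => exists2 d, is_derive t (1 : R) f d & d <= 0) ->
  forall a b, a \in I -> b \in I -> a <= b -> f b <= f a.
Proof.
move=> acf [D [mD D0 badD]] a b aI bI ab.
suff h e2 : 0 < e2 -> f b <= f a + e2 by apply/ler_addgt0Pr.
(* The slopes contribute [e * (b - a)] and the neighbourhood of [D] contributes [e], together
   [e2]. *)
move=> e20; pose e := e2 / (b - a + 1).
have ba1 : 0 < b - a + 1 by rewrite ltr_wpDl// subr_ge0.
have e0 : 0 < e by rewrite divr_gt0.
have [dl dl0 acdl] := acf a b aI bI e e0.
have Doo : (mu D < +oo)%E by rewrite D0.
have [U [oU DU UD]] := lebesgue_regularity_outer mD Doo dl0.
have mU : measurable U by exact: open_measurable.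
have muU : (mu U < dl%:E)%E.
  have -> : U = (U `\` D) `|` D by rewrite setDKU.
  by rewrite measureU0//; exact: measurableD.
(* Up to [c] the increase of [f] is paid for by the slope [e] and by finitely many ordered
   intervals; the last clause charges their total length to the part of [U] already passed. *)
pose P c := [/\ a <= c, c <= b & exists k (x y : nat -> R),
  [/\ forall i, (i < k)%N -> a <= x i /\ x i <= y i /\ y i <= c,
      forall i j, (i < j)%N -> (j < k)%N -> y i <= x j,
      f c - f a <= e * (c - a) + \sum_(i < k) `|f (x i) - f (y i)| &
      ((\sum_(i < k) (y i - x i))%:E <= mu (U `&` `]a, c]))%E]].
have step c c' : P c -> c <= c' -> c' <= b ->
    f c' - f c <= e * (c' - c) \/ `[c, c']%classic `<=` U -> P c'.
  move=> [ac' cb [k [x [y [xy srt fc muc]]]]] cc' c'b h; split => //.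
    exact: le_trans cc'.
  have musub : (mu (U `&` `]a, c]) <= mu (U `&` `]a, c']))%E.
    apply: le_measure; rewrite ?inE; try exact: measurableI.
    by apply: setIS => u /=; rewrite !in_itv /= => /andP[-> /le_trans->].
  case: h => [hf|hU].
    exists k, x, y; split => //.
    - by move=> i /xy[ax [xyi yc]]; do 2!split => //; exact: le_trans cc'.
    - have -> : f c' - f a = (f c' - f c) + (f c - f a) by rewrite addrA subrK.
      have -> : c' - a = (c' - c) + (c - a) by rewrite addrA subrK.
      by rewrite mulrDr -[X in _ <= X]addrA lerD.
    - exact: le_trans musub.
  exists k.+1, (fun i => if i == k then c else x i), (fun i => if i == k then c' else y i).
  have sumE (F : R -> R -> R) : \sum_(i < k.+1) F (if i == k :> nat then c else x i)
      (if i == k :> nat then c' else y i) = \sum_(i < k) F (x i) (y i) + F c c'.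
    rewrite big_ord_recr /= eqxx; congr (_ + _); apply: eq_bigr => i _.
    by rewrite ltn_eqF.
  split.
  - move=> i; rewrite ltnS leq_eqVlt; case: eqVneq => [//|_] /= /xy[ax [xyi yc]].
    by do 2!split => //; exact: le_trans cc'.
  - move=> i j ij; rewrite ltnS leq_eqVlt => /orP[/eqP jk|jk].
      rewrite jk eqxx ltn_eqF -?jk//; rewrite jk in ij.
      by have [_ [_]] := xy i ij.
    by rewrite !ltn_eqF ?srt// (ltn_trans ij).
  - rewrite (sumE (fun u v => `|f u - f v|)).
    have -> : f c' - f a = (f c' - f c) + (f c - f a) by rewrite addrA subrK.
    rewrite [X in X <= _]addrC [X in _ <= X]addrA lerD//; last by rewrite distrC ler_norm.
    by rewrite (le_trans fc)// lerD2r ler_wpM2l ?(ltW e0)// lerB.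
  - rewrite (sumE (fun u v => v - u)) EFinD.
    have -> : (c' - c)%:E = mu `]c, c'].
      rewrite lebesgue_measure_itv /= lte_fin -EFinB.
      case: ltP => // c'c; congr (_%:E); apply/eqP; rewrite subr_eq0; exact/eqP/le_anti/andP.
    apply: (@le_trans _ _ (mu ((U `&` `]a, c]) `|` `]c, c']))).
      rewrite measureU//; first by rewrite leeD2r.
        exact: measurableI.
      apply/seteqP; split => // u [[_ /=]]; rewrite !in_itv /= => /andP[_ uc] /andP[].
      by rewrite ltNge uc.
    apply: le_measure; rewrite ?inE//.
    + by apply: measurableU => //; exact: measurableI.
    + exact: measurableI.
    move=> u [[Uu /=]|/=]; rewrite !in_itv /=.
      by move=> /andP[au uc]; split => //; rewrite au (le_trans uc).
    move=> /andP[cu uc']; split; last by rewrite (le_lt_trans ac' cu).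
    by apply: hU; rewrite /= in_itv /= (ltW cu).
(* Both sides of [t] are treated, since [t] will be the supremum [s], which is approached from the
   left and then passed to the right. *)
have gauge t : a <= t -> t <= b -> exists2 r, 0 < r &
    (forall s, `|s - t| < r -> (t <= s -> f s - f t <= e * (s - t)) /\
                              (s <= t -> f t - f s <= e * (t - s))) \/
    (forall s, `|s - t| < r -> U s).
  move=> at_ tb; have [Dt|nDt] := pselect (D t).
    have /nbhs_ballP[r r0 hr] : nbhs t U by apply: open_nbhs_nbhs; split => //; exact: DU.
    by exists r => //; right => s st; apply: hr; rewrite /ball /= distrC.
  have [d dfd d0] : exists2 d, is_derive t (1 : R) f d & d <= 0.
    have tI : t \in I by exact: itv_mid aI bI at_ tb.
    by apply: contrapT => h; apply: nDt; apply: badD => /(_ tI).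
  have /is_derive_dist/(_ e e0)[r r0 hr] := dfd.
  exists r => //; left => s /hr; rewrite ler_norml => /andP[h1 h2]; split => ts.
    have st : 0 <= s - t by rewrite subr_ge0.
    move: h2; rewrite (ger0_norm st) lerBlDr => /le_trans; apply.
    by rewrite gerDl mulr_le0_ge0.
  have st : s - t <= 0 by rewrite subr_le0.
  move: h1; rewrite (ler0_norm st) opprB => h1.
  rewrite -opprB lerNl (le_trans h1)// lerBlDr lerDl.
  by rewrite mulr_le0.
have Pa : P a.
  split => //; exists 0%N, (fun=> a), (fun=> a); split => //.
    by rewrite !subrr mulr0 add0r big_ord0.
  by rewrite big_ord0.
(* Continuous induction: [P] holds at its supremum, and it would hold beyond it if that were less
   than [b]. *)
pose s := sup [set c | P c].
have hs : has_sup [set c | P c].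
  by split; [exists a|exists b => c []].
have as_ : a <= s by apply: sup_upper_bound.
have sb : s <= b by apply: ge_sup => [|c []]//; exists a.
have [r r0 hr] := gauge s as_ sb.
have Ps : P s.
  have [c Pc cs] := sup_adherent r0 hs.
  have cs' : c <= s by apply: sup_upper_bound.
  have cr : `|c - s| < r by rewrite distrC ger0_norm ?subr_ge0// ltrBlDl -ltrBlDr.
  apply: (step c) => //; case: hr => hr.
    by left; have [_] := hr c cr; apply.
  right => u /=; rewrite in_itv /= => /andP[cu us]; apply: hr.
  rewrite distrC ger0_norm ?subr_ge0//; apply: le_lt_trans cr.
  by rewrite distrC ger0_norm ?subr_ge0// lerB.
have Pb : P b.
  pose c := Num.min b (s + r / 2).
  have sc : s <= c by rewrite le_min sb lerDl divr_ge0// ltW.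
  have cb : c <= b by rewrite ge_min lexx.
  have cr : c - s < r.
    rewrite ltrBlDl (le_lt_trans (_ : c <= s + r / 2))//; first by rewrite ge_min lexx orbT.
    by rewrite ltrD2l ltr_pdivrMr// ltr_pMr// ltr1n.
  have Pc : P c.
    apply: (step s) => //; case: hr => hr.
      left; have cr' : `|c - s| < r by rewrite ger0_norm// subr_ge0.
      by have [h _] := hr c cr'; exact: h.
    right => u /=; rewrite in_itv /= => /andP[su uc]; apply: hr.
    by rewrite ger0_norm ?subr_ge0// (le_lt_trans _ cr)// lerB.
  have cs : c <= s by apply: sup_upper_bound.
  suff -> : b = c by [].
  apply/eqP; rewrite eq_sym eq_le cb /= leNgt; apply/negP => cltb.
  move: cs; rewrite /c minElt ltNge; move: cltb; rewrite {1}/c gt_min ltxx /= => /ltW ->.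
  by rewrite /= gerDl leNgt divr_gt0.
have [_ _ [k [x [y [xy srt fb mub]]]]] := Pb.
have lt_dl : \sum_(i < k) (y i - x i) < dl.
  rewrite -lte_fin (le_lt_trans mub)// (le_lt_trans _ muU)//.
  by apply: le_measure; rewrite ?inE//; exact: measurableI.
have := acdl k (fun i => x i) (fun i => y i) (fun i => xy i (ltn_ord i)).
move=> /(_ (fun i j ij => srt i j ij (ltn_ord j)) lt_dl) lt_e.
rewrite -lerBlDl (le_trans fb)//.
have -> : e2 = e * (b - a) + e by rewrite /e; field; rewrite gt_eqF.
by rewrite lerD2l ltW.
Qed.

End AbsolutelyContinuous.

(** * Null sets in an interval *)

Section AlmostEverywhere.
Context {R : realType}.
Notation mu := (@lebesgue_measure R).
Implicit Types (I : interval R) (P Q : R -> Prop).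

Lemma ae_on_all I P : (forall t, t \in I -> P t) -> ae_on I P.
Proof. by move=> h; apply: (@filterE _ _ (ae_filter_ringOfSetsType mu)). Qed.

Lemma ae_onW I P Q : (forall t, t \in I -> P t -> Q t) -> ae_on I P -> ae_on I Q.
Proof.
move=> PQ; apply: (@filterS _ _ (ae_filter_ringOfSetsType mu)) => t Pt tI.
exact: PQ (Pt tI).
Qed.

Lemma ae_onI I P Q : ae_on I P -> ae_on I Q -> ae_on I (fun t => P t /\ Q t).
Proof.
apply: (@filterS2 _ _ (ae_filter_ringOfSetsType mu)) => t Pt Qt tI.
by split; [exact: Pt|exact: Qt].
Qed.

Lemma ae_on_fin I (J : finType) (P : J -> R -> Prop) :
  (forall j, ae_on I (P j)) -> ae_on I (fun t => forall j, P j t).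
Proof.
move=> h; have : {ae mu, forall t, forall k : nat, forall j : J,
    (enum_rank j : nat) = k -> t \in I -> P j t}.
  apply: ae_foralln => k; have [[j jk]|nj] := pselect (exists j : J, (enum_rank j : nat) = k).
    apply: (@filterS _ _ (ae_filter_ringOfSetsType mu) _ _ _ (h j)) => t Pt j' j'k.
    suff -> : j' = j by [].
    by apply: enum_rank_inj; apply: val_inj; rewrite /= j'k.
  apply: (@filterE _ _ (ae_filter_ringOfSetsType mu)) => t j jk.
  by exfalso; apply: nj; exists j.
by apply: (@filterS _ _ (ae_filter_ringOfSetsType mu)) => t ht tI j; exact: (ht _ j).
Qed.

Lemma negligible_subsingleton (E : set R) :
  (forall x y, E x -> E y -> x = y) -> mu.-negligible E.
Proof.
move=> uE; have [[x Ex]|nE] := pselect (exists x, E x).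
  exists [set x]; split; first exact: measurable_set1.
    exact: lebesgue_measure_set1.
  by move=> y Ey /=; exact: uE.
suff -> : E = set0 by exact: negligible_set0.
by apply/seteqP; split => // x Ex; exfalso; apply: nE; exists x.
Qed.

(** A point of [I] other than its least and greatest element lies between two rational points of
    [I]; so countably many segments and two null sets suffice. *)
Lemma ae_on_segments I P :
  (forall p q, p \in I -> q \in I -> p < q -> {ae mu, forall t, p < t -> t < q -> P t}) ->
  ae_on I P.
Proof.
(* A number that codes no pair gets the default [(0, 0)], between whose entries there is no
   point. *)
move=> h; pose rq (k : nat) : rat * rat := odflt (0, 0) (unpickle k).
pose Pk (k : nat) t := ratr (rq k).1 \in I -> ratr (rq k).2 \in I ->
  ratr (rq k).1 < t -> t < ratr (rq k).2 -> P t.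
have aek : {ae mu, forall t, forall k, Pk k t}.
  apply: ae_foralln => k; rewrite /Pk.
  have [[pI qI]|npq] := pselect (ratr (rq k).1 \in I /\ ratr (rq k).2 \in I); last first.
    by apply: (@filterE _ _ (ae_filter_ringOfSetsType mu)) => t pI qI; exfalso; apply: npq.
  have [pq|qp] := ltP (ratr (rq k).1 : R) (ratr (rq k).2).
    apply: (@filterS _ _ (ae_filter_ringOfSetsType mu) _ _ _ (h _ _ pI qI pq)).
    by move=> t ht _ _; exact: ht.
  apply: (@filterE _ _ (ae_filter_ringOfSetsType mu)) => t _ _ pt tq.
  by have := lt_trans pt tq; rewrite ltNge qp.
have aesub (E : set R) : (forall x y, E x -> E y -> x = y) -> {ae mu, forall t, ~ E t}.
  move=> uE; apply: negligibleS (negligible_subsingleton uE) => t /= nnE.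
  by apply: contrapT => nE; apply: nnE.
have aemax : {ae mu, forall t, ~ (t \in I /\ forall s, s \in I -> s <= t)}.
  apply: (aesub [set t | t \in I /\ forall s, s \in I -> s <= t]).
  by move=> x y [xI hx] [yI hy]; apply/le_anti; rewrite hx// hy.
have aemin : {ae mu, forall t, ~ (t \in I /\ forall s, s \in I -> t <= s)}.
  apply: (aesub [set t | t \in I /\ forall s, s \in I -> t <= s]).
  by move=> x y [xI hx] [yI hy]; apply/le_anti; rewrite hx// hy.
apply: (@filterS3 _ _ (ae_filter_ringOfSetsType mu) _ _ _ _ _ aek aemax aemin).
move=> t tk tmax tmin tI.
have [p [pI pt]] : exists p, p \in I /\ p < t.
  apply: contrapT => np; apply: tmin; split => // s sI; rewrite leNgt; apply/negP => st.
  by apply: np; exists s.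
have [q [qI tq]] : exists p, p \in I /\ t < p.
  apply: contrapT => np; apply: tmax; split => // s sI; rewrite leNgt; apply/negP => st.
  by apply: np; exists s.
have [p' /[!in_itv]/= /andP[pp' p't]] := rat_in_itvoo pt.
have [q' /[!in_itv]/= /andP[tq' q'q]] := rat_in_itvoo tq.
have := tk (pickle (p', q')); rewrite /Pk /rq pickleK /=; apply => //.
  by apply: (itv_mid pI tI); exact: ltW.
by apply: (itv_mid tI qI); exact: ltW.
Qed.

End AlmostEverywhere.

Section ACClosure.
Context {R : realType}.
Implicit Types (I : interval R) (f g : R -> R).

Lemma ac_lipschitz I (J : finType) (g : J -> R -> R) f : (forall j, ac I (g j)) ->
  (forall a b, a \in I -> b \in I -> exists2 M, 0 <= M & forall x y,
     a <= x -> x <= y -> y <= b -> `|f x - f y| <= M * \sum_j `|g j x - g j y|) ->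
  ac I f.
Proof. exact: ac_dominated. Qed.

Lemma ac_cst I c : ac I (fun=> c).
Proof.
apply: (@ac_lipschitz I void (fun _ _ => 0)) => [[]|a b aI bI].
by exists 0 => // x y _ _ _; rewrite subrr normr0 mul0r.
Qed.

Lemma ac_ext I f g : (forall t, t \in I -> f t = g t) -> ac I f -> ac I g.
Proof.
move=> fg acf; apply: (@ac_lipschitz I unit (fun=> f)) => // a b aI bI.
exists 1 => // x y ax xy yb; rewrite mul1r big_const card_unit /= addr0.
rewrite -(fg x (itv_mid aI bI ax (le_trans xy yb))).
by rewrite -(fg y (itv_mid aI bI (le_trans ax xy) yb)).
Qed.

Lemma acD I f g : ac I f -> ac I g -> ac I (fun t => f t + g t).
Proof.
move=> acf acg; apply: (@ac_lipschitz I bool (fun b => if b then f else g)).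
  by case.
move=> a b aI bI; exists 1 => // x y ax xy yb.
rewrite mul1r big_bool /= opprD addrACA; exact: ler_normD.
Qed.

Lemma acM I f g : ac I f -> ac I g -> ac I (fun t => f t * g t).
Proof.
move=> acf acg; apply: (@ac_lipschitz I bool (fun b => if b then f else g)).
  by case.
move=> a b aI bI.
have [Mf Mf0 hf] := ac_bounded acf aI bI; have [Mg Mg0 hg] := ac_bounded acg aI bI.
exists (Mf + Mg); first exact: addr_ge0.
move=> x y ax xy yb; rewrite big_bool /=.
have -> : f x * g x - f y * g y = (f x - f y) * g x + f y * (g x - g y) by ring.
rewrite (le_trans (ler_normD _ _))// !normrM mulrDr lerD//.
  by rewrite mulrC ler_wpM2r// (le_trans (hg _ ax (le_trans xy yb)))// lerDr.
by rewrite ler_wpM2r// (le_trans (hf _ (le_trans ax xy) yb))// lerDl.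
Qed.

Lemma acN I f : ac I f -> ac I (fun t => - f t).
Proof.
move=> acf; have h := acM (@ac_cst I (-1)) acf.
by apply: (ac_ext _ h) => t _; rewrite mulN1r.
Qed.

Lemma acB I f g : ac I f -> ac I g -> ac I (fun t => f t - g t).
Proof. by move=> acf acg; apply: acD acf (acN acg). Qed.

Lemma ac_sum I (J : Type) (s : seq J) (P : pred J) (f : J -> R -> R) :
  (forall j, ac I (f j)) -> ac I (fun t => \sum_(j <- s | P j) f j t).
Proof.
move=> acf; elim: s => [|j s IH].
  by apply: (@ac_ext I (fun=> 0)); [move=> t _|exact: ac_cst]; rewrite big_nil.
case Pj : (P j).
  by apply: (ac_ext _ (acD (acf j) IH)) => t _; rewrite big_cons Pj.
by apply: (ac_ext _ IH) => t _; rewrite big_cons Pj.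
Qed.

Lemma ac_expR I f : ac I f -> ac I (fun t => expR (f t)).
Proof.
move=> acf; apply: (@ac_lipschitz I unit (fun=> f)) => // a b aI bI.
have [M M0 hM] := ac_bounded acf aI bI.
exists (expR M); first exact: expR_ge0.
move=> x y ax xy yb; rewrite big_const card_unit /= addr0.
suff aux (u v : R) : `|u| <= M -> `|v| <= M -> `|expR u - expR v| <= expR M * `|u - v|.
  by apply: aux; apply: hM => //; [exact: le_trans yb|exact: le_trans xy].
wlog vu : u v / v <= u => [hw uM vM|uM vM].
  have [|/ltW] := leP v u; first by move=> /hw; apply.
  by move=> /hw h; rewrite distrC [`|u - v|]distrC; exact: h.
rewrite !ger0_norm ?subr_ge0 ?ler_expR//.
apply: (@le_trans _ _ (expR u * (u - v))); last first.
  by rewrite ler_wpM2r ?subr_ge0// ler_expR (le_trans (ler_norm _)).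
have := expR_ge1Dx (v - u); rewrite -(ler_pM2l (expR_gt0 u)) -expRD.
rewrite (addrC u) subrK => h.
have -> : expR u * (u - v) = expR u - expR u * (1 + (v - u)) by ring.
by rewrite lerB.
Qed.

Lemma is_derive_ext f g t d :
  (exists2 r, 0 < r & forall s, `|s - t| < r -> f s = g s) ->
  is_derive t (1 : R) f d -> is_derive t (1 : R) g d.
Proof.
move=> [r r0 fg] /is_derive_dist h; apply/is_derive_dist => e /h[r' r'0 h'].
exists (Num.min r r'); first by rewrite lt_min r0.
move=> s; rewrite lt_min => /andP[sr /h'].
by rewrite (fg s sr) (fg t)// subrr normr0.
Qed.

Lemma is_derive_addl c f t d :
  is_derive t (1 : R) f d -> is_derive t (1 : R) (fun s => c + f s) d.
Proof.
move=> /is_derive_dist h; apply/is_derive_dist => e /h[r r0 h']; exists r => // s /h'.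
by rewrite opprD [c + f s + _]addrACA subrr add0r.
Qed.

Lemma ac_le_increments I f g : ac I f -> ac I g ->
  ae_on I (fun t => exists d1 d2 : R, [/\ is_derive t (1 : R) f d1,
    is_derive t (1 : R) g d2 & d1 <= d2]) ->
  forall a b, a \in I -> b \in I -> a <= b -> f b - f a <= g b - g a.
Proof.
move=> acf acg h a b aI bI ab.
have := ac_nonincreasing (acB acf acg) _ aI bI ab; rewrite lerBlDr => fg.
suff : f b - g b <= f a - g a by lra.
rewrite lerBlDr; apply: fg; apply: ae_onW h => t _ [d1 [d2 [fd gd le_d]]].
exists (d1 - d2); last by rewrite subr_le0.
exact: is_deriveB.
Qed.

Lemma ac_eq_increments I f g : ac I f -> ac I g ->
  ae_on I (fun t => exists2 d, is_derive t (1 : R) f d & is_derive t (1 : R) g d) ->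
  forall a b, a \in I -> b \in I -> f b - f a = g b - g a.
Proof.
move=> acf acg h a b aI bI.
have h1 x y : x \in I -> y \in I -> x <= y -> f y - f x = g y - g x.
  move=> xI yI xy; apply/eqP; rewrite eq_le; apply/andP; split.
    apply: (ac_le_increments acf acg _ xI yI xy).
    by apply: ae_onW h => t _ [d fd gd]; exists d, d.
  apply: (ac_le_increments acg acf _ xI yI xy).
  by apply: ae_onW h => t _ [d fd gd]; exists d, d.
have [ab|/ltW ba] := leP a b; first exact: h1.
by rewrite -opprB h1// opprB.
Qed.

End ACClosure.

(** * Primitives of locally integrable functions *)

Section Primitive.
Context {R : realType}.
Notation mu := (@lebesgue_measure R).
Implicit Types (I : interval R) (f g : R -> R).

Definition loc_int I f : Prop :=
  forall a b, a \in I -> b \in I -> mu.-integrable `[a, b] (EFin \o f).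

Definition prim (a b : R) f : R :=
  if a <= b then Rintegral mu `[a, b] f else - Rintegral mu `[b, a] f.

Lemma primB I f t0 a b : loc_int I f -> t0 \in I -> a \in I -> b \in I -> a <= b ->
  prim t0 b f - prim t0 a f = Rintegral mu `[a, b] f.
Proof.
move=> lf t0I aI bI ab.
have split3 x y z : x \in I -> z \in I -> x <= y -> y <= z ->
    Rintegral mu `[x, z] f = Rintegral mu `[x, y] f + Rintegral mu `[y, z] f.
  move=> xI zI xy yz; apply/eqP; rewrite addrC -subr_eq; apply/eqP.
  rewrite Rintegral_itvB ?bnd_simp//; last exact: lf.
  rewrite Rintegral_itv_obnd_cbnd//.
  apply: (@integrableS _ _ _ mu `[x, z]) => //; last exact: lf.
  by move=> u /=; rewrite !in_itv /= => /andP[yu ->]; rewrite (le_trans xy)// ltW.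
rewrite /prim; have [ta|at_] := leP t0 a.
  rewrite ifT ?(le_trans ta ab)//.
  by apply/eqP; rewrite subr_eq addrC; apply/eqP; exact: split3.
have [tb|bt] := leP t0 b.
  by rewrite opprK (split3 a t0 b)//; [exact: addrC|exact: ltW].
rewrite opprK; apply/eqP; rewrite addrC subr_eq; apply/eqP.
by apply: split3 => //; exact: ltW.
Qed.

Lemma primtt t0 f : prim t0 t0 f = 0.
Proof. by rewrite /prim lexx set_itv1 Rintegral_set1. Qed.

Lemma loc_int_norm I f : loc_int I f -> loc_int I (fun t => `|f t|).
Proof. by move=> lf a b aI bI; apply: (integrable_norm (lf a b aI bI)). Qed.

(** The disjoint intervals are gathered in one set [U] whose measure is their total length; absolute
    continuity of the Lebesgue integral makes the integral of [|g|] over [U] small. *)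
Lemma ac_prim I f t0 : loc_int I f -> t0 \in I -> ac I (fun t => prim t0 t f).
Proof.
move=> lf t0I a b aI bI e e0; pose g := f \_ `[a, b].
have ig : mu.-integrable setT (EFin \o g).
  rewrite /g -restrict_EFin; apply/integrable_restrict => //=.
  by rewrite setTI; exact: lf.
have [dl [dl0 h]] := integral_normr_continuous ig e0.
exists dl => // k x y xy srt lt_sum.
(* Intervals open on the left are disjoint even when they abut. The last clause keeps the set built
   so far to the left of the intervals still to come. *)
have hU j : (j <= k)%N -> exists U : set R, [/\ measurable U,
    mu U = (\sum_(i < k | (i < j)%N) (y i - x i))%:E,
    Rintegral mu U (fun t => `|g t|) =
      \sum_(i < k | (i < j)%N) Rintegral mu `]x i, y i] (fun t => `|g t|) &
    forall i : 'I_k, (j <= i)%N -> forall u, U u -> u <= x i].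
  elim: j => [_|j IH jk].
    exists set0; split => //; first by rewrite measure0 big_pred0.
    by rewrite Rintegral_set0 big_pred0.
  have [U [mU muU intU Ule]] := IH (ltnW jk).
  pose i0 := Ordinal jk; exists (U `|` `]x i0, y i0]).
  have dis : U `&` `]x i0, y i0] = set0.
    apply/seteqP; split => // u [/(Ule i0 (leqnn j)) ux /=].
    by rewrite in_itv /= ltNge ux.
  have pE (i : 'I_k) : ((i < j.+1)%N && (i != i0)) = (i < j)%N.
    by rewrite ltnS [in RHS]ltn_neqAle andbC -val_eqE.
  split.
  - exact: measurableU.
  - transitivity (mu U + mu `]x i0, y i0])%E; first exact: measureU.
    rewrite muU [in RHS](bigD1 i0) ?leqnn//= (eq_bigl _ _ pE) EFinD addeC.
    congr (_ + _)%E; have [_ [xy0 _]] := xy i0.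
    rewrite lebesgue_measure_itv /= lte_fin; case: ltP => // yx0.
    by congr EFin; apply/eqP; rewrite eq_sym subr_eq0; apply/eqP/le_anti; rewrite xy0 yx0.
  - rewrite Rintegral_setU//; last 2 first.
    + by apply: integrableS (integrable_norm ig) => //; exact: measurableU.
    + by apply/disj_setPS; rewrite dis.
    by rewrite intU [in RHS](bigD1 i0) ?leqnn//= (eq_bigl _ _ pE) addrC.
  - move=> i ji u [Uu|/=]; first by apply: Ule Uu; exact: ltnW.
    by rewrite in_itv /= => /andP[_ uy]; rewrite (le_trans uy)// srt.
have [U [mU muU intU _]] := hU k (leqnn k).
have pT (i : 'I_k) : (i < k)%N = true by exact: ltn_ord.
rewrite (eq_bigl _ _ pT) in muU; rewrite (eq_bigl _ _ pT) in intU.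
have muU' : (mu U < dl%:E)%E by rewrite muU lte_fin.
have := h U mU muU'; rewrite [X in X < e -> _](_ : _ = Rintegral mu U (fun t => `|g t|))//.
rewrite intU; apply: le_lt_trans; apply: ler_sum => i _.
have [ax [xyi yb]] := xy i.
have xI : x i \in I by exact: itv_mid aI bI ax (le_trans xyi yb).
have yI : y i \in I by exact: itv_mid aI bI (le_trans ax xyi) yb.
rewrite distrC (primB lf)// (le_trans (le_normr_Rintegral _ (lf _ _ xI yI)))//.
rewrite -Rintegral_itv_obnd_cbnd; last first.
  apply: (integrableS _ _ _ (integrable_norm (lf _ _ xI yI))) => //.
  by move=> u /=; rewrite !in_itv /= => /andP[/ltW -> ->].
rewrite le_eqVlt; apply/orP; left; apply/eqP/eq_Rintegral => u; rewrite inE /= in_itv /=.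
move=> /andP[xu uy]; rewrite /g patchE mem_set//= in_itv /=.
by rewrite (le_trans ax (ltW xu)) (le_trans uy).
Qed.

(** Lebesgue's differentiation theorem, applied on each segment to [f] cut off outside it, which is
    integrable on the whole line. *)
Lemma prim_derive I f t0 : loc_int I f -> t0 \in I ->
  ae_on I (fun t => is_derive t (1 : R) (fun s => prim t0 s f) (f t)).
Proof.
move=> lf t0I; apply: ae_on_segments => p q pI qI pq.
pose g := f \_ `[p, q].
have lg : locally_integrable [set: R] g by apply: integrable_locally => //; exact: lf.
have ig : mu.-integrable setT (EFin \o g).
  rewrite /g -restrict_EFin; apply/integrable_restrict => //=.
  by rewrite setTI; exact: lf.
have ig' : mu.-integrable `[p, q] (EFin \o g) by exact: integrableS ig.
suff key (t : R) : lebesgue_pt g t -> p < t -> t < q ->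
    is_derive t (1 : R) (fun s => prim t0 s f) (f t).
  by apply: (@filterS _ _ (ae_filter_ringOfSetsType mu) _ _ _ (lebesgue_differentiation lg)).
move=> lt_ pt tq.
have pt' : (p%:E < t%:E)%E by rewrite lte_fin.
have [dF F'] := FTC1_lebesgue_pt tq ig' pt' lt_.
have gE s : s \in `[p, q] -> g s = f s by move=> sI; rewrite /g patchE mem_set.
have : is_derive t (1 : R) (fun s => prim t0 p f + Rintegral mu `[p, s] g) (f t).
  apply: is_derive_addl; apply: DeriveDef dF _.
  by rewrite -derive1E F' gE// in_itv /= !ltW.
apply: is_derive_ext; exists (Num.min (t - p) (q - t)).
  by rewrite lt_min !subr_gt0 pt.
move=> s; rewrite lt_min ltr_norml => /andP[/andP[ps _]]; rewrite ltr_norml => /andP[_ sq].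
have ps' : p <= s by rewrite ltW//; move: ps; rewrite opprB ltrBlDr subrK.
have sq' : s <= q by rewrite ltW//; move: sq; rewrite ltrBlDr subrK.
have sI : s \in I by exact: itv_mid pI qI _ _.
rewrite -[RHS](subrK (prim t0 p f)) addrC (primB lf t0I pI sI ps'); congr (_ + _).
apply: eq_Rintegral => u.
rewrite inE /= in_itv /= => /andP[pu us]; apply: gE.
by rewrite in_itv /= pu (le_trans us).
Qed.

End Primitive.

(** * Linear differential equations *)

Section LocallyIntegrable.
Context {R : realType}.
Notation mu := (@lebesgue_measure R).
Implicit Types (I : interval R) (f g : R -> R).

Lemma loc_intD I f g : loc_int I f -> loc_int I g -> loc_int I (fun t => f t + g t).
Proof. by move=> lf lg a b aI bI; exact: (integrableD _ (lf a b aI bI) (lg a b aI bI)). Qed.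

Lemma loc_intM_bounded I f g : loc_int I f ->
  (forall a b, a \in I -> b \in I -> measurable_fun `[a, b] g) ->
  (forall a b, a \in I -> b \in I -> exists2 M, 0 <= M &
     forall x, a <= x -> x <= b -> `|g x| <= M) ->
  loc_int I (fun t => f t * g t).
Proof.
move=> lf mg bg a b aI bI; have [M M0 hM] := bg a b aI bI.
apply: (integrableMl _ (lf a b aI bI)) => //; first exact: mg.
exists M; split; first exact: num_real.
move=> x Mx y /=; rewrite in_itv /= => /andP[ay yb].
by rewrite (le_trans (hM _ ay yb))// ltW.
Qed.

Lemma ac_measurable I f a b : ac I f -> a \in I -> b \in I -> measurable_fun `[a, b] f.
Proof.
move=> acf aI bI; apply: subspace_continuous_measurable_fun => //.
exact: ac_continuous acf aI bI.
Qed.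

Lemma loc_intM I f g : loc_int I f -> ac I g -> loc_int I (fun t => f t * g t).
Proof.
move=> lf acg; apply: loc_intM_bounded lf _ _ => a b aI bI; first exact: ac_measurable acg aI bI.
exact: ac_bounded acg aI bI.
Qed.

Lemma loc_int0 I : loc_int I (fun=> 0).
Proof. by move=> a b aI bI; exact: integrable0. Qed.

Lemma loc_int_sum I (J : Type) (s : seq J) (f : J -> R -> R) :
  (forall j, loc_int I (f j)) -> loc_int I (fun t => \sum_(j <- s) f j t).
Proof.
move=> lf; elim: s => [|j s IH].
  by under eq_fun do rewrite big_nil; exact: loc_int0.
by under eq_fun do rewrite big_cons; exact: loc_intD.
Qed.

Lemma loc_intN I f : loc_int I f -> loc_int I (fun t => - f t).
Proof.
move=> lf; have := loc_intM lf (@ac_cst _ I (-1)).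
by under eq_fun do rewrite mulrN1.
Qed.

Lemma loc_intZ I c f : loc_int I f -> loc_int I (fun t => c * f t).
Proof.
move=> lf; have := loc_intM lf (@ac_cst _ I c).
by under eq_fun do rewrite mulrC.
Qed.

Lemma loc_int_ext I f g : (forall t, f t = g t) -> loc_int I f -> loc_int I g.
Proof. by move=> fg; have -> : f = g by apply/funext. Qed.

Lemma is_derive_expR_comp f t d : is_derive t (1 : R) f d ->
  is_derive t (1 : R) (fun s => expR (f s)) (expR (f t) * d).
Proof. by move=> fd; apply: (is_derive1_comp (is_derive_expR (f t)) fd). Qed.

Lemma is_derive_mul f g t df dg : is_derive t (1 : R) f df -> is_derive t (1 : R) g dg ->
  is_derive t (1 : R) (fun s => f s * g s) (df * g t + f t * dg).
Proof.
move=> fd gd; have := is_deriveM fd gd; rewrite /GRing.scale /= => h.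
by have -> : df * g t + f t * dg = f t * dg + g t * df by ring.
Qed.

Lemma is_derive_add f g t df dg : is_derive t (1 : R) f df -> is_derive t (1 : R) g dg ->
  is_derive t (1 : R) (fun s => f s + g s) (df + dg).
Proof. exact: is_deriveD. Qed.

Lemma is_derive_const (c t : R) : is_derive t (1 : R) (fun=> c : R) (0 : R).
Proof. exact: is_derive_cst. Qed.

Lemma is_derive_scale c f t d : is_derive t (1 : R) f d ->
  is_derive t (1 : R) (fun s => c * f s) (c * d).
Proof.
by move=> fd; have := is_derive_mul (is_derive_const c t) fd; rewrite mul0r add0r.
Qed.

Lemma is_derive_big (J : Type) (s : seq J) (f : J -> R -> R) t (d : J -> R) :
  (forall j, is_derive t (1 : R) (f j) (d j)) ->
  is_derive t (1 : R) (fun u => \sum_(j <- s) f j u) (\sum_(j <- s) d j).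
Proof.
move=> fd; elim: s => [|j s IH].
  by rewrite big_nil; under eq_fun do rewrite big_nil; exact: is_derive_const.
by rewrite big_cons; under eq_fun do rewrite big_cons; exact: is_derive_add.
Qed.

(** The sequences [u i - 2 c / 2^i] and [u i + 2 c / 2^i] are monotone and enclose the limit, which
    is the supremum of the former; the rate comes with it. *)
Lemma geometric_limit (u : nat -> R) c : (forall i, `|u i.+1 - u i| <= c / 2 ^+ i) ->
  exists l, forall i, `|u i - l| <= c * 2 / 2 ^+ i.
Proof.
move=> h; pose v i := u i - c * 2 / 2 ^+ i; pose w i := u i + c * 2 / 2 ^+ i.
have step i : c * 2 / 2 ^+ i = c * 2 / 2 ^+ i.+1 + c / 2 ^+ i.
  by rewrite exprS; field; rewrite expf_neq0// pnatr_eq0.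
have vS i : v i <= v i.+1.
  have := h i; rewrite ler_norml => /andP[h1 h2]; rewrite /v step; lra.
have wS i : w i.+1 <= w i.
  have := h i; rewrite ler_norml => /andP[h1 h2]; rewrite /w [in leRHS]step; lra.
have c0 : 0 <= c by have := le_trans (normr_ge0 _) (h 0%N); rewrite expr0 divr1.
have vw i : v i <= w i.
  by rewrite /v /w lerD2l ge0_cp// divr_ge0// ?mulr_ge0// exprn_ge0.
have vmono i j : (i <= j)%N -> v i <= v j.
  by move=> /subnKC <-; elim: (j - i)%N => [|k IH]; rewrite ?addn0// addnS (le_trans IH).
have wmono i j : (i <= j)%N -> w j <= w i.
  by move=> /subnKC <-; elim: (j - i)%N => [|k IH]; rewrite ?addn0// addnS (le_trans _ IH).
have vwij i j : v i <= w j.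
  apply: le_trans (vmono i (maxn i j) (leq_maxl _ _)) _.
  exact: le_trans (vw _) (wmono j _ (leq_maxr _ _)).
pose E := [set x | exists i, x = v i].
have ubE j : ubound E (w j) by move=> _ [i ->].
have hE : has_sup E by split; [exists (v 0%N); exists 0%N|exists (w 0%N)].
exists (sup E) => i.
have h1 : v i <= sup E by apply: sup_upper_bound => //; exists i.
have h2 : sup E <= w i by apply: ge_sup => //; exists (v 0%N); exists 0%N.
by move: h1 h2; rewrite /v /w ler_norml => h1 h2; apply/andP; split; lra.
Qed.

End LocallyIntegrable.

(** * Gronwall's inequality *)

Section Gronwall.
Context {R : realType}.
Implicit Types (I : interval R).

Lemma sum_norm_sqr (J : finType) (x : J -> R) :
  (\sum_j `|x j|) ^+ 2 <= #|J|%:R * \sum_j x j ^+ 2.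
Proof.
rewrite expr2 mulr_suml.
apply: (@le_trans _ _ (\sum_i \sum_j ((x i ^+ 2 + x j ^+ 2) / 2))).
  apply: ler_sum => i _; rewrite mulr_sumr; apply: ler_sum => j _.
  rewrite -[x i ^+ 2]real_normK ?num_real// -[x j ^+ 2]real_normK ?num_real//.
  by have := sqr_ge0 (`|x i| - `|x j|); rewrite sqrrB; lra.
rewrite (eq_bigr (fun i => (#|J|%:R * x i ^+ 2 + \sum_j x j ^+ 2) / 2)); last first.
  by move=> i _; rewrite -mulr_suml big_split /= sumr_const mulr_natl.
by rewrite -mulr_suml big_split /= -mulr_sumr sumr_const -[_ *+ #|_|]mulr_natl; lra.
Qed.

(** [G] is fixed before [f] and [b], which makes later bounds uniform in z. The sum of squares [phi]
    replaces the sum of absolute values, which need not be differentiable; it satisfies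
    [|phi'| <= c k phi], so its product with the exponential of [- c K] to the right of [t1], of
    [c K] to the left, is monotone. *)
Lemma gronwall I (J : finType) (k : R -> R) t1 t :
  loc_int I k -> (forall t, 0 <= k t) -> t1 \in I -> t \in I ->
  exists2 G, 0 <= G & forall (f : J -> R -> R) b, 0 <= b -> (forall j, ac I (f j)) ->
    ae_on I (fun s => exists f' : J -> R, forall j,
      is_derive s (1 : R) (f j) (f' j) /\ `|f' j| <= k s * (\sum_l `|f l s| + b)) ->
    \sum_j `|f j t| <= G * (\sum_j `|f j t1| + b).
Proof.
(* One factor 2 comes from differentiating squares; [2 * N + 1] from [F (F + b) <= 2 F^2 + b^2] and
   Cauchy-Schwarz, [F^2 <= N phi]. *)
move=> lk k0 t1I tI; pose N : R := #|J|%:R; pose c := 2 * (2 * N + 1).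
pose K s := prim t1 s k.
have acK : ac I K by exact: ac_prim.
pose E := expR (c * K t) + expR (- c * K t).
have E0 : 0 <= E by rewrite addr_ge0// expR_ge0.
have N0 : 0 <= N by [].
have NE0 : 0 <= N * E by rewrite mulr_ge0.
(* The squares satisfy [F t ^+ 2 <= N * E * (F t1 + b) ^+ 2], and [1 + N * E] bounds the square root
   of [N * E]. *)
exists (1 + N * E); first by rewrite addr_ge0.
move=> f b b0 acf fd.
pose F s := \sum_l `|f l s|; pose phi s := \sum_j f j s * f j s + b * b.
have F0 s : 0 <= F s by exact: sumr_ge0.
have phi0 s : 0 <= phi s.
  by rewrite addr_ge0 ?mulr_ge0// sumr_ge0// => j _; rewrite -expr2 sqr_ge0.
have acphi : ac I phi.
  by apply: acD; [apply: ac_sum => j; exact: acM|exact: ac_cst].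
have hphi s : phi s = \sum_j f j s ^+ 2 + b ^+ 2.
  by rewrite /phi expr2; congr (_ + _); apply: eq_bigr => j _; rewrite expr2.
have dphi : ae_on I (fun s => exists2 d, is_derive s (1 : R) phi d &
    `|d| <= c * k s * phi s).
  apply: ae_onW fd => s sI [f' hf'].
  exists (\sum_j (f' j * f j s + f j s * f' j) + 0).
    have h : is_derive s (1 : R) (fun s => \sum_j f j s * f j s)
        (\sum_j (f' j * f j s + f j s * f' j)).
      by apply: is_derive_big => j; apply: is_derive_mul; case: (hf' j).
    exact: (is_derive_add h (is_derive_const (b * b) s)).
  rewrite addr0 (le_trans (ler_norm_sum _ _ _))//.
  apply: (@le_trans _ _ (\sum_j 2 * (k s * (F s + b)) * `|f j s|)).
    apply: ler_sum => j _; have [_ h] := hf' j.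
    have -> : f' j * f j s + f j s * f' j = 2 * f' j * f j s by ring.
    by rewrite !normrM ger0_norm// ler_wpM2r// ler_wpM2l.
  rewrite -mulr_sumr -/(F s).
  have := sum_norm_sqr (fun j => f j s); rewrite -/(F s) -/N => hF.
  have hs : 0 <= \sum_j f j s ^+ 2 by apply: sumr_ge0 => j _; exact: sqr_ge0.
  have h2 : F s * (F s + b) <= (2 * N + 1) * phi s.
    have h3 : F s * b <= F s ^+ 2 + b ^+ 2 by have := sqr_ge0 (F s - b); have := F0 s; nra.
    have := mulr_ge0 N0 (sqr_ge0 b); rewrite hphi => ?; nra.
  have -> : 2 * (k s * (F s + b)) * F s = 2 * k s * (F s * (F s + b)) by ring.
  have -> : c * k s * phi s = 2 * k s * ((2 * N + 1) * phi s) by rewrite /c; ring.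
  by rewrite ler_wpM2l// mulr_ge0.
have dK := prim_derive lk t1I.
have acE (d : R) : ac I (fun s => expR (d * K s)).
  by apply: ac_expR; apply: acM => //; exact: ac_cst.
have dE (d s : R) : is_derive s (1 : R) K (k s) ->
    is_derive s (1 : R) (fun s => expR (d * K s)) (expR (d * K s) * (d * k s)).
  by move=> h; apply: is_derive_expR_comp; exact: is_derive_scale.
have phile : phi t <= phi t1 * E.
  have Kt1 : K t1 = 0 by exact: primtt.
  have [t1t|/ltW tt1] := leP t1 t.
    have acG := acM acphi (acE (- c)).
    have := ac_nonincreasing acG _ t1I tI t1t; rewrite Kt1 mulr0 expR0 mulr1 => h.
    have h1 : phi t * expR (- c * K t) <= phi t1.
      apply: h; apply: ae_onW (ae_onI dphi dK) => s sI [[d pd dle] Kd].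
      eexists; first exact: is_derive_mul pd (dE (- c) s Kd).
      have -> : d * expR (- c * K s) + phi s * (expR (- c * K s) * (- c * k s)) =
        expR (- c * K s) * (d - c * k s * phi s) by ring.
      rewrite mulr_ge0_le0 ?expR_ge0// subr_le0.
      exact: le_trans (ler_norm _) dle.
    have h2 : phi t <= phi t1 * expR (c * K t).
      rewrite -[leLHS]mulr1 -[1](expR0) -[0](subrr (c * K t)) -mulNr [c * K t + _]addrC expRD mulrA.
      by rewrite ler_wpM2r// expR_ge0.
    by rewrite (le_trans h2)// ler_wpM2l// lerDl expR_ge0.
  have acG := acN (acM acphi (acE c)).
  have := ac_nonincreasing acG _ tI t1I tt1; rewrite Kt1 mulr0 expR0 mulr1 lerN2 => h.
  have h1 : phi t * expR (c * K t) <= phi t1.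
    apply: h; apply: ae_onW (ae_onI dphi dK) => s sI [[d pd dle] Kd].
    exists (- (d * expR (c * K s) + phi s * (expR (c * K s) * (c * k s)))).
      exact: is_deriveN (is_derive_mul pd (dE c s Kd)).
    rewrite oppr_le0.
    have -> : d * expR (c * K s) + phi s * (expR (c * K s) * (c * k s)) =
      expR (c * K s) * (d + c * k s * phi s) by ring.
    rewrite mulr_ge0 ?expR_ge0//.
    by move: dle; rewrite ler_norml => /andP[]; lra.
  have h2 : phi t <= phi t1 * expR (- c * K t).
    rewrite -[leLHS]mulr1 -[1](expR0) -[0](subrr (c * K t)) -mulNr expRD mulrA.
    by rewrite ler_wpM2r// expR_ge0.
  by rewrite (le_trans h2)// ler_wpM2l// lerDr expR_ge0.
have hF : F t ^+ 2 <= N * phi t.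
  rewrite (le_trans (sum_norm_sqr (fun j => f j t)))// ler_wpM2l//.
  by rewrite hphi lerDl sqr_ge0.
have hphi1 : phi t1 <= (F t1 + b) ^+ 2.
  have h : \sum_j f j t1 ^+ 2 <= F t1 ^+ 2.
    rewrite [leRHS]expr2 {1}/F mulr_suml; apply: ler_sum => j _.
    rewrite -real_normK ?num_real// expr2 ler_wpM2l//.
    by rewrite /F (bigD1 j)//= lerDl sumr_ge0.
  by rewrite hphi; have := F0 t1; nra.
have h : F t ^+ 2 <= N * E * (F t1 + b) ^+ 2.
  rewrite (le_trans hF)// -mulrA ler_wpM2l// mulrC (le_trans phile)// ler_wpM2r//.
rewrite -/(F t) -/(F t1).
rewrite -(@ler_pXn2r _ 2)// ?nnegrE ?mulr_ge0 ?addr_ge0//.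
rewrite exprMn (le_trans h)// ler_wpM2r ?sqr_ge0//.
by rewrite expr2; nra.
Qed.

End Gronwall.

(** * Linear systems with integrable coefficients *)

Section LinearODE.
Context {R : realType}.
Implicit Types (I : interval R).

(** The bound on the derivative of [g] is itself the derivative of [c sinh (2 K)], whose absolute
    value is at most [c cosh (2 K) = c / 2 * E]. The gain of 1/2 is the contraction factor of the
    Picard iteration. *)
Lemma ac_sinh_bound I (k : R -> R) t0 c (g : R -> R) :
  0 <= c -> loc_int I k -> t0 \in I -> ac I g -> g t0 = 0 ->
  let K s := prim t0 s k in
  let E s := expR (2 * K s) + expR (- 2 * K s) in
  ae_on I (fun s => exists2 d, is_derive s (1 : R) g d & `|d| <= c * (k s * E s)) ->
  forall t, t \in I -> `|g t| <= c / 2 * E t.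
Proof.
move=> c0 lk t0I acg g0 K E gd t tI.
pose Sh s := c / 2 * (expR (2 * K s) - expR (- 2 * K s)).
have acK : ac I K by exact: ac_prim.
have acE (d : R) : ac I (fun s => expR (d * K s)).
  by apply: ac_expR; apply: acM => //; exact: ac_cst.
have acSh : ac I Sh by apply: acM; [exact: ac_cst|exact: acB].
have dE (d s : R) : is_derive s (1 : R) K (k s) ->
    is_derive s (1 : R) (fun s => expR (d * K s)) (expR (d * K s) * (d * k s)).
  by move=> h; apply: is_derive_expR_comp; exact: is_derive_scale.
have dSh : ae_on I (fun s => is_derive s (1 : R) Sh (c * (k s * E s))).
  apply: ae_onW (prim_derive lk t0I) => s sI Kd.
  have := is_derive_scale (c / 2) (is_deriveB (dE 2 s Kd) (dE (- 2) s Kd)).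
  by congr is_derive; rewrite /E; field.
have Sh0 : Sh t0 = 0 by rewrite /Sh /K primtt !mulr0 subrr mulr0.
have inc a b : a \in I -> b \in I -> a <= b -> `|g b - g a| <= Sh b - Sh a.
  move=> aI bI ab; rewrite ler_norml; apply/andP; split.
    rewrite lerNl -opprB opprK.
    have := ac_le_increments (acN acg) acSh _ aI bI ab; rewrite -opprD opprB; apply.
    apply: ae_onW (ae_onI gd dSh) => s sI [[d gd' dle] Shd].
    exists (- d), (c * (k s * E s)); split => //; first exact: is_deriveN.
    by rewrite (le_trans _ dle)// -normrN ler_norm.
  apply: (ac_le_increments acg acSh _ aI bI ab).
  apply: ae_onW (ae_onI gd dSh) => s sI [[d gd' dle] Shd].
  by exists d, (c * (k s * E s)); split => //; exact: le_trans (ler_norm _) dle.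
have c2 : 0 <= c / 2 by rewrite divr_ge0.
have [t0t|/ltW tt0] := leP t0 t.
  have := inc _ _ t0I tI t0t; rewrite g0 Sh0 !subr0 => h; rewrite (le_trans h)//.
  by rewrite ler_wpM2l// lerD2l ge0_cp ?expR_ge0.
have := inc _ _ tI t0I tt0; rewrite g0 Sh0 !sub0r normrN => h; rewrite (le_trans h)//.
by rewrite -mulrN ler_wpM2l// opprB lerBlDr addrAC lerDr addr_ge0// expR_ge0.
Qed.

(* Picard iteration: in the weight [E], whose derivative dominates [k E], every
   step halves the distance of consecutive iterates. *)
Lemma linear_ode_exists I (J : finType) (a : J -> J -> R -> R) (w0 : J -> R) t0 :
  (forall j l, loc_int I (a j l)) -> t0 \in I ->
  exists w : J -> R -> R, [/\ forall j, ac I (w j), forall j, w j t0 = w0 j &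
    forall j, ae_on I (fun t =>
      is_derive t (1 : R) (w j) (\sum_l a j l t * w l t))].
Proof.
move=> la t0I; pose k t := \sum_j \sum_l `|a j l t|.
have k0 t : 0 <= k t by apply: sumr_ge0 => j _; exact: sumr_ge0.
have lk : loc_int I k.
  by apply: loc_int_sum => j; apply: loc_int_sum => l; exact: loc_int_norm.
pose K s := prim t0 s k; pose E s := expR (2 * K s) + expR (- 2 * K s).
have acK : ac I K by exact: ac_prim.
have acE : ac I E.
  by apply: acD; apply: ac_expR; apply: acM => //; exact: ac_cst.
have E1 s : 1 <= E s.
  rewrite /E; have [K0|K0] := leP 0 (K s).
    by rewrite (le_trans (_ : 1 <= expR (2 * K s)))// ?lerDl ?expR_ge0// -expR0 ler_expR mulr_ge0.
  rewrite (le_trans (_ : 1 <= expR (- 2 * K s)))// ?lerDr ?expR_ge0//.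
  by rewrite -expR0 ler_expR mulNr -mulrN mulr_ge0// oppr_ge0 ltW.
pose T (w : J -> R -> R) (j : J) t := w0 j + prim t0 t (fun s => \sum_l a j l s * w l s).
pose M0 := \sum_j `|w0 j|; have M00 : 0 <= M0 by exact: sumr_ge0.
pose W := fix W (i : nat) : J -> R -> R := if i is i.+1 then T (W i) else fun j _ => w0 j.
have sum_le s (x : J -> R) j B : (forall l, `|x l| <= B) ->
    `|\sum_l a j l s * x l| <= B * k s.
  move=> xB; rewrite (le_trans (ler_norm_sum _ _ _))//.
  apply: (@le_trans _ _ (\sum_l `|a j l s| * B)).
    by apply: ler_sum => l _; rewrite normrM ler_wpM2l.
  have B0 : 0 <= B by exact: le_trans (xB j).
  rewrite -mulr_suml mulrC ler_wpM2l// /k [leRHS](bigD1 j)//= lerDl.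
  by apply: sumr_ge0 => i _; exact: sumr_ge0.
have dT (w : J -> R -> R) j : (forall l, loc_int I (fun s => a j l s * w l s)) ->
    [/\ ac I (T w j), T w j t0 = w0 j &
     ae_on I (fun s => is_derive s (1 : R) (T w j) (\sum_l a j l s * w l s))].
  move=> /(loc_int_sum (index_enum J)) lw; split.
  - by apply: acD; [exact: ac_cst|exact: ac_prim].
  - by rewrite /T primtt addr0.
  - by apply: ae_onW (prim_derive lw t0I) => s _; exact: is_derive_addl.
(* An arbitrary [f] stands in place of [T y j]: with [y = 0] it is the constant start of the
   iteration, so the initial step is also covered. *)
have contraction (x y : J -> R -> R) j f c : 0 <= c ->
    (forall l, loc_int I (fun s => a j l s * x l s)) -> ac I f -> f t0 = w0 j ->
    ae_on I (fun s => is_derive s (1 : R) f (\sum_l a j l s * y l s)) ->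
    (forall l s, s \in I -> `|x l s - y l s| <= c * E s) ->
    forall t, t \in I -> `|T x j t - f t| <= c / 2 * E t.
  move=> c0 lx acf f0 df xy; have [acT T0 dTj] := dT x j lx.
  apply: (@ac_sinh_bound I k t0 c (fun t => T x j t - f t) c0 lk t0I).
  - exact: acB.
  - by rewrite T0 f0 subrr.
  apply: ae_onW (ae_onI dTj df) => s sI [d1 d2]; eexists; first exact: is_deriveB d1 d2.
  rewrite -sumrB (eq_bigr (fun l => a j l s * (x l s - y l s))); last first.
    by move=> l _; rewrite mulrBr.
  rewrite [k s * _]mulrC mulrA.
  exact: (sum_le s (fun l => x l s - y l s) j (c * E s) (fun l => xy l s sI)).
have acW i j : ac I (W i j).
  elim: i j => [|i IH] j; first exact: ac_cst.
  by case: (@dT (W i) j) => // l; exact: loc_intM.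
have lW i j l : loc_int I (fun s => a j l s * W i l s) by exact: loc_intM.
have w0M l : `|w0 l| <= M0 by rewrite /M0 (bigD1 l)//= lerDl sumr_ge0.
have WS i j t : t \in I -> `|W i.+1 j t - W i j t| <= M0 * E t / 2 ^+ i.
  elim: i j t => [|i IH] j t tI.
    rewrite expr0 divr1; apply: le_trans (_ : M0 / 2 * E t <= _); last by have := E1 t; nra.
    apply: (contraction (W 0%N) (fun _ _ => 0)) => //.
      apply: ae_on_all => s _; rewrite big1; first exact: is_derive_const.
      by move=> l _; rewrite mulr0.
    by move=> l s _; rewrite subr0 (le_trans (w0M l))// ler_peMr.
  have c0 : 0 <= M0 / 2 ^+ i by rewrite divr_ge0// exprn_ge0.
  have -> : M0 * E t / 2 ^+ i.+1 = M0 / 2 ^+ i / 2 * E t.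
    by rewrite exprS; field; rewrite expf_neq0// pnatr_eq0.
  have [acT T0 dTj] := dT (W i) j (lW i j).
  apply: (contraction (W i.+1) (W i)) => // l s sI.
  by rewrite mulrAC; exact: IH.
have /choice[w hw] (jt : J * R) : exists l, jt.2 \in I ->
    forall i, `|W i jt.1 jt.2 - l| <= M0 * E jt.2 * 2 / 2 ^+ i.
  have [tI|ntI] := pselect (jt.2 \in I); last by exists 0.
  by have [l hl] := geometric_limit (fun i => WS i jt.1 jt.2 tI); exists l.
pose w' j t := w (j, t).
have hw' j t i : t \in I -> `|W i j t - w' j t| <= M0 * E t * 2 / 2 ^+ i.
  by move=> tI; exact: (hw (j, t)).
have cvg2 (c : R) : (fun i => c / 2 ^+ i) @ \oo --> (0 : R).
  have := @cvg_geometric R c 2^-1; rewrite ger0_norm// => h.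
  have -> : (fun i : nat => c / 2 ^+ i) = geometric c 2^-1.
    by apply/funext => i; rewrite /geometric /= exprVn.
  by apply: h; rewrite invf_lt1// ltr1n.
(* At this point [w'] is only a pointwise limit: its measurability comes from the iterates, its
   local boundedness from the distance to the initial one. *)
have lw j l : loc_int I (fun s => a j l s * w' l s).
  apply: loc_intM_bounded => // p q pI qI.
    apply: (@measurable_fun_cvg _ _ _ _ (fun i => W i l)).
      by move=> i; exact: ac_measurable (acW i l) pI qI.
    move=> x /=; rewrite in_itv /= => /andP[px xq].
    have xI : x \in I by exact: itv_mid pI qI px xq.
    apply/cvgrPdist_le => e e0.
    have /cvgrPdist_le/(_ e e0) := cvg2 (M0 * E x * 2).
    apply: filterS => i; rewrite sub0r normrN => h.
    by rewrite distrC (le_trans (hw' l x i xI))// (le_trans (ler_norm _)).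
  have [M M1 hM] := ac_bounded acE pI qI.
  exists (M0 + M0 * M * 2); first by rewrite addr_ge0// !mulr_ge0.
  move=> x px xq; have xI : x \in I by exact: itv_mid pI qI px xq.
  have := hw' l x 0%N xI; rewrite expr0 divr1 /= distrC => h.
  rewrite -[w' l x](subrK (w0 l)) addrC (le_trans (ler_normD _ _))// lerD//.
  rewrite (le_trans h)// ler_wpM2r// ler_wpM2l// (le_trans (ler_norm _))//.
  exact: hM.
have Tw j t : t \in I -> T w' j t = w' j t.
  move=> tI; apply/eqP; rewrite -subr_eq0 -normr_le0; apply/ler_addgt0Pr => e e0.
  rewrite add0r.
  have [i hi] : exists i : nat, M0 * E t * 3 / 2 ^+ i <= e.
    have /cvgrPdist_le/(_ e e0)[i _ hi] := cvg2 (M0 * E t * 3); exists i.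
    by have := hi i (leqnn i); rewrite sub0r normrN; apply: le_trans; exact: ler_norm.
  have [acT T0 dTj] := dT (W i) j (lW i j).
  have c0 : 0 <= M0 * 2 / 2 ^+ i by rewrite divr_ge0// ?mulr_ge0// exprn_ge0.
  have h1 : `|T w' j t - T (W i) j t| <= M0 * 2 / 2 ^+ i / 2 * E t.
    apply: (contraction w' (W i)) => // l s sI.
    have -> : M0 * 2 / 2 ^+ i * E s = M0 * E s * 2 / 2 ^+ i by ring.
    by rewrite distrC; exact: hw'.
  have h2 := hw' j t i.+1 tI.
  rewrite -[T w' j t](subrK (T (W i) j t)) -addrA (le_trans (ler_normD _ _))//.
  apply: le_trans (lerD h1 h2) _; apply: le_trans hi.
  have -> : M0 * 2 / 2 ^+ i / 2 * E t + M0 * E t * 2 / 2 ^+ i.+1 = M0 * E t * 2 / 2 ^+ i.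
    by rewrite exprS; field; rewrite expf_neq0// pnatr_eq0.
  rewrite ler_pM2r ?invr_gt0 ?exprn_gt0// ler_wpM2l ?mulr_ge0//.
    by rewrite (le_trans _ (E1 t)).
  by rewrite ler_nat.
(* [T w'] agrees with [w'] on [I] and, being a primitive, is absolutely continuous and has the
   required derivative by construction. *)
exists (T w'); split.
- by move=> j; case: (dT w' j (lw j)).
- by move=> j; case: (dT w' j (lw j)).
- move=> j; have [_ _] := dT w' j (lw j); apply: ae_onW => s sI.
  by rewrite (eq_bigr (fun l => a j l s * T w' l s)) // => l _; rewrite Tw.
Qed.

End LinearODE.

(** * Complex and matrix functions *)

Section ComplexFunctions.
Context {R : realType}.
Local Notation C := R[i].
Implicit Types (I : interval R) (f g : R -> C).

Definition cac I f : Prop :=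
  ac I (fun t => complex.Re (f t)) /\ ac I (fun t => complex.Im (f t)).

Definition cderive f (t : R) (d : C) : Prop :=
  is_derive t (1 : R) (fun s => complex.Re (f s)) (complex.Re d) /\
  is_derive t (1 : R) (fun s => complex.Im (f s)) (complex.Im d).

Definition cint I f : Prop :=
  loc_int I (fun t => complex.Re (f t)) /\ loc_int I (fun t => complex.Im (f t)).

Lemma ReM (x y : C) : complex.Re (x * y) =
  complex.Re x * complex.Re y - complex.Im x * complex.Im y.
Proof. by case: x => a b; case: y. Qed.

Lemma ImM (x y : C) : complex.Im (x * y) =
  complex.Re x * complex.Im y + complex.Im x * complex.Re y.
Proof. by case: x => a b; case: y. Qed.

Lemma cReD (x y : C) : complex.Re (x + y) = complex.Re x + complex.Re y.
Proof. by case: x => a b; case: y. Qed.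

Lemma cImD (x y : C) : complex.Im (x + y) = complex.Im x + complex.Im y.
Proof. by case: x => a b; case: y. Qed.

Lemma cReN (x : C) : complex.Re (- x) = - complex.Re x.
Proof. by case: x. Qed.

Lemma cImN (x : C) : complex.Im (- x) = - complex.Im x.
Proof. by case: x. Qed.

Lemma cReJ (x : C) : complex.Re (x^* ) = complex.Re x.
Proof. by case: x. Qed.

Lemma cImJ (x : C) : complex.Im (x^* ) = - complex.Im x.
Proof. by case: x. Qed.

Lemma complexP (x y : C) :
  complex.Re x = complex.Re y -> complex.Im x = complex.Im y -> x = y.
Proof. by case: x => a b; case: y => c d /= -> ->. Qed.

Lemma Re_le_normc (z : C) : `|complex.Re z| <= Normc.normc z.
Proof.
case: z => a b /=; by rewrite -sqrtr_sqr ler_wsqrtr// lerDl sqr_ge0.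
Qed.

Lemma Im_le_normc (z : C) : `|complex.Im z| <= Normc.normc z.
Proof.
case: z => a b /=; by rewrite -sqrtr_sqr ler_wsqrtr// lerDr sqr_ge0.
Qed.

Lemma normc_le (z : C) : Normc.normc z <= `|complex.Re z| + `|complex.Im z|.
Proof.
case: z => a b /=; rewrite -(ger0_norm (_ : 0 <= `|a| + `|b|)) ?addr_ge0// -sqrtr_sqr.
rewrite ler_wsqrtr// sqrrD !real_normK ?num_real//.
by rewrite lerD2r lerDl mulrn_wge0 ?mulr_ge0.
Qed.

Lemma cac_ext I f g : (forall t, t \in I -> f t = g t) -> cac I f -> cac I g.
Proof. by move=> fg [h1 h2]; split; [apply: ac_ext h1|apply: ac_ext h2] => t /fg ->. Qed.

Lemma cac_cst I (c : C) : cac I (fun=> c).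
Proof. by split; exact: ac_cst. Qed.

Lemma cacD I f g : cac I f -> cac I g -> cac I (fun t => f t + g t).
Proof.
move=> [f1 f2] [g1 g2]; split.
  by apply: ac_ext (acD f1 g1) => t _; rewrite cReD.
by apply: ac_ext (acD f2 g2) => t _; rewrite cImD.
Qed.

Lemma cacM I f g : cac I f -> cac I g -> cac I (fun t => f t * g t).
Proof.
move=> [f1 f2] [g1 g2]; split.
  by apply: ac_ext (acB (acM f1 g1) (acM f2 g2)) => t _; rewrite ReM.
by apply: ac_ext (acD (acM f1 g2) (acM f2 g1)) => t _; rewrite ImM.
Qed.

Lemma cacJ I f : cac I f -> cac I (fun t => (f t)^* ).
Proof.
move=> [f1 f2]; split.
  by apply: ac_ext f1 => t _; rewrite cReJ.
by apply: ac_ext (acN f2) => t _; rewrite cImJ.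
Qed.

Lemma cac_sum I (J : Type) (s : seq J) (f : J -> R -> C) :
  (forall j, cac I (f j)) -> cac I (fun t => \sum_(j <- s) f j t).
Proof.
move=> h; elim: s => [|j s IH].
  by apply: cac_ext (@cac_cst I 0) => t _; rewrite big_nil.
by apply: cac_ext (cacD (h j) IH) => t _; rewrite big_cons.
Qed.

Lemma cac_prod I (J : Type) (s : seq J) (f : J -> R -> C) :
  (forall j, cac I (f j)) -> cac I (fun t => \prod_(j <- s) f j t).
Proof.
move=> h; elim: s => [|j s IH].
  by apply: cac_ext (@cac_cst I 1) => t _; rewrite big_nil.
by apply: cac_ext (cacM (h j) IH) => t _; rewrite big_cons.
Qed.

Lemma ac_inv I (h : R -> R) : ac I h -> (forall t, t \in I -> 0 < h t) ->
  ac I (fun t => (h t)^-1).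
Proof.
move=> ach h0; apply: (@ac_lipschitz _ I unit (fun=> h)) => // a b aI bI.
have [ba|ab] := ltP b a.
  by exists 0 => // x y ax xy yb; have := le_trans (le_trans ax xy) yb; rewrite leNgt ba.
have [c cab cmin] := EVT_min ab (ac_continuous ach aI bI).
have cI : c \in I by move: cab; rewrite in_itv /= => /andP[]; exact: itv_mid aI bI.
have hc := h0 c cI; exists (h c ^- 2); first by rewrite invr_ge0 sqr_ge0.
move=> x y ax xy yb; rewrite big_const card_unit /= addr0.
have hx : h c <= h x by apply: cmin; rewrite in_itv /= ax (le_trans xy).
have hy : h c <= h y by apply: cmin; rewrite in_itv /= yb (le_trans ax).
have hx0 := lt_le_trans hc hx; have hy0 := lt_le_trans hc hy.
have -> : (h x)^-1 - (h y)^-1 = (h y - h x) * ((h x)^-1 * (h y)^-1).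
  by field; rewrite !gt_eqF.
rewrite normrM distrC mulrC ler_wpM2r// ger0_norm; last by rewrite mulr_ge0// invr_ge0 ltW.
by rewrite -exprVn expr2 ler_pM ?invr_ge0 ?(ltW hx0) ?(ltW hy0)// lef_pV2// posrE.
Qed.

Lemma normc_sqr (z : C) : z * z^* = (complex.Re z ^+ 2 + complex.Im z ^+ 2)%:C%C.
Proof. by case: z => a b; apply: complexP; rewrite /= ; ring. Qed.

(** The conjugate of [f] divided by its square norm [N], so that only a positive real function is
    inverted. *)
Lemma cacV I f : cac I f -> (forall t, t \in I -> f t != 0) -> cac I (fun t => (f t)^-1).
Proof.
move=> acf f0; have [f1 f2] := acf.
pose N t := complex.Re (f t) * complex.Re (f t) + complex.Im (f t) * complex.Im (f t).
have acn : ac I N := acD (acM f1 f1) (acM f2 f2).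
have hpos t : t \in I -> 0 < N t.
  move=> /f0; rewrite /N lt_neqAle -!expr2 addr_ge0 ?sqr_ge0// andbT.
  apply: contra => /eqP h; apply/eqP.
  by have /eqP := normc_sqr (f t); rewrite -h mulf_eq0 conjC_eq0 orbb => /eqP ->.
have aci := ac_inv acn hpos.
have caci : cac I (fun t => (N t)^-1%:C%C).
  by split => //=; exact: ac_cst.
apply: cac_ext (cacM (cacJ acf) caci) => t tI.
have fV (x : R) : (x^-1)%:C%C = (x%:C%C)^-1 :> C by exact: fmorphV.
rewrite fV (_ : _%:C%C = f t * (f t)^* ).
  rewrite invfM mulrA mulrC mulrA mulVf ?mul1r//.
  by rewrite conjC_eq0 f0.
by rewrite normc_sqr /N -!expr2.
Qed.

Lemma cderiveD f g t df dg : cderive f t df -> cderive g t dg ->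
  cderive (fun s => f s + g s) t (df + dg).
Proof.
move=> [f1 f2] [g1 g2]; split; rewrite ?cReD ?cImD.
  by under eq_fun do rewrite cReD; exact: is_derive_add.
by under eq_fun do rewrite cImD; exact: is_derive_add.
Qed.

Lemma is_derive_opp (f : R -> R) t d : is_derive t (1 : R) f d ->
  is_derive t (1 : R) (fun s => - f s) (- d).
Proof. exact: is_deriveN. Qed.

Lemma cderiveM f g t df dg : cderive f t df -> cderive g t dg ->
  cderive (fun s => f s * g s) t (df * g t + f t * dg).
Proof.
move=> [f1 f2] [g1 g2]; split.
  under eq_fun do rewrite ReM.
  have := is_derive_add (is_derive_mul f1 g1) (is_derive_opp (is_derive_mul f2 g2)).
  by congr is_derive; rewrite cReD !ReM; ring.
under eq_fun do rewrite ImM.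
have := is_derive_add (is_derive_mul f1 g2) (is_derive_mul f2 g1).
by congr is_derive; rewrite cImD !ImM; ring.
Qed.

Lemma cderiveJ f t d : cderive f t d -> cderive (fun s => (f s)^* ) t d^*.
Proof.
move=> [f1 f2]; split; rewrite ?cReJ ?cImJ.
  by under eq_fun do rewrite cReJ.
by under eq_fun do rewrite cImJ; exact: is_derive_opp.
Qed.

Lemma cderive_cst (c : C) t : cderive (fun=> c) t 0.
Proof. by split; exact: is_derive_const. Qed.

Lemma cderive_sum (J : Type) (s : seq J) (f : J -> R -> C) t (d : J -> C) :
  (forall j, cderive (f j) t (d j)) ->
  cderive (fun u => \sum_(j <- s) f j u) t (\sum_(j <- s) d j).
Proof.
move=> h; elim: s => [|j s IH].
  by rewrite big_nil; under eq_fun do rewrite big_nil; exact: cderive_cst.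
by rewrite big_cons; under eq_fun do rewrite big_cons; exact: cderiveD.
Qed.

Lemma cint_ext I f g : (forall t, f t = g t) -> cint I f -> cint I g.
Proof. by move=> fg; have -> : f = g by apply/funext. Qed.

Lemma cint0 I : cint I (fun=> 0).
Proof. by split; exact: loc_int0. Qed.

Lemma cintD I f g : cint I f -> cint I g -> cint I (fun t => f t + g t).
Proof.
move=> [f1 f2] [g1 g2]; split.
  by apply: loc_int_ext (loc_intD f1 g1) => t; rewrite cReD.
by apply: loc_int_ext (loc_intD f2 g2) => t; rewrite cImD.
Qed.

Lemma cintM I f g : cint I f -> cac I g -> cint I (fun t => f t * g t).
Proof.
move=> [f1 f2] [g1 g2]; split.
  apply: loc_int_ext (loc_intD (loc_intM f1 g1) (loc_intN (loc_intM f2 g2))) => t.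
  by rewrite ReM.
by apply: loc_int_ext (loc_intD (loc_intM f1 g2) (loc_intM f2 g1)) => t; rewrite ImM.
Qed.

Lemma cint_sum I (J : Type) (s : seq J) (f : J -> R -> C) :
  (forall j, cint I (f j)) -> cint I (fun t => \sum_(j <- s) f j t).
Proof.
move=> h; elim: s => [|j s IH].
  by apply: cint_ext (@cint0 I) => t; rewrite big_nil.
by apply: cint_ext (cintD (h j) IH) => t; rewrite big_cons.
Qed.

End ComplexFunctions.

Section MatrixFunctions.
Context {R : realType}.
Local Notation C := R[i].
Implicit Types (I : interval R).

Lemma mx_acP I m n (f : R -> 'M[C]_(m, n)) :
  mx_loc_abs_cont I f <-> forall i j, cac I (fun t => f t i j).
Proof.
split.
  move=> h i j; split => a b aI bI e e0; have [dl dl0 hd] := h a b aI bI e e0.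
    exists dl => // k x y xy srt lt; apply: le_lt_trans (hd k x y xy srt lt).
    apply: ler_sum => l _; apply: le_trans (normc_entry_le _ _ i j).
    by rewrite -cReN -cReD Re_le_normc.
  exists dl => // k x y xy srt lt; apply: le_lt_trans (hd k x y xy srt lt).
  apply: ler_sum => l _; apply: le_trans (normc_entry_le _ _ i j).
  by rewrite -cImN -cImD Im_le_normc.
move=> h; pose g (l : bool * ('I_m * 'I_n)) t :=
  if l.1 then complex.Re (f t l.2.1 l.2.2) else complex.Im (f t l.2.1 l.2.2).
apply: (@ac_dominated _ _ _ I _ g).
  by move=> [[] [i j]]; have [] := h i j.
move=> a b _ _; exists 1 => // x y _ _ _; rewrite mul1r /mx_dist.
rewrite -(pair_bigA _ (fun c l => `|g (c, l) x - g (c, l) y|)) /= big_bool /=.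
rewrite pair_bigA /= -big_split /=; apply: ler_sum => -[i j] _ /=.
by rewrite (le_trans (normc_le _))// cReD cReN cImD cImN.
Qed.

Definition mx_cint I m n (f : R -> 'M[C]_(m, n)) : Prop :=
  forall i j, cint I (fun t => f t i j).

Lemma mx_cintP I m n (f : R -> 'M[C]_(m, n)) : mx_loc_integrable I f <-> mx_cint I f.
Proof.
split; first by move=> h i j; split => a b aI bI; have [] := h a b aI bI i j.
by move=> h a b aI bI i j; have [h1 h2] := h i j; split; [exact: h1|exact: h2].
Qed.

Lemma mx_ac_ext I m n (f g : R -> 'M[C]_(m, n)) : (forall t, t \in I -> f t = g t) ->
  mx_loc_abs_cont I f -> mx_loc_abs_cont I g.
Proof.
move=> fg /mx_acP h; apply/mx_acP => i j; apply: cac_ext (h i j) => t tI.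
by rewrite fg.
Qed.

Lemma mx_ac_cst I m n (A : 'M[C]_(m, n)) : mx_loc_abs_cont I (fun=> A).
Proof. by apply/mx_acP => i j; exact: cac_cst. Qed.

Lemma mx_acD I m n (f g : R -> 'M[C]_(m, n)) : mx_loc_abs_cont I f ->
  mx_loc_abs_cont I g -> mx_loc_abs_cont I (fun t => f t + g t).
Proof.
move=> /mx_acP hf /mx_acP hg; apply/mx_acP => i j.
by apply: cac_ext (cacD (hf i j) (hg i j)) => t _; rewrite mxE.
Qed.

Lemma mx_acM I m n p (f : R -> 'M[C]_(m, n)) (g : R -> 'M[C]_(n, p)) :
  mx_loc_abs_cont I f -> mx_loc_abs_cont I g -> mx_loc_abs_cont I (fun t => f t *m g t).
Proof.
move=> /mx_acP hf /mx_acP hg; apply/mx_acP => i j.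
apply: cac_ext (cac_sum (index_enum 'I_n) (fun k => cacM (hf i k) (hg k j))) => t _.
by rewrite mxE.
Qed.

Lemma mx_acN I m n (f : R -> 'M[C]_(m, n)) : mx_loc_abs_cont I f ->
  mx_loc_abs_cont I (fun t => - f t).
Proof.
move=> /mx_acP h; apply/mx_acP => i j.
by apply: cac_ext (cacM (@cac_cst R I (-1)) (h i j)) => t _; rewrite mxE mulN1r.
Qed.

Lemma mx_acB I m n (f g : R -> 'M[C]_(m, n)) : mx_loc_abs_cont I f ->
  mx_loc_abs_cont I g -> mx_loc_abs_cont I (fun t => f t - g t).
Proof. by move=> hf hg; exact: mx_acD hf (mx_acN hg). Qed.

Lemma mx_ac_adj I m n (f : R -> 'M[C]_(m, n)) : mx_loc_abs_cont I f ->
  mx_loc_abs_cont I (fun t => (f t)^t* ).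
Proof.
move=> /mx_acP h; apply/mx_acP => i j.
by apply: cac_ext (cacJ (h j i)) => t _; rewrite !mxE.
Qed.

Lemma mx_ac_tr I m n (f : R -> 'M[C]_(m, n)) : mx_loc_abs_cont I f ->
  mx_loc_abs_cont I (fun t => (f t)^T).
Proof.
move=> /mx_acP h; apply/mx_acP => i j.
by apply: cac_ext (h j i) => t _; rewrite !mxE.
Qed.

Lemma cac_det I n (f : R -> 'M[C]_n) : mx_loc_abs_cont I f -> cac I (fun t => \det (f t)).
Proof.
move=> /mx_acP h; apply: cac_sum => s; apply: cacM; first exact: cac_cst.
by apply: cac_prod => i.
Qed.

Lemma mx_ac_inv I n (f : R -> 'M[C]_n) : mx_loc_abs_cont I f ->
  (forall t, t \in I -> f t \in unitmx) -> mx_loc_abs_cont I (fun t => invmx (f t)).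
Proof.
move=> acf uf; apply/mx_acP => i j.
have acV : cac I (fun t => (\det (f t))^-1).
  by apply: cacV; [exact: cac_det|move=> t /uf; rewrite unitmxE unitfE].
have acA : cac I (fun t => cofactor (f t) j i).
  apply: cacM; first exact: cac_cst.
  apply: cac_det; apply/mx_acP => k l; move/mx_acP: acf => h.
  by apply: cac_ext (h (lift j k) (lift i l)) => t _; rewrite !mxE.
by apply: cac_ext (cacM acV acA) => t tI; rewrite /invmx uf// !mxE.
Qed.

Lemma mx_derivD m n (f g : R -> 'M[C]_(m, n)) t df dg : mx_deriv f t df ->
  mx_deriv g t dg -> mx_deriv (fun s => f s + g s) t (df + dg).
Proof.
move=> hf hg i j; have := cderiveD (hf i j) (hg i j).
have <- : (fun s => (f s + g s) i j) = (fun s => f s i j + g s i j).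
  by apply/funext => s; rewrite mxE.
by rewrite mxE.
Qed.

Lemma mx_derivM m n p (f : R -> 'M[C]_(m, n)) (g : R -> 'M[C]_(n, p)) t df dg :
  mx_deriv f t df -> mx_deriv g t dg ->
  mx_deriv (fun s => f s *m g s) t (df *m g t + f t *m dg).
Proof.
move=> hf hg i j.
have := cderive_sum (index_enum 'I_n) (fun k => cderiveM (hf i k) (hg k j)).
have <- : (fun s => (f s *m g s) i j) = (fun s => \sum_k f s i k * g s k j).
  by apply/funext => s; rewrite mxE.
by rewrite big_split /= !mxE.
Qed.

Lemma mx_deriv_cst m n (A : 'M[C]_(m, n)) t : mx_deriv (fun=> A) t 0.
Proof. by move=> i j; rewrite mxE; exact: cderive_cst. Qed.

Lemma mx_derivMl m n p (A : 'M[C]_(m, n)) (g : R -> 'M[C]_(n, p)) t dg :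
  mx_deriv g t dg -> mx_deriv (fun s => A *m g s) t (A *m dg).
Proof. by move=> h; have := mx_derivM (mx_deriv_cst A t) h; rewrite mul0mx add0r. Qed.

Lemma mx_derivMr m n p (f : R -> 'M[C]_(m, n)) (A : 'M[C]_(n, p)) t df :
  mx_deriv f t df -> mx_deriv (fun s => f s *m A) t (df *m A).
Proof. by move=> h; have := mx_derivM h (mx_deriv_cst A t); rewrite mulmx0 addr0. Qed.

Lemma mx_derivN m n (f : R -> 'M[C]_(m, n)) t df : mx_deriv f t df ->
  mx_deriv (fun s => - f s) t (- df).
Proof.
move=> h i j; have := cderiveM (cderive_cst (-1) t) (h i j).
have <- : (fun s => (- f s) i j) = (fun s => -1 * f s i j).
  by apply/funext => s; rewrite mxE mulN1r.
by rewrite mxE mul0r add0r mulN1r.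
Qed.

Lemma mx_derivB m n (f g : R -> 'M[C]_(m, n)) t df dg : mx_deriv f t df ->
  mx_deriv g t dg -> mx_deriv (fun s => f s - g s) t (df - dg).
Proof. by move=> hf hg; exact: mx_derivD hf (mx_derivN hg). Qed.

Lemma mx_deriv_adj m n (f : R -> 'M[C]_(m, n)) t df : mx_deriv f t df ->
  mx_deriv (fun s => (f s)^t* ) t (df^t* ).
Proof.
move=> h i j; have := cderiveJ (h j i).
have <- : (fun s => (f s)^t* i j) = (fun s => (f s j i)^* ).
  by apply/funext => s; rewrite !mxE.
by rewrite !mxE.
Qed.

Lemma mx_deriv_tr m n (f : R -> 'M[C]_(m, n)) t df : mx_deriv f t df ->
  mx_deriv (fun s => (f s)^T) t (df^T).
Proof.
move=> h i j; have [h1 h2] := h j i; split; rewrite mxE.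
  by under eq_fun do rewrite mxE.
by under eq_fun do rewrite mxE.
Qed.

Lemma mx_deriv_uniq m n (f : R -> 'M[C]_(m, n)) t d1 d2 : mx_deriv f t d1 ->
  mx_deriv f t d2 -> d1 = d2.
Proof.
move=> h1 h2; apply/matrixP => i j.
have [[_ a1] [_ b1]] := h1 i j; have [[_ a2] [_ b2]] := h2 i j.
by apply: complexP; [rewrite -a1 -a2|rewrite -b1 -b2].
Qed.

Lemma mx_cint_ext I m n (f g : R -> 'M[C]_(m, n)) : (forall t, f t = g t) ->
  mx_cint I f -> mx_cint I g.
Proof. by move=> fg; have -> : f = g by apply/funext. Qed.

Lemma mx_cintD I m n (f g : R -> 'M[C]_(m, n)) : mx_cint I f -> mx_cint I g ->
  mx_cint I (fun t => f t + g t).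
Proof.
move=> hf hg i j; apply: cint_ext (cintD (hf i j) (hg i j)) => t.
by rewrite mxE.
Qed.

Lemma mx_cintM I m n p (f : R -> 'M[C]_(m, n)) (g : R -> 'M[C]_(n, p)) :
  mx_cint I f -> mx_loc_abs_cont I g -> mx_cint I (fun t => f t *m g t).
Proof.
move=> hf /mx_acP hg i j.
apply: cint_ext (cint_sum (index_enum 'I_n) (fun k => cintM (hf i k) (hg k j))) => t.
by rewrite mxE.
Qed.

Lemma mx_cint_tr I m n (f : R -> 'M[C]_(m, n)) : mx_cint I f -> mx_cint I (fun t => (f t)^T).
Proof. by move=> hf i j; apply: cint_ext (hf j i) => t; rewrite mxE. Qed.

Lemma mx_cintMl I m n p (f : R -> 'M[C]_(m, n)) (g : R -> 'M[C]_(n, p)) :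
  mx_loc_abs_cont I f -> mx_cint I g -> mx_cint I (fun t => f t *m g t).
Proof.
move=> hf hg; apply: mx_cint_ext (mx_cint_tr (mx_cintM (mx_cint_tr hg) (mx_ac_tr hf))) => t.
by rewrite trmx_mul !trmxK.
Qed.

Lemma mx_cintN I m n (f : R -> 'M[C]_(m, n)) : mx_cint I f -> mx_cint I (fun t => - f t).
Proof.
move=> hf i j; apply: cint_ext (cintM (hf i j) (@cac_cst R I (-1))) => t.
by rewrite mxE mulrN1.
Qed.

Lemma mx_cintB I m n (f g : R -> 'M[C]_(m, n)) : mx_cint I f -> mx_cint I g ->
  mx_cint I (fun t => f t - g t).
Proof. by move=> hf hg; exact: mx_cintD hf (mx_cintN hg). Qed.

Lemma mx_cintZ I m n c (f : R -> 'M[C]_(m, n)) : mx_cint I f -> mx_cint I (fun t => c *: f t).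
Proof.
move=> hf i j; apply: cint_ext (cintM (hf i j) (@cac_cst R I c)) => t.
by rewrite mxE mulrC.
Qed.

Lemma mx_cint0 I m n : mx_cint I (fun=> 0 : 'M[C]_(m, n)).
Proof. by move=> i j; apply: cint_ext (@cint0 R I) => t; rewrite mxE. Qed.

Lemma mx_cint_block I m1 m2 n1 n2 (f1 : R -> 'M[C]_(m1, n1)) (f2 : R -> 'M[C]_(m1, n2))
    (f3 : R -> 'M[C]_(m2, n1)) (f4 : R -> 'M[C]_(m2, n2)) :
  mx_cint I f1 -> mx_cint I f2 -> mx_cint I f3 -> mx_cint I f4 ->
  mx_cint I (fun t => block_mx (f1 t) (f2 t) (f3 t) (f4 t)).
Proof.
move=> h1 h2 h3 h4 i j; case: (split_ordP i) => i' ->; case: (split_ordP j) => j' ->.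
- by apply: cint_ext (h1 i' j') => t; rewrite block_mxEul.
- by apply: cint_ext (h2 i' j') => t; rewrite block_mxEur.
- by apply: cint_ext (h3 i' j') => t; rewrite block_mxEdl.
- by apply: cint_ext (h4 i' j') => t; rewrite block_mxEdr.
Qed.

Lemma mx_ac_col I m1 m2 n (f : R -> 'M[C]_(m1, n)) (g : R -> 'M[C]_(m2, n)) :
  mx_loc_abs_cont I f -> mx_loc_abs_cont I g -> mx_loc_abs_cont I (fun t => col_mx (f t) (g t)).
Proof.
move=> /mx_acP hf /mx_acP hg; apply/mx_acP => i j; case: (split_ordP i) => i' ->.
  by apply: cac_ext (hf i' j) => t _; rewrite col_mxEu.
by apply: cac_ext (hg i' j) => t _; rewrite col_mxEd.
Qed.

Lemma mx_deriv_col m1 m2 n (f : R -> 'M[C]_(m1, n)) (g : R -> 'M[C]_(m2, n)) t df dg :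
  mx_deriv f t df -> mx_deriv g t dg ->
  mx_deriv (fun t => col_mx (f t) (g t)) t (col_mx df dg).
Proof.
move=> hf hg i j; case: (split_ordP i) => i' ->.
  rewrite col_mxEu; under eq_fun do rewrite col_mxEu.
  by split; [|under eq_fun do rewrite col_mxEu]; have [] := hf i' j.
rewrite col_mxEd; under eq_fun do rewrite col_mxEd.
by split; [|under eq_fun do rewrite col_mxEd]; have [] := hg i' j.
Qed.

Lemma mx_deriv_ext m n (f g : R -> 'M[C]_(m, n)) t d :
  (exists2 r, 0 < r & forall s, `|s - t| < r -> f s = g s) ->
  mx_deriv f t d -> mx_deriv g t d.
Proof.
move=> [r r0 fg] h i j; have [h1 h2] := h i j.
by split; [apply: is_derive_ext h1|apply: is_derive_ext h2]; exists r => // s /fg ->.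
Qed.

(** A derivative at [t] looks at a full neighbourhood of [t], while most hypotheses hold on [I]
    only; endpoints of [I] are negligible. *)
Lemma ae_on_interior I : ae_on I (fun t => exists2 r, 0 < r & forall s, `|s - t| < r -> s \in I).
Proof.
apply: ae_on_segments => p q pI qI pq.
apply: (@filterE _ _ (ae_filter_ringOfSetsType (@lebesgue_measure R))) => t pt tq.
exists (Num.min (t - p) (q - t)); first by rewrite lt_min !subr_gt0 pt.
move=> s; rewrite lt_min ltr_norml => /andP[/andP[ps _]]; rewrite ltr_norml => /andP[_ sq].
by apply: (itv_mid pI qI); rewrite ltW//; lra.
Qed.

Lemma mx_deriv_vanishing I m n (f h : R -> 'M[C]_(m, n)) :
  (forall t, t \in I -> f t = 0) -> ae_on I (fun t => mx_deriv f t (h t)) ->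
  ae_on I (fun t => h t = 0).
Proof.
move=> f0 fd; apply: ae_onW (ae_onI fd (@ae_on_interior I)) => t tI [ht [r r0 hr]].
apply: (mx_deriv_uniq (f := fun=> 0) (t := t)); last exact: mx_deriv_cst.
by apply: mx_deriv_ext ht; exists r => // s /hr /f0.
Qed.

End MatrixFunctions.

(** * Linear matrix differential equations *)

Section MatrixODE.
Context {R : realType}.
Local Notation C := R[i].
Implicit Types (I : interval R).

Definition part (b : bool) (z : C) : R := if b then complex.Re z else complex.Im z.

Lemma complex_ode_exists I (K : finType) (a : K -> K -> R -> C) (w0 : K -> C) t0 :
  (forall j l, cint I (a j l)) -> t0 \in I ->
  exists w : K -> R -> C, [/\ forall j, cac I (w j), forall j, w j t0 = w0 j &
    forall j, ae_on I (fun t => cderive (w j) t (\sum_l a j l t * w l t))].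
Proof.
move=> la t0I.
(* The real form of multiplication by [a]; [true] marks real parts and [false] imaginary parts. *)
pose al (x y : bool * K) t : R :=
  if ~~ x.1 then part (~~ y.1) (a x.2 y.2 t)
  else if y.1 then complex.Re (a x.2 y.2 t) else - complex.Im (a x.2 y.2 t).
have lal x y : loc_int I (al x y).
  by case: x y => [[] j] [[] l]; have [h1 h2] := la j l => //; exact: loc_intN.
have [w [acw w0E dw]] := linear_ode_exists (fun x : bool * K => part x.1 (w0 x.2)) lal t0I.
exists (fun j t => (w (true, j) t +i* w (false, j) t)%C); split.
- by move=> j; split => /=; exact: acw.
- by move=> j; apply: complexP; rewrite /= w0E.
move=> j; apply: ae_onW (ae_onI (dw (true, j)) (dw (false, j))) => t tI [h1 h2].
have sumE x : \sum_l al x l t * w l t =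
    \sum_l (al x (true, l) t * w (true, l) t + al x (false, l) t * w (false, l) t).
  transitivity (\sum_(l : bool * K) al x (l.1, l.2) t * w (l.1, l.2) t).
    by apply: eq_bigr => -[].
  by rewrite -(pair_bigA _ (fun c l => al x (c, l) t * w (c, l) t)) big_bool /= -big_split.
rewrite sumE in h1; rewrite sumE in h2.
split => /=.
  move: h1; congr is_derive; rewrite (big_morph _ (@cReD R) (erefl _)).
  by apply: eq_bigr => l _; rewrite ReM /al /= mulNr.
move: h2; congr is_derive; rewrite (big_morph _ (@cImD R) (erefl _)).
by apply: eq_bigr => l _; rewrite ImM /al /= addrC.
Qed.

(** The factor [Q] on the right accommodates the equation of [K], where [A] acts from that side; the
    equation of [D] takes this shape after transposition. The entries of [W] form one vector, with
    coefficients given by Kronecker products. *)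
Lemma mx_ode_exists I p q (P P' : R -> 'M[C]_p) (Q : 'M[C]_q) (W0 : 'M[C]_(p, q)) t0 :
  mx_cint I P -> mx_cint I P' -> t0 \in I ->
  exists W : R -> 'M[C]_(p, q), [/\ mx_loc_abs_cont I W, W t0 = W0 &
    ae_on I (fun t => mx_deriv W t (P t *m W t *m Q + P' t *m W t))].
Proof.
move=> lP lP' t0I.
pose a (x y : 'I_p * 'I_q) t := P t x.1 y.1 * Q y.2 x.2 + P' t x.1 y.1 * (1%:M : 'M[C]_q) y.2 x.2.
have la x y : cint I (a x y).
  by apply: cintD; (apply: cintM; [|exact: cac_cst]); [exact: lP|exact: lP'].
have [w [acw w0E dw]] := complex_ode_exists (fun x => W0 x.1 x.2) la t0I.
exists (fun t => \matrix_(i, j) w (i, j) t); split.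
- by apply/mx_acP => i j; apply: cac_ext (acw (i, j)) => t _; rewrite mxE.
- by apply/matrixP => i j; rewrite mxE w0E.
apply: ae_onW (ae_on_fin dw) => t tI h i j; have := h (i, j).
have -> : w (i, j) = (fun s => (\matrix_(i, j) w (i, j) s) i j).
  by apply/funext => s; rewrite mxE.
have -> // : \sum_l a (i, j) l t * w l t = (P t *m (\matrix_(i, j) w (i, j) t) *m Q +
   P' t *m (\matrix_(i, j) w (i, j) t)) i j.
have sE (M : 'M[C]_p) (N : 'M[C]_q) : (M *m (\matrix_(i, j) w (i, j) t) *m N) i j =
    \sum_l M i l.1 * N l.2 j * w l t.
  transitivity (\sum_(l : 'I_p * 'I_q) M i l.1 * N l.2 j * w (l.1, l.2) t); last first.
    by apply: eq_bigr => -[].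
  rewrite mxE -(pair_bigA _ (fun k l => M i k * N l j * w (k, l) t)) /= exchange_big /=.
  apply: eq_bigr => l _; rewrite mxE mulr_suml; apply: eq_bigr => k _.
  by rewrite mxE mulrAC.
rewrite -[P' t *m _ in RHS]mulmx1 mxE !sE -big_split /=; apply: eq_bigr => -[k l] _.
by rewrite /a /= mulrDl.
Qed.

(** The sum of the absolute values of all real coordinates, as it occurs in [gronwall]; it is
    submultiplicative. *)
Definition snorm m n (A : 'M[C]_(m, n)) : R :=
  \sum_i \sum_j (`|complex.Re (A i j)| + `|complex.Im (A i j)|).

Lemma snorm_ge0 m n (A : 'M[C]_(m, n)) : 0 <= snorm A.
Proof. by apply: sumr_ge0 => i _; apply: sumr_ge0 => j _; rewrite addr_ge0. Qed.

Lemma snorm_eq0 m n (A : 'M[C]_(m, n)) : snorm A <= 0 -> A = 0.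
Proof.
move=> A0; apply/matrixP => i j; rewrite mxE.
have h : `|complex.Re (A i j)| + `|complex.Im (A i j)| <= 0.
  apply: le_trans A0; rewrite /snorm (bigD1 i)//= (bigD1 j)//= -addrA lerDl.
  rewrite addr_ge0//; first by apply: sumr_ge0 => ? _; rewrite addr_ge0.
  by apply: sumr_ge0 => ? _; apply: sumr_ge0 => ? _; rewrite addr_ge0.
have := normr_ge0 (complex.Re (A i j)); have := normr_ge0 (complex.Im (A i j)) => h1 h2.
by apply: complexP; apply/eqP; rewrite -normr_le0; lra.
Qed.

Lemma snorm0 m n : snorm (0 : 'M[C]_(m, n)) = 0.
Proof. by rewrite /snorm big1// => i _; rewrite big1// => j _; rewrite mxE /= normr0 addr0. Qed.

Lemma snormE m n (A : 'M[C]_(m, n)) :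
  snorm A = \sum_(x : bool * ('I_m * 'I_n)) `|part x.1 (A x.2.1 x.2.2)|.
Proof.
rewrite -(pair_bigA _ (fun c l => `|part c (A l.1 l.2)|)) /= big_bool /= -big_split /=.
by rewrite /snorm pair_bigA.
Qed.

Lemma part_le_snorm m n (A : 'M[C]_(m, n)) c i j : `|part c (A i j)| <= snorm A.
Proof.
rewrite snormE (bigD1 (c, (i, j)))//= lerDl; exact: sumr_ge0.
Qed.

Lemma snormD m n (A B : 'M[C]_(m, n)) : snorm (A + B) <= snorm A + snorm B.
Proof.
rewrite /snorm -big_split /=; apply: ler_sum => i _; rewrite -big_split /=.
apply: ler_sum => j _; rewrite mxE cReD cImD addrACA.
by rewrite lerD// ler_normD.
Qed.

Lemma snormM m n p (A : 'M[C]_(m, n)) (B : 'M[C]_(n, p)) :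
  snorm (A *m B) <= snorm A * snorm B.
Proof.
pose c (z : C) := `|complex.Re z| + `|complex.Im z|.
have c0 z : 0 <= c z by rewrite addr_ge0.
have cM (x y : C) : c (x * y) <= c x * c y.
  rewrite /c ReM ImM.
  have := ler_normB (complex.Re x * complex.Re y) (complex.Im x * complex.Im y).
  have := ler_normD (complex.Re x * complex.Im y) (complex.Im x * complex.Re y).
  by rewrite !normrM; nra.
have cs (J : Type) (s : seq J) (x : J -> C) : c (\sum_(j <- s) x j) <= \sum_(j <- s) c (x j).
  elim: s => [|j s IH]; first by rewrite !big_nil /c /= normr0 addr0.
  rewrite !big_cons (le_trans _ (lerD (lexx _) IH))// /c cReD cImD addrACA.
  by rewrite lerD// ler_normD.
have rowle k : \sum_j c (B k j) <= snorm B.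
  rewrite /snorm [leRHS](bigD1 k)//= lerDl.
  by apply: sumr_ge0 => ? _; apply: sumr_ge0 => ? _; exact: c0.
rewrite {1 2}/snorm mulr_suml; apply: ler_sum => i _.
apply: (@le_trans _ _ (\sum_j \sum_k c (A i k) * c (B k j))).
  apply: ler_sum => j _; rewrite mxE (le_trans (cs _ _ _))//.
  by apply: ler_sum => k _; exact: cM.
rewrite exchange_big mulr_suml; apply: ler_sum => k _.
by rewrite -mulr_sumr ler_wpM2l// ?c0.
Qed.

Lemma snormZ m n a (A : 'M[C]_(m, n)) :
  snorm (a *: A) <= (`|complex.Re a| + `|complex.Im a|) * snorm A.
Proof.
rewrite /snorm mulr_sumr; apply: ler_sum => i _; rewrite mulr_sumr; apply: ler_sum => j _.
rewrite mxE ReM ImM.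
have := ler_normB (complex.Re a * complex.Re (A i j)) (complex.Im a * complex.Im (A i j)).
have := ler_normD (complex.Re a * complex.Im (A i j)) (complex.Im a * complex.Re (A i j)).
by rewrite !normrM; nra.
Qed.

Lemma snorm_cint I m n (f : R -> 'M[C]_(m, n)) : mx_cint I f -> loc_int I (fun t => snorm (f t)).
Proof.
move=> h; apply: loc_int_sum => i; apply: loc_int_sum => j; have [h1 h2] := h i j.
by apply: loc_intD; exact: loc_int_norm.
Qed.

Lemma mx_gronwall I m n (k : R -> R) t1 t :
  loc_int I k -> (forall t, 0 <= k t) -> t1 \in I -> t \in I ->
  exists2 G, 0 <= G & forall (f : R -> 'M[C]_(m, n)) b, 0 <= b -> mx_loc_abs_cont I f ->
    ae_on I (fun s => exists2 f', mx_deriv f s f' & snorm f' <= k s * (snorm (f s) + b)) ->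
    snorm (f t) <= G * (snorm (f t1) + b).
Proof.
move=> lk k0 t1I tI.
have [G G0 hG] := gronwall (bool * ('I_m * 'I_n))%type lk k0 t1I tI; exists G => // f b b0 acf fd.
have := hG (fun x s => part x.1 (f s x.2.1 x.2.2)) b b0.
rewrite -!snormE; apply.
  by move=> [[] [i j]]; have /mx_acP/(_ i j)[] := acf.
apply: ae_onW fd => s sI [f' hf' le]; exists (fun x => part x.1 (f' x.2.1 x.2.2)) => -[c [i j]] /=.
split; first by case: c; have [] := hf' i j.
by rewrite -snormE (le_trans (part_le_snorm _ _ _ _)).
Qed.

Lemma mx_ode_unique I p q (P P' : R -> 'M[C]_p) (Q : 'M[C]_q) (W : R -> 'M[C]_(p, q)) t0 :
  mx_cint I P -> mx_cint I P' -> t0 \in I -> mx_loc_abs_cont I W -> W t0 = 0 ->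
  ae_on I (fun t => mx_deriv W t (P t *m W t *m Q + P' t *m W t)) ->
  forall t, t \in I -> W t = 0.
Proof.
move=> lP lP' t0I acW W0 dW t tI.
pose k s := snorm (P s) * snorm Q + snorm (P' s).
have k0 s : 0 <= k s by rewrite addr_ge0 ?mulr_ge0 ?snorm_ge0.
have lk : loc_int I k.
  apply: loc_intD (snorm_cint lP'); apply: loc_intM (snorm_cint lP) _; exact: ac_cst.
have [G G0 hG] := mx_gronwall p q lk k0 t0I tI.
apply: snorm_eq0; apply: le_trans (hG W 0 (lexx _) acW _) _.
  apply: ae_onW dW => s sI h; exists (P s *m W s *m Q + P' s *m W s) => //.
  rewrite addr0 (le_trans (snormD _ _))// /k mulrDl lerD//; last exact: snormM.
  rewrite (le_trans (snormM _ _))// mulrAC ler_wpM2r ?snorm_ge0//; exact: snormM.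
by rewrite W0 addr0 snorm0 mulr0.
Qed.

Lemma mx_ac_eq I m n (f g h : R -> 'M[C]_(m, n)) t0 : t0 \in I ->
  mx_loc_abs_cont I f -> mx_loc_abs_cont I g -> f t0 = g t0 ->
  ae_on I (fun t => mx_deriv f t (h t) /\ mx_deriv g t (h t)) ->
  forall t, t \in I -> f t = g t.
Proof.
move=> t0I acf acg fg0 fd t tI; apply/eqP; rewrite -subr_eq0; apply/eqP.
apply: (@mx_ode_unique I m n (fun=> 0) (fun=> 0) 0 (fun t => f t - g t) t0) => //.
- exact: mx_cint0.
- exact: mx_cint0.
- exact: mx_acB.
- by rewrite fg0 subrr.
apply: ae_onW fd => s sI [fs gs]; rewrite mulmx0 mul0mx addr0 -(subrr (h s)).
exact: mx_derivB.
Qed.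

Definition cprim (a b : R) (f : R -> C) : C :=
  (prim a b (fun s => complex.Re (f s)) +i* prim a b (fun s => complex.Im (f s)))%C.

Lemma mx_primitive_exists I m n (h : R -> 'M[C]_(m, n)) (W0 : 'M[C]_(m, n)) t0 :
  mx_cint I h -> t0 \in I ->
  exists W : R -> 'M[C]_(m, n), [/\ mx_loc_abs_cont I W, W t0 = W0 &
    ae_on I (fun t => mx_deriv W t (h t))].
Proof.
move=> lh t0I; exists (fun t => \matrix_(i, j) (W0 i j + cprim t0 t (fun s => h s i j))).
split.
- apply/mx_acP => i j; have [h1 h2] := lh i j.
  suff : cac I (fun t => W0 i j + cprim t0 t (fun s => h s i j)).
    by apply: cac_ext => t _; rewrite mxE.
  apply: cacD; first exact: cac_cst.
  by split => /=; exact: ac_prim.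
- by apply/matrixP => i j; rewrite mxE /cprim !primtt addr0.
have : ae_on I (fun t => forall x : 'I_m * 'I_n,
    cderive (fun t => cprim t0 t (fun s => h s x.1 x.2)) t (h t x.1 x.2)).
  apply: ae_on_fin => -[i j]; have [h1 h2] := lh i j.
  by apply: ae_onW (ae_onI (prim_derive h1 t0I) (prim_derive h2 t0I)) => t _ [].
apply: ae_onW => t tI hd i j.
have := cderiveD (cderive_cst (W0 i j) t) (hd (i, j)); rewrite add0r => -[h1 h2].
by split; under eq_fun do rewrite mxE.
Qed.

Lemma oint_derive I (f : R -> C) (h : R -> C) t0 t : cac I f -> cint I h ->
  ae_on I (fun s => cderive f s (h s)) -> t0 \in I -> t \in I ->
  oint t0 t h = f t - f t0.
Proof.
move=> [f1 f2] [h1 h2] fd t0I tI.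
have E (g k : R -> R) : ac I g -> loc_int I k -> ae_on I (fun s => is_derive s (1 : R) g (k s)) ->
    prim t0 t k = g t - g t0.
  move=> acg lk gd; rewrite (ac_eq_increments acg (ac_prim lk t0I) _ t0I tI) ?primtt ?subr0//.
  by apply: ae_onW (ae_onI gd (prim_derive lk t0I)) => s _ [h3 h4]; exists (k s).
have e1 := E _ _ f1 h1 (ae_onW (fun s _ => @proj1 _ _) fd).
have e2 := E _ _ f2 h2 (ae_onW (fun s _ => @proj2 _ _) fd).
apply: complexP.
  by rewrite cReD cReN -e1 /oint /prim; case: ifP.
by rewrite cImD cImN -e2 /oint /prim; case: ifP.
Qed.

End MatrixODE.

(** * Evolution of a realization *)

Section SumNorm.
Context {R : realType}.
Local Notation C := R[i].

Definition cabs1 (z : C) : R := `|complex.Re z| + `|complex.Im z|.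

Lemma cabs1_ge0 z : 0 <= cabs1 z.
Proof. by rewrite addr_ge0. Qed.

Lemma cabs1_le (z : C) (e : R) : `|z| < (e%:C)%C -> cabs1 z <= 2 * e.
Proof.
rewrite norm_normc ltcR => h; have := Re_le_normc z; have := Im_le_normc z.
by rewrite /cabs1; lra.
Qed.

Lemma cabs1D (x y : C) : cabs1 (x + y) <= cabs1 x + cabs1 y.
Proof. by rewrite /cabs1 cReD cImD addrACA lerD// ler_normD. Qed.

Lemma norm_le_snorm m n (A : 'M[C]_(m, n)) i j : `|A i j| <= ((snorm A)%:C)%C.
Proof.
rewrite norm_normc lecR (le_trans (normc_le _))// snormE.
rewrite (bigD1 (true, (i, j)))//= lerD2l (bigD1 (false, (i, j)))//= lerDl.
exact: sumr_ge0.
Qed.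

Lemma snorm_col m1 m2 n (A : 'M[C]_(m1, n)) (B : 'M[C]_(m2, n)) :
  snorm (col_mx A B) = snorm A + snorm B.
Proof.
rewrite /snorm big_split_ord /=; congr (_ + _); apply: eq_bigr => i _; apply: eq_bigr => j _.
  by rewrite col_mxEu.
by rewrite col_mxEd.
Qed.

(** The rate depends on [a] and no longer on z, so one Gronwall constant serves a whole
    neighbourhood. The radius 2 for [cabs1] corresponds to radius 1 for the modulus. *)
Lemma mx_ode_bound m n z a (N M0 : R -> 'M[C]_m) (W : R -> 'M[C]_(m, n)) s :
  cabs1 (z - a) <= 2 -> mx_deriv W s ((z *: N s + M0 s) *m W s) ->
  exists2 f', mx_deriv W s f' &
    snorm f' <= ((cabs1 a + 2) * snorm (N s) + snorm (M0 s)) * (snorm (W s) + 0).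
Proof.
move=> za dW; eexists; first exact: dW.
rewrite addr0 (le_trans (snormM _ _))// ler_wpM2r ?snorm_ge0//.
rewrite (le_trans (snormD _ _))// lerD2r (le_trans (snormZ _ _))// ler_wpM2r ?snorm_ge0//.
by rewrite -[z](subrK a) -/(cabs1 _) (le_trans (cabs1D _ _))// addrC lerD2l.
Qed.

End SumNorm.

Section DefectAlgebra.
Context {C : numClosedFieldType}.

(** With [x = Z D u], the relation [z x = A x + D u] removes the resolvent: [Z (D' u + D u')]
    reduces to [D s1^-1 s2 u], and [A x] to [z x - D u]. The rest regroups into the output equation
    for the defect and a source term in [u]. *)
Lemma defect_algebra n m (s1 s2 g gs : 'M[C]_n) (A : 'M[C]_m) (K K' : 'M[C]_(n, m))
    (D D' : 'M[C]_(m, n)) z (u y u' y' : 'cV[C]_n) (Z := invmx (z%:M - A)) :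
  s1 \in unitmx -> z%:M - A \in unitmx ->
  z *: (s2 *m u) - s1 *m u' + g *m u = 0 ->
  z *: (s2 *m y) - s1 *m y' + gs *m y = 0 ->
  s1 *m K' = s2 *m K *m A + gs *m K ->
  D' = - (A *m D *m invmx s1 *m s2) - D *m invmx s1 *m g ->
  y' - u' + (K' *m (Z *m (D *m u)) + K *m (Z *m (D' *m u + D *m u'))) =
  invmx s1 *m (z *: s2 + gs) *m (y - u + K *m (Z *m (D *m u))) +
  invmx s1 *m (gs - g + s1 *m K *m D *m invmx s1 *m s2 - s2 *m K *m D) *m u.
Proof.
move=> us1 uz hu hy hK hD.
have su : s1 *m u' = z *: (s2 *m u) + g *m u.
  by apply/eqP; rewrite eq_sym -subr_eq0 addrAC hu.
have sy : s1 *m y' = z *: (s2 *m y) + gs *m y.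
  by apply/eqP; rewrite eq_sym -subr_eq0 addrAC hy.
have [x Ex] : exists x, x = Z *m (D *m u) by eexists.
have zx : z *: x = A *m x + D *m u.
  by rewrite -[D *m u](mulKVmx uz) -/Z -Ex mulmxBl mul_scalar_mx addrC subrK.
have Zx : Z *m (D' *m u + D *m u') = D *m invmx s1 *m s2 *m u.
  rewrite -[RHS](mulKmx uz) -/Z; congr (_ *m _).
  rewrite -[u'](mulKmx us1) su hD !mulmxBl mul_scalar_mx !mulNmx !mulmxDr !mulmxA.
  rewrite -!scalemxAr !mulmxA.
  have [a Ea] : exists a, a = A *m D *m invmx s1 *m s2 *m u by eexists.
  have [b Eb] : exists b, b = D *m invmx s1 *m g *m u by eexists.
  have [c Ec] : exists c, c = D *m invmx s1 *m s2 *m u by eexists.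
  rewrite -Ea -Eb -Ec; apply/matrixP => i j; rewrite !mxE; ring.
rewrite Zx -Ex.
have [M EM] : exists M, M = z *: s2 + gs by eexists.
have [L EL] : exists L, L = gs - g + s1 *m K *m D *m invmx s1 *m s2 - s2 *m K *m D by eexists.
rewrite -EM -EL; apply: (can_inj (mulKmx us1)).
rewrite !mulmxDr !mulmxN su sy !mulmxA !mulmxV// !mul1mx hK mulmxDl EM EL.
rewrite -[s2 *m K *m A *m x]mulmxA.
have -> : A *m x = z *: x - D *m u by rewrite zx addrK.
rewrite !mulmxDl !mulmxDr !mulNmx !mulmxN -!scalemxAr -!scalemxAl !mulmxA.
have [a Ea] : exists a, a = s2 *m K *m x by eexists.
have [b Eb] : exists b, b = s2 *m K *m D *m u by eexists.
have [c Ec] : exists c, c = s1 *m K *m D *m invmx s1 *m s2 *m u by eexists.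
rewrite -Ea -Eb -Ec; move: (gs *m K *m x) (gs *m y) (gs *m u) (g *m u) (s2 *m y) (s2 *m u).
move=> *; apply/matrixP => i j; rewrite !mxE; ring.
Qed.

End DefectAlgebra.

Section Evolution.
Context {R : realType} (n : nat) (I : interval R).
Local Notation C := R[i].
Context (s1 s2 g gs : R -> 'M[C]_n) (S : C -> R -> 'M[C]_n).
Context (s1_ac : mx_loc_abs_cont I s1) (s1_unit : forall t, t \in I -> s1 t \in unitmx).
Context (s2_int : mx_loc_integrable I s2) (g_int : mx_loc_integrable I g)
  (gs_int : mx_loc_integrable I gs).

Local Notation J t := (invmx (s1 t)).

Lemma mx_cint_Jl p (f : R -> 'M[C]_(n, p)) : mx_cint I f -> mx_cint I (fun t => J t *m f t).
Proof. by apply: mx_cintMl; exact: mx_ac_inv. Qed.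

Lemma mx_cint_Js2 : mx_cint I (fun t => J t *m s2 t).
Proof. by apply: mx_cint_Jl; apply/mx_cintP. Qed.

Lemma mx_cint_Jg : mx_cint I (fun t => J t *m g t).
Proof. by apply: mx_cint_Jl; apply/mx_cintP. Qed.

Lemma mx_cint_Jgs : mx_cint I (fun t => J t *m gs t).
Proof. by apply: mx_cint_Jl; apply/mx_cintP. Qed.

Lemma solution_deriv z u t u' : t \in I -> z *: (s2 t *m u) - s1 t *m u' + g t *m u = 0 ->
  u' = (z *: (J t *m s2 t) + J t *m g t) *m (u : 'cV[C]_n).
Proof.
move=> tI h; apply: (can_inj (mulKmx (s1_unit tI))).
rewrite mulmxDl mulmxDr -scalemxAl -scalemxAr !mulmxA mulmxV ?s1_unit// !mul1mx.
by apply/eqP; rewrite eq_sym -subr_eq0 addrAC h.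
Qed.

Lemma solution_exists z t1 (eta : 'cV[C]_n) : t1 \in I ->
  exists2 u, solution I s1 s2 g z u & u t1 = eta.
Proof.
move=> t1I.
have lP : mx_cint I (fun t => z *: (J t *m s2 t) + J t *m g t).
  by apply: mx_cintD mx_cint_Jg; apply: mx_cintZ; exact: mx_cint_Js2.
have [u [acu u1 du]] := mx_ode_exists 0 eta (@mx_cint0 R I n n) lP t1I.
exists u => //; split => //; apply: ae_onW du => t tI; rewrite mul0mx mul0mx add0r => du.
eexists; first exact: du.
rewrite mulmxA mulmxDr -scalemxAr !mulmxA mulmxV ?s1_unit// !mul1mx.
by rewrite mulmxDl -scalemxAl opprD addrA subrr add0r addNr.
Qed.

Context (m : nat) (A : 'M[C]_m) (K : R -> 'M[C]_(n, m)) (D : R -> 'M[C]_(m, n)).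
Context (K_ac : mx_loc_abs_cont I K) (D_ac : mx_loc_abs_cont I D).
Context (K_deriv : ae_on I (fun t => exists2 K', mx_deriv K t K' &
   s1 t *m K' = s2 t *m K t *m A + gs t *m K t)).
Context (D_deriv : ae_on I (fun t =>
   mx_deriv D t (- (A *m D t *m J t *m s2 t) - D t *m J t *m g t))).

(** The linkage condition as a difference, where [K] is [B^*] and [D] is [B s1]. *)
Definition defect t : 'M[C]_n :=
  gs t - g t + s1 t *m K t *m D t *m J t *m s2 t - s2 t *m K t *m D t.

Lemma mx_cint_defect : mx_cint I defect.
Proof.
have /mx_cintP l2 := s2_int; have /mx_cintP lg := g_int; have /mx_cintP lgs := gs_int.
have acJ := mx_ac_inv s1_ac s1_unit.
apply: mx_cintB; last by do 2 (apply: mx_cintM => //).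
apply: mx_cintD; first exact: mx_cintB.
by apply: mx_cintMl => //; do 3 (apply: mx_acM => //).
Qed.

(** The pair [(u, e)] solves a linear system with matrix [z *: pencil_gen + defect_gen]: the input
    equation for [u], and the output equation for [e] with a source proportional to [u]. *)
Definition defect_gen : R -> 'M[C]_(n + n) := fun t =>
  block_mx (J t *m g t) 0 (J t *m defect t) (J t *m gs t).

Definition pencil_gen : R -> 'M[C]_(n + n) := fun t =>
  block_mx (J t *m s2 t) 0 0 (J t *m s2 t).

Lemma mx_cint_defect_gen : mx_cint I defect_gen.
Proof.
apply: mx_cint_block; [exact: mx_cint_Jg|exact: mx_cint0| |exact: mx_cint_Jgs].
exact: mx_cint_Jl mx_cint_defect.
Qed.

Lemma mx_cint_pencil_gen : mx_cint I pencil_gen.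
Proof. by apply: mx_cint_block; try exact: mx_cint_Js2; exact: mx_cint0. Qed.

Context (t0 : R) (t0I : t0 \in I).
Context (S_rational : forall t, t \in I -> rationalmx (S ^~ t))
  (S_maps : maps_solutions I s1 s2 g gs S)
  (S_infty : forall t, t \in I -> lim_at_infinity (S ^~ t) 1%:M).
Context (real0 : realizes (fun z => 1%:M - S z t0) A (K t0) (D t0)).

(* [e] is the defect of the candidate realization along a solution [u]: with [y]
   the output of [S], it is [y - u + K (z - A)^-1 D u]. *)
Lemma defect_solution z t1 (eta : 'cV[C]_n) : t1 \in I -> z%:M - A \in unitmx ->
  analytic_at (S ^~ t0) z ->
  exists u e : R -> 'cV[C]_n, [/\ mx_loc_abs_cont I u, mx_loc_abs_cont I e &
    [/\ u t1 = eta, e t0 = 0,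
      ae_on I (fun t => mx_deriv u t ((z *: (J t *m s2 t) + J t *m g t) *m u t)),
      ae_on I (fun t => mx_deriv (fun s => col_mx (u s) (e s)) t
        ((z *: pencil_gen t + defect_gen t) *m col_mx (u t) (e t))) &
      forall t, t \in I -> analytic_at (S ^~ t) z ->
        e t = (S z t - 1%:M + K t *m invmx (z%:M - A) *m D t) *m u t]].
Proof.
move=> t1I uz an0; have [u usol u1] := solution_exists z eta t1I.
have [y ysol yS] := S_maps usol.
have [acu du] := usol; have [acy dy] := ysol.
pose Z := invmx (z%:M - A).
(* Built on [y] and not on [S z t *m u t], [e] stays absolutely continuous across the times at which
   z is a pole. *)
pose e t := y t - u t + K t *m (Z *m (D t *m u t)).
have eE t : t \in I -> analytic_at (S ^~ t) z ->
    e t = (S z t - 1%:M + K t *m Z *m D t) *m u t.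
  by move=> tI an; rewrite /e (yS t tI an) mulmxDl mulmxBl mul1mx !mulmxA.
exists u, e; split => //.
  apply: mx_acD; first exact: mx_acB.
  apply: mx_acM => //; apply: mx_acM; first exact: mx_ac_cst.
  exact: mx_acM.
split => //.
- by rewrite eE// (analytic_realization real0 an0 uz) [1%:M - _]addrC addrK addNr mul0mx.
- by apply: ae_onW du => t tI [u' hu hE]; rewrite -(solution_deriv tI hE).
apply: ae_onW (ae_onI (ae_onI du dy) (ae_onI K_deriv D_deriv)) => t tI.
move=> [[[u' hu uE] [y' hy yE]] [[K' hK KE] hD]].
have E : y' - u' + (K' *m (Z *m (D t *m u t)) + K t *m (Z *m
    ((- (A *m D t *m J t *m s2 t) - D t *m J t *m g t) *m u t + D t *m u'))) =
    J t *m (z *: s2 t + gs t) *m e t + J t *m defect t *m u t.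
  exact: (defect_algebra (s1_unit tI) uz uE yE KE (erefl _)).
have de := mx_derivD (mx_derivB hy hu) (mx_derivM hK (mx_derivMl Z (mx_derivM hD hu))).
have -> : (z *: pencil_gen t + defect_gen t) *m col_mx (u t) (e t) =
    col_mx u' (y' - u' + (K' *m (Z *m (D t *m u t)) + K t *m (Z *m
      ((- (A *m D t *m J t *m s2 t) - D t *m J t *m g t) *m u t + D t *m u')))).
  rewrite E /pencil_gen /defect_gen scale_block_mx add_block_mx mul_block_col.
  rewrite !scaler0 !add0r mul0mx addr0 -(solution_deriv tI uE); congr col_mx.
  by rewrite addrC [J t *m (z *: _ + _)]mulmxDr -scalemxAr.
exact: mx_deriv_col.
Qed.

(* Gronwall bounds the strictly proper rational function [Rd], which maps [u t]
   to [e t], near every point; hence it has no poles and vanishes. *)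
Lemma transfer_constant t : t \in I -> realizes (fun z => 1%:M - S z t) A (K t) (D t).
Proof.
move=> tI; pose Rd z := S z t - 1%:M + K t *m invmx (z%:M - A) *m D t.
suff : generically (fun z => Rd z = 0).
  move=> h; have gu := generically_unitmx A.
  apply/realizesP; apply: genericallyW (genericallyI h gu) => z [Rz uz].
  split => //; apply/eqP; rewrite -subr_eq0 -oppr_eq0 !opprB addrC.
  by rewrite -[X in X == 0]/(Rd z) Rz.
apply: proper_fraction_bounded0.
  have p1 := proper_fractionN (rationalmx_proper (S_rational tI) (S_infty tI)).
  have rK : realizes (fun z => K t *m invmx (z%:M - A) *m D t) A (K t) (D t).
    by apply/realizesP; apply: genericallyW (generically_unitmx A) => z uz.
  have := proper_fractionD p1 (realizes_proper_fraction rK).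
  by under eq_fun do rewrite opprB.
move=> a.
have lJ2 := snorm_cint mx_cint_Js2; have lJg := snorm_cint mx_cint_Jg.
have lN := snorm_cint mx_cint_pencil_gen; have lM := snorm_cint mx_cint_defect_gen.
have a0 : 0 <= cabs1 a + 2 by rewrite addr_ge0 ?cabs1_ge0.
(* [G1] carries [u] from its prescribed value at [t] back to [t0]; [G2] carries [(u, e)] from [t0],
   where [e = 0], forward to [t]. *)
have [G1 G10 hG1] := @mx_gronwall R I n 1 _ t t0 (loc_intD (loc_intZ (cabs1 a + 2) lJ2) lJg)
  (fun s => addr_ge0 (mulr_ge0 a0 (snorm_ge0 _)) (snorm_ge0 _)) tI t0I.
have [G2 G20 hG2] := @mx_gronwall R I (n + n) 1 _ t0 t (loc_intD (loc_intZ (cabs1 a + 2) lN) lM)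
  (fun s => addr_ge0 (mulr_ge0 a0 (snorm_ge0 _)) (snorm_ge0 _)) t0I tI.
pose B := G2 * G1 * \sum_j snorm (delta_mx j 0 : 'cV[C]_n).
have B0 : 0 <= B by rewrite !mulr_ge0// sumr_ge0// => j _; exact: snorm_ge0.
exists (B%:C)%C, 1; split; rewrite ?lecR//.
apply: genericallyW (genericallyI (generically_unitmx A) (genericallyI
  (rationalmx_analytic (S_rational t0I)) (rationalmx_analytic (S_rational tI)))).
move=> z [uz [an0 ant]] za i j.
have za2 : cabs1 (z - a) <= 2 by rewrite (le_trans (cabs1_le (e := 1) za))// mulr1.
have [u [e [acu ace [ut e0 du dW eE]]]] := defect_solution (delta_mx j 0) tI uz an0.
have hu : snorm (u t0) <= G1 * (snorm (u t) + 0).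
  apply: (hG1 u 0 (lexx _) acu); apply: ae_onW du => s sI h.
    apply: (@mx_ode_bound _ _ _ z a (fun s => J s *m s2 s) (fun s => J s *m g s) u s za2).
    exact: h.
have hW : snorm (col_mx (u t) (e t)) <= G2 * (snorm (col_mx (u t0) (e t0)) + 0).
  apply: (hG2 (fun s => col_mx (u s) (e s)) 0) => //; first exact: mx_ac_col.
  by apply: ae_onW dW => s sI h; exact: (mx_ode_bound za2 h).
have -> : Rd z i j = (e t) i 0 by rewrite eE// ut -colE [RHS]mxE.
rewrite (le_trans (norm_le_snorm _ _ _))// lecR.
have h1 : snorm (e t) <= snorm (col_mx (u t) (e t)) by rewrite snorm_col lerDr snorm_ge0.
rewrite (le_trans h1)// (le_trans hW)// e0 snorm_col snorm0 !addr0 /B -mulrA ler_wpM2l//.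
rewrite (le_trans hu)// addr0 ut ler_wpM2l// (bigD1 j)//= lerDl.
by apply: sumr_ge0 => k _; exact: snorm_ge0.
Qed.

(* [e] vanishes for generic [z], hence by continuity in [z] also for [z = 0],
   where its equation forces [defect *m u = 0] for all solutions [u]. *)
Lemma linkage : ae_on I (fun t => defect t = 0).
Proof.
have lP := mx_cint_defect_gen.
(* [W *m eta] solves the system of [(u, e)] at [z = 0] with [e t0 = 0]. Since 0 may be a pole of [S]
   or an eigenvalue of [A], it is compared with the solutions at generic small z. *)
have [W [acW W0 dW]] := mx_ode_exists 0 (col_mx 1%:M 0 : 'M[C]_(n + n, n))
  (@mx_cint0 R I (n + n) (n + n)) lP t0I.
have e0 t (eta : 'cV[C]_n) : t \in I -> dsubmx (W t) *m eta = 0.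
  move=> tI; apply: snorm_eq0; apply/ler_addgt0Pr => ep ep0; rewrite add0r.
  pose V s := W s *m eta.
  have lV : mx_cint I (fun s => pencil_gen s *m V s).
    apply: mx_cintM mx_cint_pencil_gen _; apply: mx_acM => //; exact: mx_ac_cst.
  have lN := snorm_cint mx_cint_pencil_gen; have lM := snorm_cint mx_cint_defect_gen.
  pose k s := 2 * snorm (pencil_gen s) + snorm (defect_gen s) + snorm (pencil_gen s *m V s).
  have k0 s : 0 <= k s by rewrite !addr_ge0 ?mulr_ge0 ?snorm_ge0.
  have lk : loc_int I k by apply: loc_intD (snorm_cint lV); exact: loc_intD (loc_intZ 2 lN) lM.
  have [G G0 hG] := @mx_gronwall R I (n + n) 1 _ t0 t lk k0 t0I tI.
  (* The entry 1 keeps z in the range where the rate [k] is valid; the other makes [G * (2 * dl)] at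
     most [ep]. *)
  pose dl := Num.min 1 (ep / (2 * (G + 1))).
  have dl0 : 0 < dl by rewrite lt_min ltr01 divr_gt0// mulr_gt0// ltr_wpDl.
  have rt := (transfer_constant tI).
  have gen := genericallyI (generically_unitmx A) (genericallyI
    (rationalmx_analytic (S_rational t0I)) (rationalmx_analytic (S_rational tI))).
  have dlC : 0 < (dl%:C)%C by rewrite ltcR.
  have [z [uz [an0 ant]] zdl] := generically_near 0 gen dlC.
  have [u [e [acu ace [u0 et0 du dX eE]]]] := defect_solution eta t0I uz an0.
  have zc : cabs1 z <= 2 * dl by apply: cabs1_le; rewrite subr0 in zdl.
  have et : e t = 0.
    by rewrite eE// (analytic_realization rt ant uz) [1%:M - _]addrC addrK addNr mul0mx.
  (* The difference of the two solutions vanishes at [t0] and has the source term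
     [z *: (pencil_gen s *m V s)], which accounts for the [b] of Gronwall's lemma. *)
  have h : snorm (col_mx (u t) (e t) - V t) <= G * (snorm (col_mx (u t0) (e t0) - V t0) + cabs1 z).
    apply: (hG (fun s => col_mx (u s) (e s) - V s)) => //.
    + exact: cabs1_ge0.
    + apply: mx_acB; first exact: mx_ac_col.
      by apply: mx_acM => //; exact: mx_ac_cst.
    apply: ae_onW (ae_onI dX dW) => s sI [hX hW].
    have hV := mx_derivMr eta hW.
    eexists; first exact: mx_derivB hX hV.
    have -> : (z *: pencil_gen s + defect_gen s) *m col_mx (u s) (e s) -
        (0 *m W s *m 0 + defect_gen s *m W s) *m eta =
        (z *: pencil_gen s + defect_gen s) *m (col_mx (u s) (e s) - V s) +
        z *: (pencil_gen s *m V s).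
      rewrite mul0mx mul0mx add0r -mulmxA -/(V s) mulmxBr [in X in _ = _ - X + _]mulmxDl -scalemxAl.
      by rewrite opprD addrA [in RHS]addrAC subrK.
    have z2 : cabs1 z <= 2 by rewrite (le_trans zc)// -[leRHS]mulr1 ler_wpM2l// ge_min lexx.
    rewrite (le_trans (snormD _ _))// mulrDr lerD//.
      rewrite (le_trans (snormM _ _))// ler_wpM2r ?snorm_ge0// (le_trans (snormD _ _))//.
      rewrite /k -addrA [X in _ <= _ + X]addrC addrA lerD// ?snorm_ge0// ler_wpDr ?snorm_ge0//.
      by rewrite (le_trans (snormZ _ _))// ler_wpM2r// snorm_ge0.
    rewrite (le_trans (snormZ _ _))// mulrC ler_wpM2r ?cabs1_ge0// /k lerDr.
    by rewrite addr_ge0 ?mulr_ge0 ?snorm_ge0.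
  have V0 : V t0 = col_mx (u t0) (e t0) by rewrite /V W0 u0 et0 mul_col_mx mul1mx mul0mx.
  move: h; rewrite V0 subrr snorm0 add0r => h.
  have -> : dsubmx (W t) *m eta = - dsubmx (col_mx (u t) (e t) - V t).
    by rewrite linearB /= col_mxKd et sub0r opprK /V mul_dsub_mx.
  have h2 : snorm (- dsubmx (col_mx (u t) (e t) - V t)) <= snorm (col_mx (u t) (e t) - V t).
    move: (_ - V t) => Y; rewrite -[in leRHS](vsubmxK Y) snorm_col ler_wpDl ?snorm_ge0//.
    rewrite -scaleN1r (le_trans (snormZ _ _))// /= normrN normr1 oppr0 normr0 addr0 mul1r //.
  rewrite (le_trans h2)// (le_trans h)// (le_trans (ler_wpM2l G0 zc))//.
  have : dl <= ep / (2 * (G + 1)) by rewrite ge_min lexx orbT.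
  have G1 : 0 < 2 * (G + 1) by rewrite mulr_gt0// ltr_wpDl.
  by rewrite ler_pdivlMr//; nra.
have e0' t : t \in I -> dsubmx (W t) = 0.
  move=> tI; apply/matrixP => i j; have := e0 t (delta_mx j 0) tI.
  by move=> /matrixP/(_ i 0); rewrite -colE mxE => ->; rewrite !mxE.
pose U t := usubmx (W t).
have WU t : t \in I -> W t = col_mx (U t) 0 by move=> tI; rewrite -[LHS]vsubmxK e0'.
have dU : ae_on I (fun t => mx_deriv U t (J t *m g t *m U t)).
  apply: ae_onW dW => t tI h i j; have := h (lshift n i) j.
  rewrite mul0mx mul0mx add0r (WU t tI) /defect_gen mul_block_col mul0mx addr0 col_mxEu.
  by rewrite /U; under [X in is_derive _ _ X _]eq_fun do rewrite -[W _]vsubmxK col_mxEu;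
    under [X in _ /\ is_derive _ _ X _]eq_fun do rewrite -[W _]vsubmxK col_mxEu.
have dE : ae_on I (fun t => mx_deriv (fun t => dsubmx (W t)) t (J t *m defect t *m U t)).
  apply: ae_onW dW => t tI h i j; have := h (rshift n i) j.
  rewrite mul0mx mul0mx add0r (WU t tI) /defect_gen mul_block_col !mulmx0 !addr0 col_mxEd.
  by under [X in is_derive _ _ X _]eq_fun do rewrite -[W _]vsubmxK col_mxEd;
    under [X in _ /\ is_derive _ _ X _]eq_fun do rewrite -[W _]vsubmxK col_mxEd.
have acU : mx_loc_abs_cont I U.
  apply/mx_acP => i j; have /mx_acP/(_ (lshift n i) j) := acW.
  by apply: cac_ext => t _; rewrite mxE.
(* [U] is the fundamental matrix of the input equation at [z = 0]: a vector killed at [t] gives a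
   solution that vanishes at [t], hence at [t0], where [U] is 1. *)
have Uunit t : t \in I -> U t \in unitmx.
  move=> tI; apply: unitmx_injective => v Uv.
  have Uv0 : U t0 *m v = 0.
    apply: (@mx_ode_unique R I n 1 _ _ 0 (fun s => U s *m v) t
      (@mx_cint0 R I n n) mx_cint_Jg) => //.
      by apply: mx_acM => //; exact: mx_ac_cst.
    apply: ae_onW dU => s sI h; rewrite mul0mx mul0mx add0r mulmxA; exact: mx_derivMr.
  by rewrite -Uv0 /U W0 col_mxKu mul1mx.
have := mx_deriv_vanishing e0' dE; apply: ae_onW => t tI h.
have : J t *m defect t = 0 by rewrite -[LHS](mulmxK (Uunit t tI)) h mul0mx.
by move=> h'; rewrite -[LHS](mulKVmx (s1_unit tI)) h' mulmx0.
Qed.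

End Evolution.

(** * Identities for the Gram matrix *)

Section GramAlgebra.
Context {C : numClosedFieldType}.
Context (n m : nat) (s1 s1' s2 g gs : 'M[C]_n) (A X : 'M[C]_m) (K K' : 'M[C]_(n, m)).
Context (s1_herm : s1^t* = s1) (s2_herm : s2^t* = s2) (s1_unit : s1 \in unitmx)
  (gs_herm : gs^t* = - gs - s1').
Context (K_eq : s1 *m K' = s2 *m K *m A + gs *m K).

Lemma adj_output_eq : K'^t* *m s1 = A^t* *m K^t* *m s2 - K^t* *m gs - K^t* *m s1'.
Proof.
have := congr1 (fun M => M^t*) K_eq.
rewrite adjmxD !adjmxM s1_herm s2_herm gs_herm => ->.
by rewrite mulmxA mulmxBr mulmxN addrA.
Qed.

(** The left side is the derivative of the Lyapunov expression when [X' = - K^* s2 K]. The relation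
    between [gs], its adjoint and [s1'] cancels the terms in [gs] and [s1'], the output equation
    those in [A]. *)
Lemma lyapunov_derivative :
  - (K^t* *m s2 *m K) *m A + A^t* *m - (K^t* *m s2 *m K) +
  ((K'^t* *m s1 + K^t* *m s1') *m K + K^t* *m s1 *m K') = 0.
Proof.
rewrite adj_output_eq subrK -[K^t* *m s1 *m K']mulmxA K_eq mulmxBl mulmxDr mulNmx mulmxN !mulmxA.
move: (K^t* *m s2 *m K *m A) (A^t* *m K^t* *m s2 *m K) (K^t* *m gs *m K) => a b c.
by apply/matrixP => i j; rewrite !mxE; ring.
Qed.

(** The difference [X D - K^* s1] solves a homogeneous linear equation, so it vanishes once it
    vanishes at [t0]. The Lyapunov equation replaces [X A], and the linkage condition replaces
    [g]. *)
Lemma state_adjoint_derivative (D : 'M[C]_(m, n)) :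
  X *m A + A^t* *m X + K^t* *m s1 *m K = 0 ->
  gs - g + s1 *m K *m D *m invmx s1 *m s2 - s2 *m K *m D = 0 ->
  (- (K^t* *m s2 *m K) *m D + X *m (- (A *m D *m invmx s1 *m s2) - D *m invmx s1 *m g)) -
    (K'^t* *m s1 + K^t* *m s1') =
  A^t* *m (X *m D - K^t* *m s1) *m (invmx s1 *m s2) - (X *m D - K^t* *m s1) *m (invmx s1 *m g).
Proof.
move=> lyap L0; rewrite adj_output_eq subrK.
have XA : X *m A = - (A^t* *m X) - K^t* *m s1 *m K.
  by apply/eqP; rewrite -subr_eq0 -opprD opprK addrA lyap.
have gE : g = gs + s1 *m K *m D *m invmx s1 *m s2 - s2 *m K *m D.
  apply/eqP; rewrite eq_sym -subr_eq0; apply/eqP; rewrite -[RHS]L0.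
  by apply/matrixP => i j; rewrite !mxE; ring.
have Jg : (X *m D - K^t* *m s1) *m (invmx s1 *m g) = X *m D *m invmx s1 *m g -
    (K^t* *m gs + K^t* *m s1 *m K *m D *m invmx s1 *m s2 - K^t* *m s2 *m K *m D).
  rewrite mulmxBl !mulmxA (mulmxK s1_unit) {2}gE mulmxBr mulmxDr !mulmxA.
  by [].
rewrite Jg !mulmxBr mulmxN !mulmxA XA !mulmxBl !mulNmx (mulmxK s1_unit).
move: (K^t* *m s2 *m K *m D) (A^t* *m X *m D *m invmx s1 *m s2) (K^t* *m gs)
  (K^t* *m s1 *m K *m D *m invmx s1 *m s2) (X *m D *m invmx s1 *m g) (A^t* *m K^t* *m s2).
by move=> *; apply/matrixP => i j; rewrite !mxE; ring.
Qed.

End GramAlgebra.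

(** Transposition brings the equation of [X D - K^* s1], whose variable coefficients act from the
    right, into the shape of [mx_ode_unique]. *)
Lemma trmx_sylvester (F : comNzRingType) m n (A : 'M[F]_m) (E : 'M[F]_(m, n)) (P Q : 'M[F]_n) :
  (A *m E *m P - E *m Q)^T = P^T *m E^T *m A^T + - Q^T *m E^T.
Proof. by rewrite linearB /= !trmx_mul mulmxA mulNmx. Qed.

(** * Propagation from the base point *)

Section StateSpace.
Context {R : realType}.
Local Notation C := R[i].

Lemma state_space n (I : interval R) (s1 s2 g gs : R -> 'M[C]_n) (S : C -> R -> 'M[C]_n) t0 :
  mx_loc_abs_cont I s1 -> (forall t, t \in I -> s1 t \in unitmx) ->
  mx_loc_integrable I s2 -> mx_loc_integrable I g -> mx_loc_integrable I gs ->
  (forall t, t \in I -> (s1 t)^t* = s1 t) -> ae_on I (fun t => (s2 t)^t* = s2 t) ->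
  ae_on I (fun t => exists2 s1', mx_deriv s1 t s1' & (gs t)^t* = - gs t - s1') ->
  (forall t, t \in I -> rationalmx (S ^~ t)) -> maps_solutions I s1 s2 g gs S ->
  (forall t, t \in I -> lim_at_infinity (S ^~ t) 1%:M) ->
  (forall t z, t \in I -> analytic_at (S ^~ t) z -> complex.Re z < 0 ->
     psdmx (S z t *m invmx (s1 t) *m (S z t)^t* - invmx (s1 t))) ->
  (forall t z, t \in I -> analytic_at (S ^~ t) z -> analytic_at (S ^~ t) (- Num.conj z) ->
     S z t *m invmx (s1 t) *m (S (- Num.conj z) t)^t* = invmx (s1 t)) ->
  t0 \in I ->
  exists m (A : 'M[C]_m) (K : R -> 'M[C]_(n, m)) (D : R -> 'M[C]_(m, n)) (X : R -> 'M[C]_m),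
  [/\ [/\ mx_loc_abs_cont I K, mx_loc_abs_cont I D, mx_loc_abs_cont I X &
          mx_cint I (fun t => (K t)^t* *m s2 t *m K t)],
      [/\ ae_on I (fun t => exists2 K', mx_deriv K t K' &
            s1 t *m K' = s2 t *m K t *m A + gs t *m K t),
          ae_on I (fun t => mx_deriv D t
            (- (A *m D t *m invmx (s1 t) *m s2 t) - D t *m invmx (s1 t) *m g t)),
          ae_on I (fun t => mx_deriv X t (- ((K t)^t* *m s2 t *m K t))) &
          ae_on I (fun t => gs t - g t + s1 t *m K t *m D t *m invmx (s1 t) *m s2 t
            - s2 t *m K t *m D t = 0)] &
      forall t, t \in I -> [/\ (X t)^t* = X t, posdef (X t),
        X t *m A + A^t* *m X t + (K t)^t* *m s1 t *m K t = 0,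
        X t *m D t = (K t)^t* *m s1 t &
        realizes (fun z => 1%:M - S z t) A (K t) (D t)]].
Proof.
move=> s1_ac s1_unit s2_int g_int gs_int s1_herm s2_herm gs_herm S_rat S_maps S_inf.
move=> S_ineq S_sym t0I.
have [m [A [X0 [K0 [[X0h X0u] obs0 lyap0 real0]]]]] :=
  rational_realization (s1_herm _ t0I) (s1_unit _ t0I) (S_rat _ t0I) (S_inf _ t0I)
    (fun z => S_sym t0 z t0I).
have lJ2 := mx_cint_Js2 s1_ac s1_unit s2_int.
have lJg := mx_cint_Jg s1_ac s1_unit g_int.
have lJgs := mx_cint_Jgs s1_ac s1_unit gs_int.
have /mx_cintP l2 := s2_int.
have [K [acK K0E dK0]] := mx_ode_exists A K0 lJ2 lJgs t0I.
have dK : ae_on I (fun t => exists2 K', mx_deriv K t K' &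
    s1 t *m K' = s2 t *m K t *m A + gs t *m K t).
  apply: ae_onW dK0 => t tI h; eexists; first exact: h.
  by rewrite mulmxDr !mulmxA mulmxV ?s1_unit// !mul1mx.
have [T [acT T0E dT]] := mx_ode_exists (- A^T) ((invmx X0 *m K0^t* *m s1 t0)^T) (mx_cint_tr lJ2)
  (mx_cintN (mx_cint_tr lJg)) t0I.
have [D ED] : exists D, D = fun t => (T t)^T by eexists.
have acD : mx_loc_abs_cont I D by rewrite ED; exact: mx_ac_tr.
have D0E : D t0 = invmx X0 *m K0^t* *m s1 t0 by rewrite ED T0E trmxK.
have dD : ae_on I (fun t => mx_deriv D t
    (- (A *m D t *m invmx (s1 t) *m s2 t) - D t *m invmx (s1 t) *m g t)).
  apply: ae_onW dT => t tI h; have := mx_deriv_tr h; rewrite -ED.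
  have [P EP] : exists P, P = invmx (s1 t) *m s2 t by eexists.
  have [Q EQ] : exists Q, Q = invmx (s1 t) *m g t by eexists.
  rewrite -EP -EQ linearD /= !trmx_mul !linearN /= !trmxK.
  have -> : (T t)^T = D t by rewrite ED.
  by rewrite mulNmx EP EQ !mulmxA.
have lKK : mx_cint I (fun t => (K t)^t* *m s2 t *m K t).
  by apply: mx_cintM => //; apply: mx_cintMl => //; exact: mx_ac_adj.
have [X [acX X0E dX]] := mx_primitive_exists X0 (mx_cintN lKK) t0I.
have realt0 : realizes (fun z => 1%:M - S z t0) A (K t0) (D t0) by rewrite D0E K0E.
have real t (tI : t \in I) := transfer_constant s1_ac s1_unit s2_int g_int gs_int acK acD dK dD t0I
  S_rat S_maps S_inf realt0 tI.
have link := linkage s1_ac s1_unit s2_int g_int gs_int acK acD dK dD t0I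
  S_rat S_maps S_inf realt0.
have Xh t : t \in I -> (X t)^t* = X t.
  move=> tI; apply: (@mx_ac_eq _ I m m (fun t => (X t)^t*) X
    (fun t => - ((K t)^t* *m s2 t *m K t)) t0) => //.
  - exact: mx_ac_adj.
  - by rewrite X0E X0h.
  apply: ae_onW (ae_onI dX s2_herm) => s sI [h hs2]; split => //.
  by have := mx_deriv_adj h; rewrite adjmxN !adjmxM hs2 trmxCK mulmxA.
have lyap t : t \in I -> X t *m A + A^t* *m X t + (K t)^t* *m s1 t *m K t = 0.
  move=> tI.
  apply: (@mx_ac_eq _ I m m (fun t => X t *m A + A^t* *m X t + (K t)^t* *m s1 t *m K t)
    (fun=> 0) (fun=> 0) t0) => //.
  - apply: mx_acD; last by apply: mx_acM => //; apply: mx_acM => //; exact: mx_ac_adj.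
    by apply: mx_acD; apply: mx_acM => //; exact: mx_ac_cst.
  - exact: mx_ac_cst.
  - by rewrite X0E K0E.
  apply: ae_onW (ae_onI (ae_onI dX s2_herm) (ae_onI dK gs_herm)) => s sI.
  move=> [[hX hs2] [[K' hK KE] [s1' hs1 hgs]]].
  split; last exact: mx_deriv_cst.
  rewrite -(lyapunov_derivative (s1_herm _ sI) hs2 hgs KE).
  apply: mx_derivD; first by apply: mx_derivD; [exact: mx_derivMr|exact: mx_derivMl].
  by apply: mx_derivM => //; apply: mx_derivM => //; exact: mx_deriv_adj.
have XD t : t \in I -> X t *m D t = (K t)^t* *m s1 t.
  move=> tI; apply/eqP; rewrite -subr_eq0 -trmx_eq0; apply/eqP.
  apply: (@mx_ode_unique _ I n m _ _ (A^t* )^T (fun t => (X t *m D t - (K t)^t* *m s1 t)^T) t0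
    (mx_cint_tr lJ2) (mx_cintN (mx_cint_tr lJg))) => //.
  - apply: mx_ac_tr; apply: mx_acB; first exact: mx_acM.
    by apply: mx_acM => //; exact: mx_ac_adj.
  - by rewrite X0E D0E K0E !mulmxA mulmxV// mul1mx subrr trmx0.
  apply: ae_onW (ae_onI (ae_onI (ae_onI dX dD) (ae_onI s2_herm link)) (ae_onI dK gs_herm)) => s sI.
  move=> [[[hX hD] [hs2 L0]] [[K' hK KE] [s1' hs1 hgs]]].
  have E := state_adjoint_derivative (s1_herm _ sI) hs2 (s1_unit _ sI) hgs KE (lyap s sI) L0.
  have := mx_derivB (mx_derivM hX hD) (mx_derivM (mx_deriv_adj hK) hs1).
  by rewrite E => /mx_deriv_tr; rewrite trmx_sylvester.
(* For a fixed eigenvector [v] of [A], the output equation of [K] becomes a homogeneous linear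
   equation for [K s *m v]; a zero at [t] spreads to [t0]. *)
have obs t : t \in I -> observable A (K t).
  move=> tI a v Av Kv; apply: (obs0 a v Av).
  have lP : mx_cint I (fun t => a *: (invmx (s1 t) *m s2 t) + invmx (s1 t) *m gs t).
    by apply: mx_cintD => //; exact: mx_cintZ.
  rewrite -K0E; apply: (@mx_ode_unique _ I n 1 _ _ 0 (fun s => K s *m v) t
    (@mx_cint0 _ I n n) lP) => //.
    by apply: mx_acM => //; exact: mx_ac_cst.
  apply: ae_onW dK0 => s sI h; have := mx_derivMr v h.
  by rewrite mul0mx mul0mx add0r !mulmxDl -!mulmxA Av -!scalemxAr -scalemxAl !mulmxA.
exists m, A, K, D, X; split => // t tI.
(* The adjoint of [X D = K^* s1] is [D^* X = s1 K], so [K] vanishes on the kernel of [X]. *)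
have Xu : X t \in unitmx.
  apply: (gram_injective (obs t tI) (lyap t tI)) => v Xv.
  apply: (can_inj (mulKmx (s1_unit _ tI))); rewrite mulmx0 mulmxA.
  have := congr1 (fun M => M^t*) (XD t tI).
  rewrite !adjmxM (s1_herm _ tI) (Xh _ tI) trmxCK => <-.
  by rewrite -mulmxA Xv mulmx0.
split => //; first exact: Xh.
- have DE : D t = invmx (X t) *m (K t)^t* *m s1 t by rewrite -mulmxA -(XD t tI) mulKmx.
  apply: (rational_posdef (s1_herm _ tI) (s1_unit _ tI) (S_rat _ tI)
    (fun z => S_ineq t z tI) (Xh _ tI) Xu (obs t tI) (lyap t tI)).
  by rewrite -DE; exact: real.
- exact: lyap.
- exact: XD.
- exact: real.
Qed.

End StateSpace.

(** * The inner space with a given Gram matrix *)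

Section GramSpace.
Context {R : realType}.
Local Notation C := R[i].

(** The two proofs are arguments so that the dot product structure, which rests on them, can be
    inferred from the form. *)
Definition gram_form m (X : 'M[C]_m) (_ : X^t* = X) (_ : posdef X) (x y : 'cV[C]_m) : C :=
  (y^t* *m X *m x) 0 0.

Section Form.
Context (m : nat) (X : 'M[C]_m) (X_herm : X^t* = X) (X_pos : posdef X).
Local Notation form := (gram_form X_herm X_pos).

Lemma gram_form_bilinear : bilinear_for ( *%R ) (@Num.conj C \; *%R) form.
Proof.
split=> [y a u v|x a u v]; rewrite /gram_form.
  by rewrite mulmxDr mxE -scalemxAr mxE.
by rewrite adjmxD adjmxZ !mulmxDl mxE -!scalemxAl mxE.
Qed.

HB.instance Definition _ := bilinear_isBilinear.Build C 'cV[C]_m 'cV[C]_m C ( *%R )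
  (@Num.conj C \; *%R) form gram_form_bilinear.

Lemma gram_form_hermitian x y : form x y = (-1) ^+ false * Num.conj (form y x).
Proof.
rewrite expr0 mul1r /gram_form -[in RHS]adjmx_entry !adjmxM X_herm trmxCK.
by rewrite mulmxA.
Qed.

HB.instance Definition _ := isHermitianSesquilinear.Build C 'cV[C]_m false (@Num.conj C) form
  gram_form_hermitian.

Lemma gram_form_gt0 x : x != 0 -> 0 < form x x.
Proof. exact: X_pos. Qed.

HB.instance Definition _ := isDotProduct.Build C 'cV[C]_m form gram_form_gt0.

Definition gram_dot : {dot 'cV[C]_m for @Num.conj C} := form.

Lemma gram_dotE x y : gram_dot x y = (y^t* *m X *m x) 0 0.
Proof. by []. Qed.

End Form.

Definition equiv_norm m (p : 'cV[C]_m -> R) : Prop :=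
  exists2 c : R, 0 <= c & forall x,
    [/\ 0 <= p x, snorm x <= c * p x & p x <= c * snorm x].

Lemma snorm_adj m n (A : 'M[C]_(m, n)) : snorm (A^t* ) = snorm A.
Proof.
rewrite /snorm exchange_big /=; apply: eq_bigr => i _; apply: eq_bigr => j _.
by rewrite !mxE cReJ cImJ normrN.
Qed.

(** The coordinate [x i 0] is the inner product of [x] with [w i = X^-1 delta_i], so Cauchy-Schwarz
    bounds it by the norm; submultiplicativity of [snorm] gives the converse estimate. *)
Lemma gram_equiv_norm m (X : 'M[C]_m) (Xh : X^t* = X) (Xp : posdef X) :
  equiv_norm (dot_norm (gram_dot Xh Xp)).
Proof.
have Xu := posdef_unit Xp.
pose w i : 'cV[C]_m := invmx X *m delta_mx i 0.
have dotw x i : gram_dot Xh Xp x (w i) = x i 0.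
  rewrite gram_dotE /w adjmxM adjmx_inv Xh -!mulmxA (mulmxA (invmx X)) mulVmx// mul1mx.
  have -> : (delta_mx i 0 : 'cV[C]_m)^t* = delta_mx 0 i.
    by rewrite trmx_delta; apply/matrixP => a b; rewrite !mxE rmorph_nat.
  by rewrite -rowE mxE.
have dot0 x : gram_dot Xh Xp x x = ((complex.Re (gram_dot Xh Xp x x))%:C)%C.
  have : 0 <= gram_dot Xh Xp x x by exact: dnorm_ge0.
  by case: (gram_dot _ _ _ _) => a b; rewrite lecE /= => /andP[/eqP -> _].
have Re0 x : 0 <= complex.Re (gram_dot Xh Xp x x).
  by rewrite -lecR -dot0; exact: dnorm_ge0.
pose p := dot_norm (gram_dot Xh Xp).
have p0 x : 0 <= p x by exact: sqrtr_ge0.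
have le_w (x : 'cV[C]_m) (i : 'I_m) : Normc.normc (x i 0) <= p x * p (w i).
  rewrite -(@ler_pXn2r _ 2)// ?nnegrE ?mulr_ge0 ?normc_ge0//.
  rewrite exprMn !sqr_sqrtr ?Re0//.
  have h : `|gram_dot Xh Xp x (w i)| ^+ 2 <= gram_dot Xh Xp x x * gram_dot Xh Xp (w i) (w i).
    exact: (CauchySchwarz (gram_dot Xh Xp) x (w i)).1.
  by move: h; rewrite dotw norm_normc (dot0 x) (dot0 (w i)) -rmorphXn -rmorphM /= lecR.
pose c1 := 2 * \sum_i p (w i); pose c2 := Num.sqrt (snorm X).
have c10 : 0 <= c1 by rewrite mulr_ge0// sumr_ge0.
have c20 : 0 <= c2 by exact: sqrtr_ge0.
exists (c1 + c2); first exact: addr_ge0.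
move=> x; split; first exact: p0.
  apply: (@le_trans _ _ (c1 * p x)); last by rewrite ler_wpM2r// lerDl.
  rewrite /snorm /c1 -mulrA mulr_suml mulr_sumr; apply: ler_sum => i _.
  rewrite big_ord1; have := Re_le_normc (x i 0); have := Im_le_normc (x i 0).
  have := le_w x i; rewrite [p x * _]mulrC; lra.
apply: (@le_trans _ _ (c2 * snorm x)); last by rewrite ler_wpM2r ?snorm_ge0// lerDr.
rewrite -(@ler_pXn2r _ 2)// ?nnegrE ?mulr_ge0 ?snorm_ge0 ?sqrtr_ge0//.
rewrite exprMn !sqr_sqrtr ?Re0 ?snorm_ge0//.
have h : `|complex.Re (gram_dot Xh Xp x x)| <= snorm (x^t* *m X *m x).
  exact: (part_le_snorm _ true).
rewrite (le_trans (ler_norm _))// (le_trans h)// (le_trans (snormM _ _))//.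
rewrite expr2 mulrA ler_wpM2r ?snorm_ge0// (le_trans (snormM _ _))// snorm_adj.
by rewrite mulrC.
Qed.

Lemma enorm_equiv_norm m : equiv_norm (@enorm R m).
Proof.
have h1 : (1%:M : 'M[C]_m)^t* = 1%:M by rewrite adjmx_scalar conjC1.
have -> : @enorm R m = dot_norm (gram_dot h1 (@posdef1 C m)).
  by apply/funext => x; rewrite /enorm /dot_norm gram_dotE mulmx1.
exact: gram_equiv_norm.
Qed.

Lemma real_cauchy_limit (u : nat -> R) :
  (forall e, 0 < e -> exists N, forall i j, (N <= i)%N -> (N <= j)%N -> `|u i - u j| < e) ->
  exists l, forall e, 0 < e -> exists N, forall i, (N <= i)%N -> `|u i - l| < e.
Proof.
move=> uc; have : cvg (u @ \oo).
  apply/cauchy_cvgP/cauchy_ballP => e e0; have [N hN] := uc e e0.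
  exists ([set u k | k in [set k | (N <= k)%N]], [set u k | k in [set k | (N <= k)%N]]).
    by split; exists N => // k Nk; exists k.
  by move=> [_ _] /= [[i Ni <-] [j Nj <-]]; exact: hN.
move=> ul; exists (lim (u @ \oo)) => e e0.
have /cvgrPdist_lt/(_ e e0)[N _ hN] := ul.
by exists N => i Ni; rewrite distrC; exact: hN.
Qed.

Lemma small_multiple (c e : R) (k : nat) : 0 <= c -> 0 < e ->
  exists2 d, 0 < d & c * (k%:R * d) < e.
Proof.
move=> c0 e0; have k1 : 0 < k%:R + 1 :> R by rewrite ltr_wpDl.
have c1 : 0 < (c + 1) * (k%:R + 1) by rewrite mulr_gt0// ltr_wpDl.
exists (e / ((c + 1) * (k%:R + 1))); first exact: divr_gt0.
rewrite !mulrA ltr_pdivrMr// -subr_gt0.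
have -> : e * ((c + 1) * (k%:R + 1)) - c * k%:R * e = e * (c + k%:R + 1) by ring.
by rewrite mulr_gt0// ltr_wpDl// addr_ge0.
Qed.

Lemma equiv_norm_complete m (p : 'cV[C]_m -> R) : equiv_norm p -> complete_for p.
Proof.
move=> [c c0 hc] u uc.
have c1 : 0 < c + 1 by rewrite ltr_wpDl.
have /choice[l hl] (x : bool * 'I_m) : exists l, forall e, 0 < e ->
    exists N, forall i, (N <= i)%N -> `|part x.1 (u i x.2 0) - l| < e.
  apply: real_cauchy_limit => e e0.
  have [N hN] := uc (e / (c + 1)) (divr_gt0 e0 c1); exists N => i j Ni Nj.
  have h := part_le_snorm (u i - u j) x.1 x.2 0; have [p0 h1 _] := hc (u i - u j).
  have -> : part x.1 (u i x.2 0) - part x.1 (u j x.2 0) = part x.1 ((u i - u j) x.2 0).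
    by rewrite !mxE; case: x.1; rewrite /= ?cReD ?cImD ?cReN ?cImN.
  rewrite (le_lt_trans h)// (le_lt_trans h1)//.
  by have := hN i j Ni Nj; rewrite ltr_pdivlMr//; nra.
exists (\col_i (l (true, i) +i* l (false, i))%C) => e e0.
have [d d0 hd] := small_multiple #|{: bool * ('I_m * 'I_1)}| c0 e0.
have /choice[N hN] (x : bool * 'I_m) : exists N, forall i, (N <= i)%N ->
    `|part x.1 (u i x.2 0) - l x| < d by exact: hl.
exists (\max_x N x)%N => i Ni; set v := u i - _; have [_ _ h] := hc v.
rewrite (le_lt_trans h)//.
apply: le_lt_trans hd; rewrite ler_wpM2l// snormE mulr_natl -sumr_const.
apply: ler_sum => -[b [j k]] _ /=.
have /ltW := hN (b, j) i (leq_trans (leq_bigmax (b, j)) Ni); rewrite (ord1 k) /v !mxE.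
by case: b; rewrite /= ?cReD ?cImD ?cReN ?cImN.
Qed.

Section Operators.
Context (m n : nat) (p : 'cV[C]_m -> R) (q : 'cV[C]_n -> R).
Context (p_eqv : equiv_norm p) (q_eqv : equiv_norm q).
Implicit Types (I : interval R) (M : R -> 'M[C]_(n, m)).

Lemma mulmx_bound : exists2 c : R, 0 <= c &
  forall (M : 'M[C]_(n, m)) x, q (M *m x) <= c * snorm M * p x.
Proof.
have [c c0 hc] := p_eqv; have [d d0 hd] := q_eqv.
exists (d * c); first exact: mulr_ge0.
move=> M x; have [_ _ h] := hd (M *m x); have [_ h1 _] := hc x.
rewrite (le_trans h)// -!mulrA ler_wpM2l// (le_trans (snormM _ _))// mulrCA.
by rewrite ler_wpM2l// snorm_ge0.
Qed.

Lemma mulmx_bounded_op (M : 'M[C]_(n, m)) : bounded_op p q (mulmx M).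
Proof. by have [c c0 h] := mulmx_bound; exists (c * snorm M) => x; exact: h. Qed.

Lemma op_norm_mulmx : exists2 c : R, 0 <= c &
  forall M : 'M[C]_(n, m), op_norm p q (mulmx M) <= c * snorm M.
Proof.
have [c c0 h] := mulmx_bound; exists c => // M.
have [d d0 hd] := p_eqv.
apply: ge_sup.
  exists (q (M *m 0)); exists 0 => //=; have [_ _ ] := hd 0.
  by rewrite snorm0 mulr0 => /le_trans; apply.
by move=> _ [x /= px <-]; rewrite (le_trans (h M x))// ler_piMr// mulr_ge0// snorm_ge0.
Qed.

Lemma op_loc_abs_cont_mulmx I (G : R -> 'cV[C]_m -> 'cV[C]_n) M :
  (forall s, s \in I -> forall x, G s x = M s *m x) -> mx_loc_abs_cont I M ->
  op_loc_abs_cont p q I G.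
Proof.
move=> GM /mx_acP acM; have [c c0 hc] := op_norm_mulmx.
pose gg (x : bool * ('I_n * 'I_m)) t := part x.1 (M t x.2.1 x.2.2).
apply: (@ac_dominated _ _ _ I _ gg).
  by move=> [[] [i j]]; have [] := acM i j.
move=> a b aI bI; exists c => // s t as_ st tb.
have sI : s \in I by exact: itv_mid aI bI as_ (le_trans st tb).
have tI : t \in I by exact: itv_mid aI bI (le_trans as_ st) tb.
have -> : (fun x => G s x - G t x) = mulmx (M s - M t).
  by apply/funext => x; rewrite GM// GM// mulmxBl.
rewrite (le_trans (hc _))// ler_wpM2l// snormE ler_sum// => -[b' [i j]] _.
by rewrite /gg /= !mxE; case: b'; rewrite /= ?cReD ?cImD ?cReN ?cImN.
Qed.

Lemma op_deriv_mulmx (G : R -> 'cV[C]_m -> 'cV[C]_n) M t (D : 'M[C]_(n, m)) :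
  (exists2 r, 0 < r & forall s, `|s - t| < r -> forall x, G s x = M s *m x) ->
  mx_deriv M t D -> op_deriv p q G t (mulmx D).
Proof.
move=> [r r0 GM] dM; split; first exact: mulmx_bounded_op.
have [c c0 hc] := op_norm_mulmx.
move=> e e0; have [d d0 hd] := small_multiple #|{: bool * ('I_n * 'I_m)}| c0 e0.
have /choice[dl hdl] (x : bool * ('I_n * 'I_m)) : exists r, 0 < r /\ forall s, `|s - t| < r ->
    `|part x.1 (M s x.2.1 x.2.2) - part x.1 (M t x.2.1 x.2.2) - part x.1 (D x.2.1 x.2.2) * (s - t)|
      <= d * `|s - t|.
  have [h1 h2] := dM x.2.1 x.2.2; case: x h1 h2 => -[] [i j] /= h1 h2.
    by have /is_derive_dist/(_ _ d0)[r' r'0 hr] := h1; exists r'.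
  by have /is_derive_dist/(_ _ d0)[r' r'0 hr] := h2; exists r'.
pose rr := Num.min r (\big[Num.min/1]_x dl x).
have rr0 : 0 < rr.
  rewrite lt_min r0 /=; apply: (big_ind (fun z => 0 < z)) => //.
    by move=> x y x0 y0; rewrite lt_min x0.
  by move=> x _; case: (hdl x).
apply/nbhs_ballP; exists rr => //= s; rewrite /ball /= distrC => st.
have [sr sdl] : `|s - t| < r /\ forall x, `|s - t| < dl x.
  move: st; rewrite lt_min => /andP[sr sd]; split => // x.
  by apply: lt_le_trans sd _; exact: bigmin_le_cond.
have -> : (fun x => G s x - G t x - (s - t)%:C%C *: (D *m x)) =
    mulmx (M s - M t - (s - t)%:C%C *: D).
  apply/funext => x; rewrite GM// GM ?subrr ?normr0// !mulmxBl.
  by rewrite -scalemxAl.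
rewrite (le_trans (hc _))//.
have hs : snorm (M s - M t - (s - t)%:C%C *: D) <= #|{: bool * ('I_n * 'I_m)}|%:R * (d * `|s - t|).
  rewrite snormE mulr_natl -sumr_const; apply: ler_sum => x _.
  have [_ /(_ s (sdl x))] := hdl x; congr (`| _ | <= _); rewrite !mxE.
  by case: x.1; rewrite /= ?cReD ?cImD ?cReN ?cImN ?cReD ?cImD ?cReN ?cImN ?ReM ?ImM /=; ring.
by rewrite (le_trans (ler_wpM2l c0 hs))// !mulrA ler_wpM2r// -mulrA ltW.
Qed.

End Operators.
End GramSpace.

(** The operator [F^* B s2 B^* F] read in Gram matrices: [X0^-1 X] is the adjoint of the identity
    between the two inner products, and [X D = K^* s1] absorbs [D s1^-1]. *)
Lemma metric_integrand (F : numClosedFieldType) m n (X0 X : 'M[F]_m) (D : 'M[F]_(m, n))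
    (K : 'M[F]_(n, m)) (s1 s2 : 'M[F]_n) (x y : 'cV[F]_m) :
  X0 \in unitmx -> s1 \in unitmx -> X *m D = K^t* *m s1 ->
  y^t* *m X0 *m (invmx X0 *m X *m (D *m invmx s1 *m (s2 *m (K *m x)))) =
  y^t* *m (K^t* *m s2 *m K) *m x.
Proof.
move=> uX us XD; rewrite -!mulmxA (mulKVmx uX) [X *m _]mulmxA XD -!mulmxA.
by rewrite (mulKVmx us).
Qed.

(** * The vessel of a family of Gram matrices *)

Section Vessel.
Context {R : realType}.
Local Notation C := R[i].

Definition gram_hilbert m (X : 'M[C]_m) (Xh : X^t* = X) (Xp : posdef X) : hilbert R :=
  Hilbert (equiv_norm_complete (gram_equiv_norm Xh Xp)).

Context (n m : nat) (A : 'M[C]_m) (s1 : R -> 'M[C]_n) (K : R -> 'M[C]_(n, m))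
  (D : R -> 'M[C]_(m, n)) (X : R -> 'M[C]_m).
Context (X_herm : forall t, (X t)^t* = X t) (X_pos : forall t, posdef (X t)).

(* The evolution is trivial; the adjoints are those of the Gram matrices [X t]. *)
Definition gram_vessel : vessel R n := @Vessel R n
  (fun t => gram_hilbert (X_herm t) (X_pos t))
  (fun _ => mulmx A : {linear 'cV[C]_m -> 'cV[C]_m})
  (fun t => mulmx (invmx (X t) *m A^t* *m X t) : {linear 'cV[C]_m -> 'cV[C]_m})
  (fun _ _ => mulmx 1%:M : {linear 'cV[C]_m -> 'cV[C]_m})
  (fun t s => mulmx (invmx (X s) *m X t) : {linear 'cV[C]_m -> 'cV[C]_m})
  (fun t => mulmx (D t *m invmx (s1 t)) : {linear 'cV[C]_n -> 'cV[C]_m})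
  (fun t => mulmx (K t) : {linear 'cV[C]_m -> 'cV[C]_n}).

Context (I : interval R) (s2 g gs : R -> 'M[C]_n).
Context (s1_unit : forall t, t \in I -> s1 t \in unitmx).
Context (K_ac : mx_loc_abs_cont I K) (D_ac : mx_loc_abs_cont I D)
  (X_ac : mx_loc_abs_cont I X) (KK_int : mx_cint I (fun t => (K t)^t* *m s2 t *m K t)).
Context (K_deriv : ae_on I (fun t => exists2 K', mx_deriv K t K' &
   s1 t *m K' = s2 t *m K t *m A + gs t *m K t)).
Context (D_deriv : ae_on I (fun t => mx_deriv D t
   (- (A *m D t *m invmx (s1 t) *m s2 t) - D t *m invmx (s1 t) *m g t))).
Context (X_deriv : ae_on I (fun t => mx_deriv X t (- ((K t)^t* *m s2 t *m K t)))).
Context (link : ae_on I (fun t => gs t - g t + s1 t *m K t *m D t *m invmx (s1 t) *m s2 t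
   - s2 t *m K t *m D t = 0)).
Context (lyap : forall t, t \in I -> X t *m A + A^t* *m X t + (K t)^t* *m s1 t *m K t = 0).
Context (XD : forall t, t \in I -> X t *m D t = (K t)^t* *m s1 t).

Lemma X_unit t : X t \in unitmx.
Proof. exact: posdef_unit. Qed.

Lemma hnorm_equiv t : equiv_norm (hnorm (vH gram_vessel t)).
Proof. exact: gram_equiv_norm. Qed.

Lemma oint_ext a b (f h : R -> C) : a \in I -> b \in I -> (forall s, s \in I -> f s = h s) ->
  oint a b f = oint a b h.
Proof.
move=> aI bI fh.
have E (part : C -> R) x y : x \in I -> y \in I ->
    Rintegral (@lebesgue_measure R) `[x, y] (fun s => part (f s)) =
    Rintegral (@lebesgue_measure R) `[x, y] (fun s => part (h s)).
  move=> xI yI; apply: eq_Rintegral => s; rewrite inE /= in_itv /= => /andP[xs sy].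
  by rewrite fh//; exact: itv_mid xI yI xs sy.
by rewrite /oint; case: ifP => _; rewrite !(E (@complex.Re R)) ?(E (@complex.Im R)).
Qed.

(** The fundamental theorem of calculus for [X' = - K^* s2 K]: with trivial evolution the metric
    condition only records the change of the inner product. *)
Lemma gram_metric t t0 (x y : 'cV[C]_m) : t \in I -> t0 \in I ->
  (y^t* *m X t *m x) 0 0 = (y^t* *m X t0 *m x) 0 0 -
    oint t0 t (fun s => (y^t* *m ((K s)^t* *m s2 s *m K s) *m x) 0 0).
Proof.
move=> tI t0I.
pose f s := (- (y^t* *m X s *m x)) 0 0.
have fE s : f s = - (y^t* *m X s *m x) 0 0 by rewrite /f mxE.
have fac : cac I f.
  have : mx_loc_abs_cont I (fun s => - (y^t* *m X s *m x)).
    by apply: mx_acN; apply: mx_acM; [apply: mx_acM => //|]; exact: mx_ac_cst.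
  by move=> /mx_acP/(_ 0 0).
have hint := mx_cintM (mx_cintMl (@mx_ac_cst R I _ _ (y^t* )) KK_int) (@mx_ac_cst R I _ _ x).
have fd : ae_on I (fun s => cderive f s ((y^t* *m ((K s)^t* *m s2 s *m K s) *m x) 0 0)).
  apply: ae_onW X_deriv => s sI hX.
  have := mx_derivN (mx_derivMr x (mx_derivMl (y^t* ) hX)) => /(_ 0 0).
  by rewrite mulmxN mulNmx opprK.
rewrite (oint_derive fac (hint 0 0) fd t0I tI) !fE.
by rewrite opprK opprD opprK addrC subrK.
Qed.

Lemma gram_vessel_conservative : conservative I s1 s2 g gs gram_vessel.
Proof.
split.
- by move=> t tI; exact: (mulmx_bounded_op (hnorm_equiv t) (hnorm_equiv t)).
- by move=> t tI; exact: (mulmx_bounded_op (@enorm_equiv_norm R n) (hnorm_equiv t)).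
- by move=> t s tI sI; exact: (mulmx_bounded_op (hnorm_equiv s) (hnorm_equiv t)).
- move=> t tI x y; rewrite /= !gram_dotE !adjmxM trmxCK adjmx_inv X_herm !mulmxA.
  by rewrite mulmxKV// X_unit.
(* [X D = K^* s1] is exactly the adjointness of [D s1^-1] and [K]. *)
- move=> t tI x y; rewrite /= /edot gram_dotE !adjmxM -!mulmxA; congr ((_ *m _) 0 0).
  by rewrite !mulmxA XD// mulmxK// s1_unit.
- move=> t s tI sI x y; rewrite /= !gram_dotE !adjmxM adjmx_inv !X_herm mul1mx !mulmxA.
  by rewrite mulmxKV// X_unit.
- by move=> t s r tI sI rI x; rewrite /= !mul1mx.
- by move=> t tI x; rewrite /= mul1mx.
- apply: ae_on_all => t tI.
  apply: (op_loc_abs_cont_mulmx (@enorm_equiv_norm R n) (hnorm_equiv t) (M := D)) => //.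
  by move=> s sI x; rewrite /= mul1mx mulmxA mulmxKV// s1_unit.
- apply: ae_on_all => t tI.
  apply: (op_loc_abs_cont_mulmx (hnorm_equiv t) (@enorm_equiv_norm R n) (M := K)) => //.
  by move=> s sI x; rewrite /= mul1mx.
(* Multiplied by [X t], the colligation condition becomes the Lyapunov equation. *)
- move=> t tI x /=; apply: (can_inj (mulKmx (X_unit t))).
  rewrite mulmx0 !mulmxDr !mulmxA mulmxV ?X_unit// mul1mx mulmxKV ?s1_unit// XD//.
  by rewrite -!mulmxDl lyap// mul0mx.
- move=> t t0 tI t0I x y; rewrite /= !gram_dotE mul1mx !mulmxA (mulmxK (X_unit t0)).
  rewrite (gram_metric x y tI t0I); congr (_ - _); apply: oint_ext => // s sI.
  by rewrite gram_dotE metric_integrand ?X_unit ?s1_unit ?XD.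
- by move=> t t0 tI t0I x; rewrite /= !mul1mx.
- move=> t0 t0I; apply: ae_onW (ae_onI D_deriv (@ae_on_interior R I)) => t tI [hD [r r0 hr]].
  exists (mulmx (- (A *m D t *m invmx (s1 t) *m s2 t) - D t *m invmx (s1 t) *m g t)
    : {linear 'cV[C]_n -> 'cV[C]_m}).
    apply: (op_deriv_mulmx (@enorm_equiv_norm R n) (hnorm_equiv t0) _ hD).
    by exists r => // s /hr sI x; rewrite /= mul1mx mulmxA mulmxKV// s1_unit.
  have key (e : 'cV[C]_n) :
      (- (A *m D t *m invmx (s1 t) *m s2 t) - D t *m invmx (s1 t) *m g t) *m e +
      A *m (D t *m invmx (s1 t) *m (s2 t *m e)) + D t *m invmx (s1 t) *m (g t *m e) = 0.
    by rewrite !mulmxA mulmxBl mulNmx -opprD -addrA addNr.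
  by move=> e; rewrite /= !mul1mx; exact: key.
- move=> t0 t0I; apply: ae_onW K_deriv => t tI [K' hK KE].
  exists (mulmx K' : {linear 'cV[C]_m -> 'cV[C]_n}).
    apply: (op_deriv_mulmx (hnorm_equiv t0) (@enorm_equiv_norm R n) _ hK).
    by exists 1 => // s _ x; rewrite /= mul1mx.
  by move=> x; rewrite /= !mul1mx !mulmxA KE mulmxDl addrAC addrK subrr.
- apply: ae_onW link => t tI L0 e.
  rewrite /= !mulmxA (mulmxKV (s1_unit tI)) -[LHS]subr0 -[0](mul0mx _ e) -L0.
  rewrite !mulmxBl !mulmxDl mulNmx.
  move: (gs t *m e) (g t *m e) (s1 t *m _ *m _ *m _ *m _ *m e) (s2 t *m _ *m _ *m e) => a b c d.
  by apply/matrixP => i j; rewrite !mxE; ring.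
Qed.

Lemma gram_vessel_transfer (S : C -> R -> 'M[C]_n) :
  (forall t, t \in I -> realizes (fun z => 1%:M - S z t) A (K t) (D t)) ->
  transfer_function I s1 gram_vessel S.
Proof.
move=> real t tI z Q [_ hQ] an e.
have [q [q1 q2 qE]] : exists q : 'cV[C]_m -> 'cV[C]_m,
    [/\ forall x, q (z *: x - A *m x) = x, forall x, z *: q x - A *m q x = x & q = Q].
  by exists Q; split => // x; [exact: (proj1 (hQ x))|exact: (proj2 (hQ x))].
suff : S z t *m e = e - K t *m q (D t *m invmx (s1 t) *m (s1 t *m e)) by rewrite qE.
have uz : z%:M - A \in unitmx.
  apply: unitmx_injective => v; rewrite mulmxBl mul_scalar_mx => Av.
  by have := q1 0; rewrite scaler0 mulmx0 subr0 -Av q1.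
have {}qE x : q x = invmx (z%:M - A) *m x.
  apply: (can_inj (mulKmx uz)); rewrite mulKVmx//.
  by rewrite mulmxBl mul_scalar_mx q2.
rewrite qE (analytic_realization (real t tI) an uz) mulmxBl mul1mx !mulmxA.
by rewrite mulmxKV// s1_unit.
Qed.

Lemma gram_vessel_coordinates : inner_coordinates I gram_vessel A K X.
Proof.
exists (fun _ => mulmx 1%:M : {linear 'cV[C]_m -> 'cV[C]_m}) => t tI; split.
- by exists (mulmx 1%:M) => x; rewrite /= !mul1mx.
- by move=> s u sI; rewrite /= !mul1mx.
- by move=> u; rewrite /= !mul1mx.
- by move=> u; rewrite /= !mul1mx.
- by move=> u v; rewrite /= gram_dotE !mul1mx.
Qed.

(** Since [X D = K^* s1], the product [gram_adjoint X K *m s1] is [D]; the formula is the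
    realization with the sign of the resolvent reversed. *)
Lemma gram_vessel_formula (S : C -> R -> 'M[C]_n) t z :
  (forall t, t \in I -> realizes (fun z => 1%:M - S z t) A (K t) (D t)) ->
  t \in I -> analytic_at (S ^~ t) z -> A - z%:M \in unitmx ->
  S z t = 1%:M + K t *m invmx (A - z%:M) *m gram_adjoint (X t) (K t) *m s1 t.
Proof.
move=> real tI an uz.
have uz' : z%:M - A \in unitmx by rewrite -opprB -scaleN1r unitmxZ ?unitrN1.
have -> : invmx (A - z%:M) = - invmx (z%:M - A).
  apply: (can_inj (mulKmx uz)); rewrite mulmxV// mulmxN -mulNmx opprB mulmxV//.
rewrite (analytic_realization (real t tI) an uz') mulmxN !mulNmx /gram_adjoint.
by congr (_ - _); rewrite -!mulmxA -(XD tI) mulKmx// X_unit.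
Qed.

End Vessel.

Theorem theorem9p1 (R : realType) (n : nat) (I : interval R)
  (s1 s2 g gs : R -> 'M[R[i]]_n) (S : R[i] -> R -> 'M[R[i]]_n)
  (s1_ac : mx_loc_abs_cont I s1)
  (s1_unit : forall t, t \in I -> s1 t \in unitmx)
  (s2_int : mx_loc_integrable I s2)
  (g_int : mx_loc_integrable I g)
  (gs_int : mx_loc_integrable I gs)
  (s1_herm : forall t, t \in I -> (s1 t)^t* = s1 t)
  (s2_herm : ae_on I (fun t => (s2 t)^t* = s2 t))
  (g_herm : ae_on I (fun t =>
     exists2 s1', mx_deriv s1 t s1' & (g t)^t* = - g t - s1'))
  (gs_herm : ae_on I (fun t =>
     exists2 s1', mx_deriv s1 t s1' & (gs t)^t* = - gs t - s1'))
  (S_rational : forall t, t \in I -> rationalmx (S ^~ t))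
  (S_maps : maps_solutions I s1 s2 g gs S)
  (S_infty : forall t, t \in I -> lim_at_infinity (S ^~ t) 1%:M)
  (S_ineq : forall t z, t \in I -> analytic_at (S ^~ t) z -> complex.Re z < 0 ->
     psdmx (S z t *m invmx (s1 t) *m (S z t)^t* - invmx (s1 t)))
  (S_sym : forall t z, t \in I -> analytic_at (S ^~ t) z ->
     analytic_at (S ^~ t) (- Num.conj z) ->
     S z t *m invmx (s1 t) *m (S (- Num.conj z) t)^t* = invmx (s1 t)) :
  exists2 V : vessel R n,
    conservative I s1 s2 g gs V /\ transfer_function I s1 V S &
    exists (m : nat) (A1 : 'M[R[i]]_m) (C : R -> 'M[R[i]]_(n, m))
      (X : R -> 'M[R[i]]_m),
    [/\ inner_coordinates I V A1 C X,
        forall t z, t \in I -> analytic_at (S ^~ t) z ->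
          A1 - z%:M \in unitmx ->
          S z t = 1%:M +
            C t *m invmx (A1 - z%:M) *m gram_adjoint (X t) (C t) *m s1 t,
        mx_loc_abs_cont I C &
        ae_on I (fun t => exists2 C', mx_deriv C t C' &
          s1 t *m C' = s2 t *m C t *m A1 + gs t *m C t)].
Proof.
(* An empty interval has no base point; the vessel with zero-dimensional inner spaces then
   serves. *)
have [[t0 t0I]|I0] := pselect (exists t, t \in I); last first.
  have nI t : t \in I -> False by move=> tI; apply: I0; exists t.
  have h1 : (1%:M : 'M[R[i]]_0)^t* = 1%:M by rewrite adjmx_scalar conjC1.
  exists (gram_vessel 0 s1 (fun=> 0) (fun=> 0) (fun=> h1) (fun=> @posdef1 _ 0)).
    split; last by move=> t /nI.
    apply: gram_vessel_conservative; try (by move=> t /nI); try exact: mx_ac_cst;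
      try (by apply: ae_on_all => t /nI).
    by move=> i; case: i.
  exists 0%N, 0, (fun=> 0), (fun=> 1%:M); split.
  - exact: gram_vessel_coordinates.
  - by move=> t z /nI.
  - exact: mx_ac_cst.
  - by apply: ae_on_all => t /nI.
have [m [A [K [D [X [[acK acD acX lKK] [dK dD dX link] hX]]]]]] :=
  state_space s1_ac s1_unit s2_int g_int gs_int s1_herm s2_herm gs_herm S_rational S_maps
    S_infty S_ineq S_sym t0I.
(* A vessel carries a Hilbert space at every real time, so the Gram matrix is continued outside [I]
   by the identity. *)
have [Y [Yh Yp YX]] : exists Y : R -> 'M[R[i]]_m,
    [/\ forall t, (Y t)^t* = Y t, forall t, posdef (Y t) & forall t, t \in I -> X t = Y t].
  exists (fun t => if t \in I then X t else 1%:M); split => t.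
  - by case: ifP => [/hX[]//|_]; rewrite adjmx_scalar conjC1.
  - by case: ifP => [/hX[]//|_]; exact: posdef1.
  - by move=> ->.
have acY := mx_ac_ext YX acX.
have dY : ae_on I (fun t => mx_deriv Y t (- ((K t)^t* *m s2 t *m K t))).
  apply: ae_onW (ae_onI dX (@ae_on_interior R I)) => t tI [h [r r0 hr]].
  by apply: mx_deriv_ext h; exists r => // s /hr /YX.
have hY t : t \in I -> [/\ Y t *m A + A^t* *m Y t + (K t)^t* *m s1 t *m K t = 0,
    Y t *m D t = (K t)^t* *m s1 t & realizes (fun z => 1%:M - S z t) A (K t) (D t)].
  by move=> tI; have [_ _] := hX t tI; rewrite -YX.
have real t (tI : t \in I) : realizes (fun z => 1%:M - S z t) A (K t) (D t) by have [] := hY t tI.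
have YD t (tI : t \in I) : Y t *m D t = (K t)^t* *m s1 t by have [] := hY t tI.
exists (gram_vessel A s1 K D Yh Yp).
  split; last exact: (gram_vessel_transfer s1_unit real).
  by apply: gram_vessel_conservative => // t /hY[].
exists m, A, K, Y; split => //; first exact: gram_vessel_coordinates.
by move=> t z tI an uz; exact: (gram_vessel_formula Yp YD real tI an uz).
Qed.
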